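(* Let $g>0$ and let $\gamma:\mathbb{R}\to[0,\infty)$, $s\mapsto\gamma_s$, be smooth with $\gamma_s$, $\dot\gamma_s$, $\ddot\gamma_s$ bounded continuous functions, and set $\gamma:=\sup_s\gamma_s$. For $s\in\mathbb{R}$ let $$H_s=\frac12\begin{pmatrix} s& g\\ g& -s\end{pmatrix}=e_s(P_s^+-P_s^-),\qquad e_s=\tfrac12\sqrt{s^2+g^2},$$ with $P_s^\pm$ the eigenprojections of $H_s$ for the eigenvalues $\pm e_s$, and let $\mathcal{L}_s\rho=-i[H_s,\rho]-\frac{\gamma_s}{2}[\sqrt{H_s},[\sqrt{H_s},\rho]]$, where $\sqrt{H_s}:=\operatorname{sgn}(H_s)\sqrt{|H_s|}$. For $\epsilon>0$ let $\mathcal{U}_\epsilon(s,s')$, $s\geq s'$, be the propagator defined by $\epsilon\,\partial_s\mathcal{U}_\epsilon(s,s')=\mathcal{L}_s\mathcal{U}_\epsilon(s,s')$, $\mathcal{U}_\epsilon(s',s')=\mathbb{1}$, and let the transition probability be $$p(\epsilon,\gamma)=\lim_{T\to\infty}\operatorname{tr}\big(P_T^+\,\mathcal{U}_\epsilon(T,-T)P_{-T}^-\big).$$ Then $$p(\epsilon,\gamma)=\exp\Big(-\pi\frac{g^2}{2\epsilon}\Big)+\epsilon\int_{-\infty}^{\infty}\frac{\gamma_\tau}{1+\gamma_\tau^2}\,\frac{\operatorname{tr}\big(P_\tau^-(\dot P_\tau^+)^2P_\tau^-\big)}{e_\tau}\,d\tau+R,$$ where the remainder satisfies $|R|\leq C\gamma\epsilon^2$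 with a constant $C$ depending only on $g$ and on a bound for $\gamma_s,\dot\gamma_s,\ddot\gamma_s$.
   Context: All operators act on $\mathbb{C}^2$; super-operators act on $2\times2$ matrices. Dots denote derivatives with respect to $s$. *)

(* Defs.v *)
From Stdlib Require Import Reals.
From Coquelicot Require Import Coquelicot.

Open Scope R_scope.

(** 2x2 complex matrices: ((a, b), (c, d)) represents [[a, b], [c, d]].
    As a product of normed modules over R it carries Coquelicot's
    NormedModule structure (so [is_derive], [filterlim] apply). *)
Definition M2 : Type := ((C * C) * (C * C))%type.

Definition mk2 (a b c d : C) : M2 := ((a, b), (c, d)).
Definition m11 (A : M2) : C := fst (fst A).
Definition m12 (A : M2) : C := snd (fst A).
Definition m21 (A : M2) : C := fst (snd A).
Definition m22 (A : M2) : C := snd (snd A).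

Definition Madd (A B : M2) : M2 :=
  mk2 (Cplus (m11 A) (m11 B)) (Cplus (m12 A) (m12 B))
      (Cplus (m21 A) (m21 B)) (Cplus (m22 A) (m22 B)).
Definition Mscal (z : C) (A : M2) : M2 :=
  mk2 (Cmult z (m11 A)) (Cmult z (m12 A)) (Cmult z (m21 A)) (Cmult z (m22 A)).
Definition Mopp (A : M2) : M2 := Mscal (RtoC (-1)) A.
Definition Msub (A B : M2) : M2 := Madd A (Mopp B).
Definition Mmul (A B : M2) : M2 :=
  mk2 (Cplus (Cmult (m11 A) (m11 B)) (Cmult (m12 A) (m21 B)))
      (Cplus (Cmult (m11 A) (m12 B)) (Cmult (m12 A) (m22 B)))
      (Cplus (Cmult (m21 A) (m11 B)) (Cmult (m22 A) (m21 B)))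
      (Cplus (Cmult (m21 A) (m12 B)) (Cmult (m22 A) (m22 B))).
Definition Mid : M2 := mk2 (RtoC 1) (RtoC 0) (RtoC 0) (RtoC 1).
Definition Mtr (A : M2) : C := Cplus (m11 A) (m22 A).
Definition Mcomm (A B : M2) : M2 := Msub (Mmul A B) (Mmul B A).

Definition CDerive (f : R -> C) (s : R) : C :=
  (Derive (fun t => fst (f t)) s, Derive (fun t => snd (f t)) s).
Definition MDerive (f : R -> M2) (s : R) : M2 :=
  mk2 (CDerive (fun t => m11 (f t)) s) (CDerive (fun t => m12 (f t)) s)
      (CDerive (fun t => m21 (f t)) s) (CDerive (fun t => m22 (f t)) s).

Definition Ham (g s : R) : M2 :=
  mk2 (RtoC (s / 2)) (RtoC (g / 2)) (RtoC (g / 2)) (RtoC (- s / 2)).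

Definition en (g s : R) : R := sqrt (s ^ 2 + g ^ 2) / 2.

(** Eigenprojections of H_s for the eigenvalues +e_s and -e_s (distinct when
    g > 0), given by the Lagrange/Riesz formula for a matrix with two simple
    eigenvalues: P_lambda = (H - mu) / (lambda - mu). *)
Definition Eproj_plus (g s : R) : M2 :=
  Mscal (RtoC (/ (2 * en g s))) (Madd (Ham g s) (Mscal (RtoC (en g s)) Mid)).
Definition Eproj_minus (g s : R) : M2 :=
  Mscal (RtoC (/ (2 * en g s))) (Msub (Mscal (RtoC (en g s)) Mid) (Ham g s)).

(** sqrt(H_s) := sgn(H_s) sqrt|H_s| = sqrt(e_s) (P_s^+ - P_s^-)
    (functional calculus for H_s = e_s (P_s^+ - P_s^-)). *)
Definition sqrtH (g s : R) : M2 :=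
  Mscal (RtoC (sqrt (en g s))) (Msub (Eproj_plus g s) (Eproj_minus g s)).

Definition Lind (g : R) (gam : R -> R) (s : R) (rho : M2) : M2 :=
  Madd (Mscal (Copp Ci) (Mcomm (Ham g s) rho))
       (Mscal (RtoC (- gam s / 2)) (Mcomm (sqrtH g s) (Mcomm (sqrtH g s) rho))).

Definition is_propagator (g : R) (gam : R -> R) (eps : R)
    (U : R -> R -> M2 -> M2) : Prop :=
  (forall s' rho, U s' s' rho = rho) /\
  (forall s' rho, filterlim (fun s => U s s' rho) (at_right s') (locally rho)) /\
  (forall s' s rho, s' < s ->
     is_derive (fun t => U t s' rho) s (Mscal (RtoC (/ eps)) (Lind g gam s (U s s' rho)))).

Definition smooth (f : R -> R) : Prop := forall n x, ex_derive_n f n x.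

Definition sup_fun (f : R -> R) : R := real (Lub_Rbar (fun x => exists s, x = f s)).

Definition integrand (g : R) (gam : R -> R) (tau : R) : C :=
  Cmult (RtoC (gam tau / (1 + gam tau ^ 2) / en g tau))
    (Mtr (Mmul (Eproj_minus g tau)
      (Mmul (Mmul (MDerive (Eproj_plus g) tau) (MDerive (Eproj_plus g) tau)) (Eproj_minus g tau)))).

(* Main.v *)
Require Import Defs.
From Stdlib Require Import Reals Lra Psatz.
From Coquelicot Require Import Coquelicot.
Open Scope R_scope.

(** In Bloch coordinates the state is a vector [r] with [eps r' = om (n x r - gam r_perp)], where
    [om = sqrt (s^2 + g^2)] and [n = (g, 0, s) / om].  In the frame moving with [n] put [a = r . n] and
    let the complex number [z] collect the transverse components; then
    [z' = (om / eps) (i - gam) z - a th] and [a' = th Re z] with [th = - g / om^2], and the transition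
    probability is [(1 + a) / 2].

    For [gam = 0] the problem is exactly solvable: the spinor equation has the solution
    [v (x) = int_0^oo exp (- e^(i pi/4) x t - t^2 / 2) t^(i nu) dt], [nu = g^2 / (4 eps)],
    [x = s / sqrt eps].  The conserved form [|u|^2 + |v|^2] becomes [|u|^2 - |v|^2] on the imaginary axis,
    the amplitudes at infinity along the two rays differ by the factor [e^(pi nu / 2)] coming from
    rotating the Mellin integral, and the conserved inner product with the reflected solution turns
    [|u (0)|^2 - |v (0)|^2] into the survival amplitude [e^(- pi nu)].

    For general [gam], pairing [r] with the undamped solution [D] asymptotic to [n] at [+oo] gives
    [(D . r)' = - gam (om / eps) D_perp . r_perp].  Both transverse parts follow the slow manifold
    [z = eps a th / (om (i - gam))] up to [O(eps^2)], with a weight decaying at [-oo] for [r] and at [+oo]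
    for [D], so the right-hand side is [eps] times the stated integrand up to an integrable error of
    order [gam eps^2]. *)

(** * Complex-valued functions of a real variable *)

(** The remainder has to carry a factor [gamma] and stay uniform as [gamma] tends to 0, so no decay
    may be drawn from the damping: the growth estimates use only that it has a favourable sign and
    that the fast rotation drops out of the derivative of [|z|^2]. Comparing with an exact undamped
    solution puts [gam] in front of the whole difference, and the exponential term comes out
    exactly, for every [eps]. The obstacle is the factor [om / eps] in the derivative of the
    pairing: it grows with [|s|] and costs a power of [eps]. Transverse errors of order [eps^2] that
    are merely uniform in time would not be integrable against it. Each error decays like [om^-3]
    only on the side from which its solution starts, because an oscillation created at the crossing
    persists afterwards. On each half line one of the two factors decays, which leaves the
    integrable weight [om^-2]. Starting at a finite time [-T] adds an error of order [T^-3], small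
    enough to survive the factor [om] and an interval of length [2 T]. Nothing requires [eps] to be
    small: for [eps > 1] the bound [|z| <= 1] replaces the expansion. *)

Definition is_cderive (f : R -> C) (s : R) (l : C) : Prop :=
  is_derive (fun t => fst (f t)) s (fst l) /\
  is_derive (fun t => snd (f t)) s (snd l).

Lemma is_derive_val (f : R -> R) (s l l' : R) :
  is_derive f s l -> l = l' -> is_derive f s l'.
Proof. intros H ->; exact H. Qed.

Lemma is_derive_Rext (f h : R -> R) (s l : R) :
  (forall t, f t = h t) -> is_derive f s l -> is_derive h s l.
Proof. intros E; apply is_derive_ext; exact E. Qed.

Lemma is_cderive_val (f : R -> C) (s : R) (l l' : C) :
  is_cderive f s l -> l = l' -> is_cderive f s l'.
Proof. intros H ->; exact H. Qed.

Lemma is_cderive_ext (f h : R -> C) (s : R) (l : C) :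
  (forall t, f t = h t) -> is_cderive f s l -> is_cderive h s l.
Proof.
  intros E [H1 H2]; split; [apply (is_derive_ext (fun t => fst (f t))) | apply (is_derive_ext (fun t => snd (f t)))];
    try assumption; intros t; now rewrite E.
Qed.

Lemma is_derive_Rmult (f h : R -> R) (s df dh : R) :
  is_derive f s df -> is_derive h s dh ->
  is_derive (fun t => f t * h t) s (df * h s + f s * dh).
Proof.
  intros Hf Hh. apply (is_derive_mult f h s df dh Hf Hh).
  intros x y; apply Rmult_comm.
Qed.

Lemma is_derive_Rplus (f h : R -> R) (s df dh : R) :
  is_derive f s df -> is_derive h s dh ->
  is_derive (fun t => f t + h t) s (df + dh).
Proof. intros Hf Hh. exact (is_derive_plus f h s df dh Hf Hh). Qed.

Lemma is_derive_Rminus (f h : R -> R) (s df dh : R) :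
  is_derive f s df -> is_derive h s dh ->
  is_derive (fun t => f t - h t) s (df - dh).
Proof. intros Hf Hh. exact (is_derive_minus f h s df dh Hf Hh). Qed.

Lemma is_derive_Ropp (f : R -> R) (s df : R) :
  is_derive f s df -> is_derive (fun t => - f t) s (- df).
Proof. intros Hf. exact (is_derive_opp f s df Hf). Qed.

Lemma is_derive_Rconst (c s : R) : is_derive (fun _ => c) s 0.
Proof. exact (is_derive_const c s). Qed.

Lemma is_derive_Rcomp (f h : R -> R) (s df dh : R) :
  is_derive f (h s) df -> is_derive h s dh ->
  is_derive (fun t => f (h t)) s (dh * df).
Proof. intros Hf Hh. exact (is_derive_comp f h s df dh Hf Hh). Qed.

Lemma is_derive_Rlin (c s : R) : is_derive (fun t => c * t) s c.
Proof. auto_derive; [exact I | ring]. Qed.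

Lemma is_cderive_mult (f h : R -> C) (s : R) (df dh : C) :
  is_cderive f s df -> is_cderive h s dh ->
  is_cderive (fun t => Cmult (f t) (h t)) s
    (Cplus (Cmult df (h s)) (Cmult (f s) dh)).
Proof.
  intros [F1 F2] [H1 H2]; split; simpl.
  - eapply is_derive_val.
    + apply is_derive_Rminus; apply is_derive_Rmult; eassumption.
    + simpl; ring.
  - eapply is_derive_val.
    + apply is_derive_Rplus; apply is_derive_Rmult; eassumption.
    + simpl; ring.
Qed.

Lemma is_cderive_plus (f h : R -> C) (s : R) (df dh : C) :
  is_cderive f s df -> is_cderive h s dh ->
  is_cderive (fun t => Cplus (f t) (h t)) s (Cplus df dh).
Proof.
  intros [F1 F2] [H1 H2]; split; simpl; apply is_derive_Rplus; assumption.
Qed.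

Lemma is_cderive_minus (f h : R -> C) (s : R) (df dh : C) :
  is_cderive f s df -> is_cderive h s dh ->
  is_cderive (fun t => Cminus (f t) (h t)) s (Cminus df dh).
Proof.
  intros [F1 F2] [H1 H2]; split; simpl.
  - exact (is_derive_Rminus _ _ _ _ _ F1 H1).
  - exact (is_derive_Rminus _ _ _ _ _ F2 H2).
Qed.

Lemma is_cderive_const (c : C) (s : R) : is_cderive (fun _ => c) s (RtoC 0).
Proof. split; simpl; apply is_derive_Rconst. Qed.

Lemma is_cderive_scal (c : C) (f : R -> C) (s : R) (df : C) :
  is_cderive f s df -> is_cderive (fun t => Cmult c (f t)) s (Cmult c df).
Proof.
  intros H. eapply is_cderive_val.
  - apply is_cderive_mult; [apply is_cderive_const | exact H].
  - simpl. ring.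
Qed.

Lemma is_cderive_RtoC (f : R -> R) (s df : R) :
  is_derive f s df -> is_cderive (fun t => RtoC (f t)) s (RtoC df).
Proof. intros H; split; simpl; [exact H | apply is_derive_Rconst]. Qed.

Lemma is_cderive_comp (f : R -> C) (h : R -> R) (s dh : R) (df : C) :
  is_cderive f (h s) df -> is_derive h s dh ->
  is_cderive (fun t => f (h t)) s (Cmult (RtoC dh) df).
Proof.
  intros [F1 F2] H; split; simpl.
  - eapply is_derive_val; [apply (is_derive_Rcomp (fun t => fst (f t))); eassumption | ring].
  - eapply is_derive_val; [apply (is_derive_Rcomp (fun t => snd (f t))); eassumption | ring].
Qed.

Lemma is_cderive_Cconj (f : R -> C) (s : R) (df : C) :
  is_cderive f s df -> is_cderive (fun t => Cconj (f t)) s (Cconj df).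
Proof.
  intros [F1 F2]; split; simpl; [exact F1 | now apply is_derive_Ropp].
Qed.

Definition Cexp (z : C) : C := (exp (fst z) * cos (snd z), exp (fst z) * sin (snd z)).

Lemma Cmod_Cexp (z : C) : Cmod (Cexp z) = exp (fst z).
Proof.
  unfold Cmod, Cexp; simpl.
  replace (_ + _) with (Rsqr (exp (fst z)) * (Rsqr (sin (snd z)) + Rsqr (cos (snd z)))) by (unfold Rsqr; ring).
  rewrite sin2_cos2, Rmult_1_r.
  apply sqrt_Rsqr, Rlt_le, exp_pos.
Qed.

Lemma is_cderive_Cexp (f : R -> C) (s : R) (df : C) :
  is_cderive f s df -> is_cderive (fun t => Cexp (f t)) s (Cmult df (Cexp (f s))).
Proof.
  intros [F1 F2]; unfold Cexp; split; simpl.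
  - eapply is_derive_val.
    + apply is_derive_Rmult; [eapply (is_derive_Rcomp exp) | eapply (is_derive_Rcomp cos)];
        try eassumption; apply is_derive_Reals; [apply derivable_pt_lim_exp | apply derivable_pt_lim_cos].
    + simpl. ring.
  - eapply is_derive_val.
    + apply is_derive_Rmult; [eapply (is_derive_Rcomp exp) | eapply (is_derive_Rcomp sin)];
        try eassumption; apply is_derive_Reals; [apply derivable_pt_lim_exp | apply derivable_pt_lim_sin].
    + simpl. ring.
Qed.

Lemma MVT_point (f df : R -> R) (a b : R) :
  (forall t, Rmin a b <= t <= Rmax a b -> is_derive f t (df t)) ->
  exists c, Rmin a b <= c <= Rmax a b /\ f b - f a = df c * (b - a).
Proof.
  intros H. apply MVT_gen.
  - intros x Hx; apply H; lra.
  - intros x Hx. apply derivable_continuous_pt. exists (df x). apply is_derive_Reals, H; lra.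
Qed.

Lemma is_derive_constant_value (f : R -> R) :
  (forall t, is_derive f t 0) -> forall s t, f s = f t.
Proof.
  intros H s t. destruct (MVT_point f (fun _ => 0) t s) as [c [_ E]]; [intros; apply H | lra].
Qed.

Lemma is_cderive_constant_value (f : R -> C) :
  (forall t, is_cderive f t (RtoC 0)) -> forall s t, f s = f t.
Proof.
  intros H s t. apply injective_projections.
  - apply (is_derive_constant_value (fun t => fst (f t))). intros u; exact (proj1 (H u)).
  - apply (is_derive_constant_value (fun t => snd (f t))). intros u; exact (proj2 (H u)).
Qed.

(** * Integrals over the line of functions dominated by [1 / (1 + y^2)] *)

(** Symmetric integer windows suffice for integrands dominated by [1 / (1 + y^2)] and turn every
    limit into one of sequences. [real] sends an infinite limit to a default value, so the number
    carries meaning only together with [tame]. *)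
Definition lineint (f : R -> R) : R :=
  real (Lim_seq (fun n => RInt f (- INR n) (INR n))).

Definition tame (f : R -> R) : Prop :=
  (forall y, continuous f y) /\ exists K, forall y, Rabs (f y) <= K / (1 + y ^ 2).

Lemma one_plus_sqr_pos (y : R) : 0 < 1 + y ^ 2.
Proof. nra. Qed.

Lemma is_RInt_cauchy_density (K a b : R) :
  is_RInt (fun y => K / (1 + y ^ 2)) a b (K * atan b - K * atan a).
Proof.
  apply (is_RInt_derive (fun y => K * atan y)).
  - intros x _. eapply is_derive_val.
    + apply is_derive_Rmult; [apply is_derive_Rconst | apply is_derive_Reals, derivable_pt_lim_atan].
    + pose proof (one_plus_sqr_pos x). simpl. unfold Rsqr. field. nra.
  - intros x _. apply (continuous_mult (fun _ => K) (fun y => / (1 + y ^ 2))); [apply continuous_const|].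
    apply continuous_Rinv_comp; [|pose proof (one_plus_sqr_pos x); lra].
    apply (ex_derive_continuous (fun y => 1 + y ^ 2)). auto_derive; auto.
Qed.

Lemma continuous_ex_RInt (f : R -> R) (a b : R) :
  (forall y, continuous f y) -> ex_RInt f a b.
Proof. intros H; apply (ex_RInt_continuous (V := R_CompleteNormedModule) f); intros; apply H. Qed.

Lemma RInt_cauchy_bound (f : R -> R) (K a b : R) :
  (forall y, continuous f y) -> (forall y, Rabs (f y) <= K / (1 + y ^ 2)) ->
  a <= b -> Rabs (RInt f a b) <= K * (atan b - atan a).
Proof.
  intros Hc Hb Hab.
  replace (K * (atan b - atan a)) with (K * atan b - K * atan a) by ring.
  apply (norm_RInt_le f (fun y => K / (1 + y ^ 2)) a b); auto.
  - apply (RInt_correct f a b). now apply continuous_ex_RInt.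
  - apply is_RInt_cauchy_density.
Qed.

Lemma tame_bound_nonneg (f : R -> R) (K : R) :
  (forall y, Rabs (f y) <= K / (1 + y ^ 2)) -> 0 <= K.
Proof.
  intros H. specialize (H 0). pose proof (Rabs_pos (f 0)).
  replace (K / (1 + 0 ^ 2)) with K in H by field. lra.
Qed.

Lemma lineint_correct (f : R -> R) : tame f ->
  is_lim_seq (fun n => RInt f (- INR n) (INR n)) (lineint f).
Proof.
  intros [Hc [K Hb]].
  assert (HK := tame_bound_nonneg f K Hb).
  assert (Hex : forall a b, ex_RInt f a b) by (intros; now apply continuous_ex_RInt).
  (* Enlarging the window changes the integral by at most [2 K (atan (n + 1) - atan n)]; adding
     [2 K atan n] therefore makes the sequence nondecreasing, and it stays below [2 K PI]. *)
  assert (E : ex_finite_lim_seq (fun n => RInt f (- INR n) (INR n) + 2 * K * atan (INR n))).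
  { apply ex_finite_lim_seq_incr with (2 * K * PI).
    - intros n. rewrite S_INR. pose proof (pos_INR n).
      rewrite <- (RInt_Chasles f (- (INR n + 1)) (- INR n) (INR n + 1)) by auto.
      rewrite <- (RInt_Chasles f (- INR n) (INR n) (INR n + 1)) by auto.
      unfold plus; simpl.
      pose proof (RInt_cauchy_bound f K (- (INR n + 1)) (- INR n) Hc Hb ltac:(lra)) as B1.
      pose proof (RInt_cauchy_bound f K (INR n) (INR n + 1) Hc Hb ltac:(lra)) as B2.
      rewrite !atan_opp in B1.
      apply Rabs_le_between in B1; apply Rabs_le_between in B2. nra.
    - intros n. pose proof (pos_INR n).
      pose proof (RInt_cauchy_bound f K (- INR n) (INR n) Hc Hb ltac:(lra)) as B.
      rewrite atan_opp in B. apply Rabs_le_between in B.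
      pose proof (atan_bound (INR n)). nra. }
  destruct E as [l Hl].
  assert (Ha : is_lim_seq (fun n => 2 * K * atan (INR n)) (2 * K * (PI / 2))).
  { apply (is_lim_seq_mult' (fun _ => 2 * K) (fun n => atan (INR n))); [apply is_lim_seq_const|].
    apply is_lim_seq_spec. intros eps.
    set (x := Rmax 0 (PI / 2 - eps)).
    assert (Hpi := PI_RGT_0).
    assert (Hx : 0 <= x < PI / 2) by (unfold x; destruct eps as [e He]; simpl; unfold Rmax; destruct Rle_dec; lra).
    destruct (INR_unbounded (tan x)) as [N HN].
    exists N. intros n Hn. apply le_INR in Hn.
    pose proof (atan_bound (INR n)).
    assert (x < atan (INR n)).
    { rewrite <- (atan_tan x) by lra. apply atan_increasing. lra. }
    rewrite Rabs_left by lra.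
    assert (PI / 2 - eps <= x) by apply Rmax_r. lra. }
  assert (Hf : is_lim_seq (fun n => RInt f (- INR n) (INR n)) (l - 2 * K * (PI / 2))).
  { eapply is_lim_seq_ext; [|apply (is_lim_seq_minus' _ _ _ _ Hl Ha)]. intros n; simpl; ring. }
  unfold lineint. rewrite (is_lim_seq_unique _ _ Hf). exact Hf.
Qed.

Lemma lineint_unique (f : R -> R) (l : R) :
  is_lim_seq (fun n => RInt f (- INR n) (INR n)) l -> lineint f = l.
Proof. intros H. unfold lineint. now rewrite (is_lim_seq_unique _ _ H). Qed.

Lemma lineint_bound (f : R -> R) (K : R) :
  (forall y, continuous f y) -> (forall y, Rabs (f y) <= K / (1 + y ^ 2)) ->
  Rabs (lineint f) <= K * PI.
Proof.
  intros Hc Hb.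
  assert (HK := tame_bound_nonneg f K Hb).
  assert (Ht : tame f) by (split; [exact Hc | exists K; exact Hb]).
  assert (L := is_lim_seq_abs _ _ (lineint_correct f Ht)).
  refine (is_lim_seq_le _ _ (Finite (Rabs (lineint f))) (Finite (K * PI)) _ L (is_lim_seq_const _)).
  intros n. pose proof (pos_INR n).
  eapply Rle_trans; [apply (RInt_cauchy_bound f K); auto; lra|].
  rewrite atan_opp. pose proof (atan_bound (INR n)). nra.
Qed.

Lemma tame_lin (f h : R -> R) (a b : R) :
  tame f -> tame h -> tame (fun y => a * f y + b * h y).
Proof.
  intros [Cf [K1 B1]] [Ch [K2 B2]]. split.
  - intros y. apply (continuous_plus (fun y => a * f y) (fun y => b * h y)).
    + apply (continuous_mult (fun _ => a) f); [apply continuous_const | apply Cf].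
    + apply (continuous_mult (fun _ => b) h); [apply continuous_const | apply Ch].
  - exists (Rabs a * K1 + Rabs b * K2). intros y.
    eapply Rle_trans; [apply Rabs_triang|]. rewrite !Rabs_mult.
    replace ((Rabs a * K1 + Rabs b * K2) / (1 + y ^ 2))
      with (Rabs a * (K1 / (1 + y ^ 2)) + Rabs b * (K2 / (1 + y ^ 2)))
      by (field; pose proof (one_plus_sqr_pos y); lra).
    apply Rplus_le_compat; apply Rmult_le_compat_l; auto using Rabs_pos.
Qed.

Lemma lineint_lin (f h : R -> R) (a b : R) : tame f -> tame h ->
  lineint (fun y => a * f y + b * h y) = a * lineint f + b * lineint h.
Proof.
  intros Hf Hh. apply lineint_unique.
  eapply is_lim_seq_ext; [|apply is_lim_seq_plus'; apply is_lim_seq_mult';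
    [apply is_lim_seq_const | apply lineint_correct, Hf | apply is_lim_seq_const | apply lineint_correct, Hh]].
  intros n; cbv beta. destruct Hf as [Cf _], Hh as [Ch _]. symmetry.
  apply is_RInt_unique.
  apply (is_RInt_plus (fun y => a * f y) (fun y => b * h y)).
  - apply (is_RInt_scal f _ _ a). apply (RInt_correct f). now apply continuous_ex_RInt.
  - apply (is_RInt_scal h _ _ b). apply (RInt_correct h). now apply continuous_ex_RInt.
Qed.

Lemma lineint_ext (f h : R -> R) : (forall y, f y = h y) -> lineint f = lineint h.
Proof.
  intros E. unfold lineint. f_equal. apply Lim_seq_ext. intros n.
  apply RInt_ext. auto.
Qed.

Lemma lineint_le (f h : R -> R) : tame f -> tame h ->
  (forall y, f y <= h y) -> lineint f <= lineint h.
Proof.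
  intros Hf Hh H.
  refine (is_lim_seq_le _ _ (Finite (lineint f)) (Finite (lineint h)) _
    (lineint_correct f Hf) (lineint_correct h Hh)).
  intros n. pose proof (pos_INR n).
  destruct Hf as [Cf _], Hh as [Ch _].
  apply RInt_le; try lra; try (apply continuous_ex_RInt; assumption). auto.
Qed.

Lemma is_lim_seq_cauchy_density (K : R) :
  is_lim_seq (fun n => K / (1 + INR n ^ 2)) 0.
Proof.
  replace (Finite 0) with (Finite (K * 0)) by (f_equal; ring).
  apply (is_lim_seq_mult' (fun _ => K)); [apply is_lim_seq_const|].
  apply (is_lim_seq_le_le (fun _ => 0) _ (fun n => / (INR n + 1))).
  - intros n. pose proof (pos_INR n). pose proof (one_plus_sqr_pos (INR n)). split.
    + left. now apply Rinv_0_lt_compat.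
    + apply Rinv_le_contravar; [lra|].
      destruct n as [|n]; [simpl; lra|]. rewrite S_INR in *. pose proof (pos_INR n). nra.
  - apply is_lim_seq_const.
  - replace (Finite 0) with (Rbar_inv p_infty) by reflexivity.
    apply is_lim_seq_inv; [|discriminate].
    apply (is_lim_seq_ext (fun n => INR (S n))); [intros; apply S_INR|].
    apply (is_lim_seq_incr_1 INR), is_lim_seq_INR.
Qed.

Lemma lineint_deriv (f df : R -> R) (K : R) :
  (forall y, is_derive f y (df y)) -> tame df ->
  (forall y, Rabs (f y) <= K / (1 + y ^ 2)) -> lineint df = 0.
Proof.
  intros D [Cd _] B. apply lineint_unique.
  apply (is_lim_seq_ext (fun n => f (INR n) - f (- INR n))).
  - intros n. symmetry. apply is_RInt_unique.
    apply (is_RInt_derive f); intros; auto.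
  - replace (Finite 0) with (Finite (0 - 0)) by (f_equal; ring).
    apply is_lim_seq_minus'; apply is_lim_seq_abs_0;
    apply (is_lim_seq_le_le (fun _ => 0) _ (fun n => K / (1 + INR n ^ 2)));
    try apply is_lim_seq_const; try apply is_lim_seq_cauchy_density; intros n; split; try apply Rabs_pos.
    + apply B.
    + eapply Rle_trans; [apply B|]. right. f_equal. f_equal. ring.
Qed.

(** * Differentiation under the integral sign *)

Lemma is_derive_quadratic (F : R -> R) (t l K : R) :
  (forall h, Rabs h <= 1 -> Rabs (F (t + h) - F t - h * l) <= K * h ^ 2) ->
  is_derive F t l.
Proof.
  intros H. apply is_derive_Reals. intros eps Heps.
  assert (HK : 0 <= K).
  { specialize (H 1). rewrite Rabs_R1 in H. specialize (H ltac:(lra)).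
    pose proof (Rabs_pos (F (t + 1) - F t - 1 * l)). lra. }
  assert (Hd : 0 < Rmin 1 (eps / (K + 1))).
  { apply Rmin_pos; [lra|]. apply Rdiv_lt_0_compat; lra. }
  exists (mkposreal _ Hd). simpl. intros h Hh0 Hh.
  assert (H1 : Rabs h < 1) by (eapply Rlt_le_trans; [apply Hh | apply Rmin_l]).
  assert (H2 : Rabs h < eps / (K + 1)) by (eapply Rlt_le_trans; [apply Hh | apply Rmin_r]).
  replace ((F (t + h) - F t) / h - l) with ((F (t + h) - F t - h * l) / h) by (field; auto).
  unfold Rdiv. rewrite Rabs_mult, Rabs_inv.
  assert (Hp : 0 < Rabs h) by now apply Rabs_pos_lt.
  apply Rmult_lt_reg_r with (Rabs h); [exact Hp|].
  rewrite Rmult_assoc, Rinv_l, Rmult_1_r by lra.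
  eapply Rle_lt_trans; [apply H; lra|].
  rewrite <- (pow2_abs h). simpl. rewrite Rmult_1_r, <- Rmult_assoc.
  apply Rmult_lt_compat_r; [exact Hp|].
  assert ((K + 1) * Rabs h < eps).
  { apply Rmult_lt_reg_r with (/ (K + 1)); [apply Rinv_0_lt_compat; lra|].
    replace ((K + 1) * Rabs h * / (K + 1)) with (Rabs h) by (field; lra). exact H2. }
  nra.
Qed.

Lemma taylor2_bound (f f1 f2 : R -> R) (t h B : R) :
  (forall u, Rabs (u - t) <= Rabs h -> is_derive f u (f1 u)) ->
  (forall u, Rabs (u - t) <= Rabs h -> is_derive f1 u (f2 u)) ->
  (forall u, Rabs (u - t) <= Rabs h -> Rabs (f2 u) <= B) ->
  Rabs (f (t + h) - f t - h * f1 t) <= B * h ^ 2.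
Proof.
  intros D1 D2 HB.
  assert (L : forall u, Rmin t (t + h) <= u <= Rmax t (t + h) -> Rabs (u - t) <= Rabs h).
  { intros u. unfold Rmin, Rmax, Rabs. destruct Rle_dec, Rcase_abs, Rcase_abs; lra. }
  destruct (MVT_point f f1 t (t + h)) as [c [Hc Ec]]; [intros; apply D1; auto|].
  assert (Hct := L c Hc).
  assert (L' : forall u, Rmin t c <= u <= Rmax t c -> Rabs (u - t) <= Rabs h).
  { intros u. revert Hct. unfold Rmin, Rmax, Rabs. destruct Rle_dec; repeat destruct Rcase_abs; lra. }
  destruct (MVT_point f1 f2 t c) as [d [Hd Ed]]; [intros; apply D2; auto|].
  replace (f (t + h) - f t - h * f1 t) with ((f1 c - f1 t) * h) by (rewrite Ec; ring).
  rewrite Ed, !Rabs_mult, <- (pow2_abs h).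
  assert (HBd := HB d (L' d Hd)). pose proof (Rabs_pos (f2 d)). pose proof (Rabs_pos (c - t)). pose proof (Rabs_pos h).
  assert (Rabs (f2 d) * Rabs (c - t) <= B * Rabs h) by (apply Rmult_le_compat; lra).
  nra.
Qed.

(** A dominated second derivative takes the place of dominated convergence: the Taylor remainder is
    at most [h^2 K / (1 + y^2)] pointwise, hence at most [K PI h^2] after integration. *)
Lemma is_derive_lineint (f f1 f2 : R -> R -> R) (t K : R) :
  (forall u y, Rabs (u - t) <= 1 -> is_derive (fun v => f v y) u (f1 u y)) ->
  (forall u y, Rabs (u - t) <= 1 -> is_derive (fun v => f1 v y) u (f2 u y)) ->
  (forall u y, Rabs (u - t) <= 1 -> Rabs (f2 u y) <= K / (1 + y ^ 2)) ->
  (forall u, Rabs (u - t) <= 1 -> tame (f u)) -> tame (f1 t) ->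
  is_derive (fun u => lineint (f u)) t (lineint (f1 t)).
Proof.
  intros D1 D2 B T T1.
  apply is_derive_quadratic with (K * PI).
  intros h Hh.
  assert (Th : tame (f (t + h))) by (apply T; now replace (t + h - t) with h by ring).
  assert (T0 : tame (f t)) by (apply T; rewrite Rminus_diag, Rabs_R0; lra).
  assert (Td := tame_lin _ _ 1 (-1) Th T0).
  assert (Te := tame_lin _ _ 1 (- h) Td T1).
  replace (lineint (f (t + h)) - lineint (f t) - h * lineint (f1 t))
    with (lineint (fun y => 1 * (1 * f (t + h) y + -1 * f t y) + - h * f1 t y)).
  2:{ rewrite (lineint_lin _ _ 1 (- h) Td T1), (lineint_lin _ _ 1 (-1) Th T0). ring. }
  replace (K * PI * h ^ 2) with ((K * h ^ 2) * PI) by ring.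
  apply lineint_bound; [apply Te|].
  intros y.
  replace (1 * (1 * f (t + h) y + -1 * f t y) + - h * f1 t y) with (f (t + h) y - f t y - h * f1 t y) by ring.
  replace (K * h ^ 2 / (1 + y ^ 2)) with (K / (1 + y ^ 2) * h ^ 2)
    by (field; pose proof (one_plus_sqr_pos y); lra).
  apply (taylor2_bound (fun v => f v y) (fun v => f1 v y) (fun v => f2 v y)); intros u Hu;
    [apply D1 | apply D2 | apply B]; lra.
Qed.

(** * Incomplete Gaussian Mellin integrals *)

Lemma RtoC_m1 : RtoC (-1) = Copp (RtoC 1).
Proof. apply injective_projections; simpl; ring. Qed.

(** With [t = exp y] the weight [1 + y^2] is at most [t + 1 / t], so it is paid for by one power of
    [t] up or down. The bound is the square of [x <= exp (x / 2) - exp (- x / 2)]. *)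
Lemma exp_add_exp_opp_ge (y : R) : 2 + y ^ 2 <= exp y + exp (- y).
Proof.
  assert (P : forall x, 0 <= x -> 2 * x <= exp x - exp (- x)).
  { intros x Hx.
    destruct (MVT_point (fun x => exp x - exp (- x) - 2 * x) (fun x => exp x + exp (- x) - 2) 0 x) as [c [_ E]].
    - intros t _. auto_derive; [exact I | ring].
    - cbv beta in E. rewrite Ropp_0, exp_0 in E.
      assert (2 <= exp c + exp (- c)).
      { rewrite exp_Ropp. pose proof (exp_pos c).
        assert (exp c + / exp c - 2 = (exp c - 1) ^ 2 * / exp c) by (field; lra).
        pose proof (Rmult_le_pos _ _ (pow2_ge_0 (exp c - 1)) (Rlt_le _ _ (Rinv_0_lt_compat _ H))). lra. }
      nra. }
  assert (Q : forall x, 0 <= x -> 2 + x ^ 2 <= exp x + exp (- x)).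
  { intros x Hx. pose proof (P (x / 2) ltac:(lra)) as Hp.
    replace (exp x) with (exp (x / 2) * exp (x / 2)) by (rewrite <- exp_plus; f_equal; lra).
    replace (exp (- x)) with (exp (- (x / 2)) * exp (- (x / 2))) by (rewrite <- exp_plus; f_equal; lra).
    assert (exp (x / 2) * exp (- (x / 2)) = 1) by (rewrite <- exp_plus, Rplus_opp_r; apply exp_0).
    nra. }
  destruct (Rle_dec 0 y) as [H|H]; [now apply Q|].
  pose proof (Q (- y) ltac:(lra)). rewrite Ropp_involutive in H0.
  replace ((- y) ^ 2) with (y ^ 2) in H0 by ring. lra.
Qed.

Lemma pow_le_exp (m : nat) : forall c, 0 < c ->
  exists C, 0 <= C /\ forall t, 0 < t -> t ^ m <= C * exp (c * t).
Proof.
  induction m as [|m IH]; intros c Hc.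
  - exists 1. split; [lra|]. intros t Ht. simpl.
    pose proof (exp_ineq1_le (c * t)). nra.
  - destruct (IH (c / 2) ltac:(lra)) as [C [HC H]].
    exists (C * (2 / c)). split.
    { apply Rmult_le_pos; [exact HC | left; apply Rdiv_lt_0_compat; lra]. }
    intros t Ht. specialize (H t Ht).
    assert (t <= 2 / c * exp (c / 2 * t)).
    { pose proof (exp_ineq1_le (c / 2 * t)).
      apply Rmult_le_reg_l with (c / 2); [lra|].
      replace (c / 2 * (2 / c * exp (c / 2 * t))) with (exp (c / 2 * t)) by (field; lra). nra. }
    replace (exp (c * t)) with (exp (c / 2 * t) * exp (c / 2 * t)) by (rewrite <- exp_plus; f_equal; field).
    simpl. pose proof (pow_lt t m Ht). pose proof (exp_pos (c / 2 * t)).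
    replace (C * (2 / c) * (exp (c / 2 * t) * exp (c / 2 * t)))
      with ((2 / c * exp (c / 2 * t)) * (C * exp (c / 2 * t))) by ring.
    apply Rmult_le_compat; lra.
Qed.

Lemma exp_INR_mult (k : nat) (y : R) : exp (INR k * y) = exp y ^ k.
Proof.
  induction k as [|k IH]; [simpl; rewrite Rmult_0_l; apply exp_0|].
  rewrite S_INR, Rmult_plus_distr_r, Rmult_1_l, exp_plus, IH. simpl; ring.
Qed.

(* The integrand of [int_0^oo exp (- A t - b t^2 / 2) t^(k + i nu) dt] after the substitution [t = exp y]. *)
Definition mellin_integrand (nu : R) (k : nat) (A : C) (b y : R) : C :=
  Cexp (- fst A * exp y - b * exp y ^ 2 / 2 + (INR k + 1) * y, - snd A * exp y + nu * y).

Definition mellin (nu : R) (k : nat) (A : C) (b : R) : C :=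
  (lineint (fun y => fst (mellin_integrand nu k A b y)),
   lineint (fun y => snd (mellin_integrand nu k A b y))).

(** The exponential factor of the integrand is at most [exp K exp (- t / 2)]. Fixing the rate
    [1 / 2] makes all bounds depend on [A] and [b] through [K] alone; the rate is low enough that
    [K = 0] works for unit [A] with [|arg A| <= PI / 4], uniformly in [b >= 0]. *)
Definition damped (A : C) (b K : R) : Prop :=
  forall t, 0 < t -> t / 2 - K <= fst A * t + b * t ^ 2 / 2.

Lemma mellin_integrand_S (nu : R) (k : nat) (A : C) (b y : R) :
  mellin_integrand nu (S k) A b y = Cmult (RtoC (exp y)) (mellin_integrand nu k A b y).
Proof.
  unfold mellin_integrand, Cexp, Cmult, RtoC. cbn [fst snd]. rewrite S_INR.
  replace (- fst A * exp y - b * exp y ^ 2 / 2 + (INR k + 1 + 1) * y)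
    with (y + (- fst A * exp y - b * exp y ^ 2 / 2 + (INR k + 1) * y)) by ring.
  rewrite (exp_plus y). f_equal; ring.
Qed.

Lemma Cmod_mellin_integrand (nu : R) (k : nat) (A : C) (b y : R) :
  Cmod (mellin_integrand nu k A b y)
  = exp (- (fst A * exp y + b * exp y ^ 2 / 2)) * exp y ^ S k.
Proof.
  unfold mellin_integrand. rewrite Cmod_Cexp. simpl fst.
  rewrite <- (exp_INR_mult (S k) y), <- exp_plus. f_equal. rewrite S_INR. simpl; field.
Qed.

Lemma mellin_integrand_bound (k : nat) : exists c, 0 <= c /\ forall nu A b K y,
  damped A b K -> Cmod (mellin_integrand nu k A b y) <= exp K * c / (1 + y ^ 2).
Proof.
  destruct (pow_le_exp (S (S k)) (1 / 2) ltac:(lra)) as [c1 [Hc1 H1]].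
  destruct (pow_le_exp k (1 / 2) ltac:(lra)) as [c2 [Hc2 H2]].
  exists (c1 + c2). split; [lra|]. intros nu A b K y HD.
  rewrite Cmod_mellin_integrand.
  set (t := exp y). assert (Ht : 0 < t) by apply exp_pos.
  specialize (HD t Ht). specialize (H1 t Ht). specialize (H2 t Ht).
  assert (Hy := exp_add_exp_opp_ge y). fold t in Hy. rewrite exp_Ropp in Hy. fold t in Hy.
  assert (E1 : exp (- (fst A * t + b * t ^ 2 / 2)) <= exp K * exp (- (1 / 2 * t))).
  { rewrite <- exp_plus.
    assert (L : - (fst A * t + b * t ^ 2 / 2) <= K + - (1 / 2 * t)) by lra.
    destruct L as [L|L]; [left; now apply exp_increasing | right; now rewrite L]. }
  pose proof (exp_pos (1 / 2 * t)) as Hp. pose proof (exp_pos K) as HK.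
  apply Rmult_le_reg_r with (1 + y ^ 2); [apply one_plus_sqr_pos|].
  replace (exp K * (c1 + c2) / (1 + y ^ 2) * (1 + y ^ 2)) with (exp K * (c1 + c2))
    by (field; pose proof (one_plus_sqr_pos y); lra).
  (* Replacing [1 + y^2] by [t + 1 / t] produces the powers [k + 2] and [k], which is why exactly
     these two were compared with [exp (t / 2)]. *)
  assert (E2 : t ^ S k * (1 + y ^ 2) <= (c1 + c2) * exp (1 / 2 * t)).
  { apply Rle_trans with (t ^ S k * (t + / t)).
    - apply Rmult_le_compat_l; [left; now apply pow_lt | lra].
    - replace (t ^ S k * (t + / t)) with (t ^ S (S k) + t ^ k) by (simpl; field; lra). lra. }
  rewrite (exp_Ropp (1 / 2 * t)) in E1.
  apply Rle_trans with (exp K * / exp (1 / 2 * t) * ((c1 + c2) * exp (1 / 2 * t))).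
  - rewrite Rmult_assoc. apply Rmult_le_compat; try exact E1; try exact E2.
    + left; apply exp_pos.
    + apply Rmult_le_pos; [left; now apply pow_lt | left; apply one_plus_sqr_pos].
  - right. field. lra.
Qed.

Lemma is_cderive_mellin_integrand_y (nu : R) (k : nat) (A : C) (b y : R) :
  is_cderive (mellin_integrand nu k A b) y
    (Cminus (Cmult (INR k + 1, nu) (mellin_integrand nu k A b y))
       (Cplus (Cmult A (mellin_integrand nu (S k) A b y))
              (Cmult (RtoC b) (mellin_integrand nu (S (S k)) A b y)))).
Proof.
  eapply is_cderive_val.
  - unfold mellin_integrand.
    apply is_cderive_Cexp with (df := (- fst A * exp y - b * exp y ^ 2 + (INR k + 1), - snd A * exp y + nu)).
    split; cbn [fst snd].
    + auto_derive; [exact I | field].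
    + auto_derive; [exact I | ring].
  - rewrite !mellin_integrand_S. unfold mellin_integrand.
    generalize (Cexp (- fst A * exp y - b * exp y ^ 2 / 2 + (INR k + 1) * y, - snd A * exp y + nu * y)).
    intros [c d]. destruct A as [A1 A2]. apply injective_projections; simpl; field.
Qed.

Lemma abs_fst_le_Cmod (z : C) : Rabs (fst z) <= Cmod z.
Proof. eapply Rle_trans; [apply Rmax_l | apply (Rmax_Cmod z)]. Qed.

Lemma abs_snd_le_Cmod (z : C) : Rabs (snd z) <= Cmod z.
Proof. eapply Rle_trans; [apply Rmax_r | apply (Rmax_Cmod z)]. Qed.

Lemma Cmod_le_abs (z : C) : Cmod z <= Rabs (fst z) + Rabs (snd z).
Proof.
  unfold Cmod. rewrite <- (sqrt_pow2 (Rabs (fst z) + Rabs (snd z))).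
  - apply sqrt_le_1_alt. rewrite <- (pow2_abs (fst z)), <- (pow2_abs (snd z)).
    pose proof (Rabs_pos (fst z)). pose proof (Rabs_pos (snd z)). nra.
  - pose proof (Rabs_pos (fst z)). pose proof (Rabs_pos (snd z)). lra.
Qed.

Lemma Cmod_triangle_inv (z w : C) : Rabs (Cmod z - Cmod w) <= Cmod (Cminus z w).
Proof. rewrite !Cmod_norm. apply (norm_triangle_inv (V := C_R_NormedModule)). Qed.

Lemma continuous_mellin_integrand (nu : R) (k : nat) (A : C) (b y : R) :
  continuous (fun y => fst (mellin_integrand nu k A b y)) y /\
  continuous (fun y => snd (mellin_integrand nu k A b y)) y.
Proof.
  destruct (is_cderive_mellin_integrand_y nu k A b y) as [H1 H2].
  split; eapply (ex_derive_continuous (K := R_AbsRing) (V := R_NormedModule)); eexists; eassumption.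
Qed.

Lemma tame_mellin_integrand (nu : R) (k : nat) (A : C) (b K : R) : damped A b K ->
  tame (fun y => fst (mellin_integrand nu k A b y)) /\
  tame (fun y => snd (mellin_integrand nu k A b y)).
Proof.
  intros HD. destruct (mellin_integrand_bound k) as [c [_ H]].
  split; (split; [intros y; apply (continuous_mellin_integrand nu k A b y)|]);
    exists (exp K * c); intros y; (eapply Rle_trans; [|apply (H nu A b K y HD)]).
  - apply abs_fst_le_Cmod.
  - apply abs_snd_le_Cmod.
Qed.

Lemma mellin_bound (k : nat) : exists c, 0 <= c /\ forall nu A b K,
  damped A b K -> Cmod (mellin nu k A b) <= c * exp K.
Proof.
  destruct (mellin_integrand_bound k) as [c [Hc H]].
  exists (2 * c * PI). split; [pose proof PI_RGT_0; nra|].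
  intros nu A b K HD. eapply Rle_trans; [apply Cmod_le_abs|]. unfold mellin; cbn [fst snd].
  assert (B1 : Rabs (lineint (fun y => fst (mellin_integrand nu k A b y))) <= exp K * c * PI).
  { apply lineint_bound; [intros y; apply (continuous_mellin_integrand nu k A b y)|].
    intros y. eapply Rle_trans; [apply abs_fst_le_Cmod | apply H, HD]. }
  assert (B2 : Rabs (lineint (fun y => snd (mellin_integrand nu k A b y))) <= exp K * c * PI).
  { apply lineint_bound; [intros y; apply (continuous_mellin_integrand nu k A b y)|].
    intros y. eapply Rle_trans; [apply abs_snd_le_Cmod | apply H, HD]. }
  lra.
Qed.

Lemma tame_ext (f h : R -> R) : (forall y, f y = h y) -> tame f -> tame h.
Proof.
  intros E [Hc [K Hb]]. split.
  - intros y. apply (continuous_ext f); auto.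
  - exists K. intros y. now rewrite <- E.
Qed.

Definition ctame (f : R -> C) : Prop :=
  tame (fun y => fst (f y)) /\ tame (fun y => snd (f y)).

Definition clineint (f : R -> C) : C :=
  (lineint (fun y => fst (f y)), lineint (fun y => snd (f y))).

Lemma clineint_lin (f h : R -> C) (c d : C) : ctame f -> ctame h ->
  ctame (fun y => Cplus (Cmult c (f y)) (Cmult d (h y))) /\
  clineint (fun y => Cplus (Cmult c (f y)) (Cmult d (h y)))
  = Cplus (Cmult c (clineint f)) (Cmult d (clineint h)).
Proof.
  intros [F1 F2] [H1 H2]. destruct c as [c1 c2], d as [d1 d2].
  assert (P1 := tame_lin _ _ c1 (- c2) F1 F2).
  assert (P2 := tame_lin _ _ d1 (- d2) H1 H2).
  assert (P3 := tame_lin _ _ c1 c2 F2 F1).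
  assert (P4 := tame_lin _ _ d1 d2 H2 H1).
  assert (Q1 := tame_lin _ _ 1 1 P1 P2).
  assert (Q2 := tame_lin _ _ 1 1 P3 P4).
  split; [split|].
  - eapply tame_ext; [|exact Q1]. intros y; simpl; ring.
  - eapply tame_ext; [|exact Q2]. intros y; simpl; ring.
  - unfold clineint, Cplus, Cmult; cbn [fst snd]. f_equal.
    + rewrite (lineint_ext _ (fun y => 1 * (c1 * fst (f y) + - c2 * snd (f y)) + 1 * (d1 * fst (h y) + - d2 * snd (h y))))
        by (intros y; ring).
      rewrite (lineint_lin _ _ 1 1 P1 P2), (lineint_lin _ _ c1 (- c2) F1 F2), (lineint_lin _ _ d1 (- d2) H1 H2). ring.
    + rewrite (lineint_ext _ (fun y => 1 * (c1 * snd (f y) + c2 * fst (f y)) + 1 * (d1 * snd (h y) + d2 * fst (h y))))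
        by (intros y; ring).
      rewrite (lineint_lin _ _ 1 1 P3 P4), (lineint_lin _ _ c1 c2 F2 F1), (lineint_lin _ _ d1 d2 H2 H1). ring.
Qed.

(** The integral over the line of the [y]-derivative of the integrand vanishes. This recurrence is
    the only special-function identity needed: the differential equations, the scaling law and the
    rotation all come from it. *)
Lemma mellin_parts (nu : R) (k : nat) (A : C) (b K : R) : damped A b K ->
  Cmult (INR k + 1, nu) (mellin nu k A b)
  = Cplus (Cmult A (mellin nu (S k) A b)) (Cmult (RtoC b) (mellin nu (S (S k)) A b)).
Proof.
  intros HD.
  assert (T0 : ctame (mellin_integrand nu k A b)) by (apply (tame_mellin_integrand nu k A b K HD)).
  assert (T1 : ctame (mellin_integrand nu (S k) A b)) by (apply (tame_mellin_integrand nu (S k) A b K HD)).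
  assert (T2 : ctame (mellin_integrand nu (S (S k)) A b)) by (apply (tame_mellin_integrand nu (S (S k)) A b K HD)).
  destruct (clineint_lin _ _ A (RtoC b) T1 T2) as [P1 E1].
  destruct (clineint_lin _ _ (INR k + 1, nu) (RtoC (-1)) T0 P1) as [P2 E2].
  rewrite E1 in E2.
  destruct (mellin_integrand_bound k) as [c [_ H]].
  assert (Z : clineint (fun y => Cplus (Cmult (INR k + 1, nu) (mellin_integrand nu k A b y))
    (Cmult (RtoC (-1)) (Cplus (Cmult A (mellin_integrand nu (S k) A b y)) (Cmult (RtoC b) (mellin_integrand nu (S (S k)) A b y))))) = RtoC 0).
  { unfold clineint, RtoC. f_equal.
    - apply (lineint_deriv (fun y => fst (mellin_integrand nu k A b y)) _ (exp K * c)); [|apply P2|].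
      + intros y. eapply is_derive_val; [apply (is_cderive_mellin_integrand_y nu k A b y) | simpl; ring].
      + intros y. eapply Rle_trans; [apply abs_fst_le_Cmod | apply H, HD].
    - apply (lineint_deriv (fun y => snd (mellin_integrand nu k A b y)) _ (exp K * c)); [|apply P2|].
      + intros y. eapply is_derive_val; [apply (is_cderive_mellin_integrand_y nu k A b y) | simpl; ring].
      + intros y. eapply Rle_trans; [apply abs_snd_le_Cmod | apply H, HD]. }
  rewrite Z in E2. change (mellin nu) with (fun k A b => clineint (mellin_integrand nu k A b)). cbv beta.
  revert E2.
  generalize (clineint (mellin_integrand nu k A b)) (clineint (mellin_integrand nu (S k) A b)) (clineint (mellin_integrand nu (S (S k)) A b)).
  intros p q r E2.
  replace (Cmult (INR k + 1, nu) p) with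
    (Cplus (Cplus (Cmult (INR k + 1, nu) p) (Cmult (RtoC (-1)) (Cplus (Cmult A q) (Cmult b r)))) (Cplus (Cmult A q) (Cmult b r)))
    by (rewrite RtoC_m1; ring).
  rewrite <- E2. ring.
Qed.

Section ParametricDerivative.

Variables (nu : R) (A A1 A2 : R -> C) (b b1 b2 : R -> R).

Let integrand1 k t y : C :=
  Cplus (Cmult (Copp (A1 t)) (mellin_integrand nu (S k) (A t) (b t) y))
        (Cmult (RtoC (- b1 t / 2)) (mellin_integrand nu (S (S k)) (A t) (b t) y)).

Lemma is_cderive_mellin_integrand (k : nat) (t y : R) :
  is_cderive A t (A1 t) -> is_derive b t (b1 t) ->
  is_cderive (fun u => mellin_integrand nu k (A u) (b u) y) t (integrand1 k t y).
Proof.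
  intros [HA1 HA2] Hb. eapply is_cderive_val.
  - unfold mellin_integrand. apply is_cderive_Cexp with (df := (- fst (A1 t) * exp y - b1 t * exp y ^ 2 / 2, - snd (A1 t) * exp y)).
    split; cbn [fst snd].
    + apply (is_derive_Rext (fun u => fst (A u) * (- exp y) + (b u * (- exp y ^ 2 / 2) + (INR k + 1) * y)));
        [intros u; field|].
      eapply is_derive_val.
      * apply is_derive_Rplus; [apply is_derive_Rmult; [exact HA1 | apply is_derive_Rconst]|].
        apply is_derive_Rplus; [apply is_derive_Rmult; [exact Hb | apply is_derive_Rconst] | apply is_derive_Rconst].
      * cbv beta; field.
    + apply (is_derive_Rext (fun u => snd (A u) * (- exp y) + nu * y)); [intros u; ring|].
      eapply is_derive_val.
      * apply is_derive_Rplus; [apply is_derive_Rmult; [exact HA2 | apply is_derive_Rconst] | apply is_derive_Rconst].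
      * cbv beta; ring.
  - unfold integrand1. rewrite !mellin_integrand_S. unfold mellin_integrand.
    generalize (Cexp (- fst (A t) * exp y - b t * exp y ^ 2 / 2 + (INR k + 1) * y, - snd (A t) * exp y + nu * y)).
    intros [c d]. destruct (A1 t) as [a1 a2]. apply injective_projections; simpl; field.
Qed.

Variables (t B K : R).
Hypothesis dA : forall u, is_cderive A u (A1 u).
Hypothesis dA1 : forall u, is_cderive A1 u (A2 u).
Hypothesis db : forall u, is_derive b u (b1 u).
Hypothesis db1 : forall u, is_derive b1 u (b2 u).
Hypothesis bounds : forall u, Rabs (u - t) <= 1 ->
  Cmod (A1 u) <= B /\ Cmod (A2 u) <= B /\ Rabs (b1 u) <= B /\ Rabs (b2 u) <= B.
Hypothesis damp : forall u, Rabs (u - t) <= 1 -> damped (A u) (b u) K.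

Let integrand2 k u y : C :=
  Cplus (Cplus (Cmult (Copp (A2 u)) (mellin_integrand nu (S k) (A u) (b u) y))
               (Cmult (Copp (A1 u)) (integrand1 (S k) u y)))
        (Cplus (Cmult (RtoC (- b2 u / 2)) (mellin_integrand nu (S (S k)) (A u) (b u) y))
               (Cmult (RtoC (- b1 u / 2)) (integrand1 (S (S k)) u y))).

Lemma is_cderive_integrand1 (k : nat) (u y : R) :
  is_cderive (fun v => integrand1 k v y) u (integrand2 k u y).
Proof.
  unfold integrand1 at 1, integrand2. apply is_cderive_plus;
    [apply (is_cderive_mult (fun v => Copp (A1 v)) (fun v => mellin_integrand nu (S k) (A v) (b v) y))
    |apply (is_cderive_mult (fun v => RtoC (- b1 v / 2)) (fun v => mellin_integrand nu (S (S k)) (A v) (b v) y))].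
  - apply (is_cderive_ext (fun v => Cmult (RtoC (-1)) (A1 v))); [intros v; rewrite RtoC_m1; ring|].
    eapply is_cderive_val; [exact (is_cderive_scal _ _ _ _ (dA1 u)) | rewrite RtoC_m1; ring].
  - now apply is_cderive_mellin_integrand.
  - apply is_cderive_RtoC.
    apply (is_derive_Rext (fun v => b1 v * (-1 / 2))); [intros v; field|].
    eapply is_derive_val; [apply is_derive_Rmult; [apply db1 | apply is_derive_Rconst] | cbv beta; field].
  - now apply is_cderive_mellin_integrand.
Qed.

Lemma integrand2_bound (k : nat) : exists c, forall u y, Rabs (u - t) <= 1 ->
  Cmod (integrand2 k u y) <= c / (1 + y ^ 2).
Proof.
  destruct (mellin_integrand_bound (S k)) as [c1 [P1 H1]].
  destruct (mellin_integrand_bound (S (S k))) as [c2 [P2 H2]].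
  destruct (mellin_integrand_bound (S (S (S k)))) as [c3 [P3 H3]].
  destruct (mellin_integrand_bound (S (S (S (S k))))) as [c4 [P4 H4]].
  exists (exp K * (B * c1 + B * (B * c2 + B * c3) + (B * c2 + B * (B * c3 + B * c4)))).
  intros u y Hu. destruct (bounds u Hu) as [a1 [a2 [a3 a4]]].
  specialize (H1 nu (A u) (b u) K y (damp u Hu)). specialize (H2 nu (A u) (b u) K y (damp u Hu)).
  specialize (H3 nu (A u) (b u) K y (damp u Hu)). specialize (H4 nu (A u) (b u) K y (damp u Hu)).
  assert (HB : 0 <= B) by (pose proof (Cmod_ge_0 (A1 u)); lra).
  set (w := exp K / (1 + y ^ 2)).
  assert (Hw : 0 <= w) by (left; apply Rdiv_lt_0_compat; [apply exp_pos | apply one_plus_sqr_pos]).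
  assert (Ew : forall c, exp K * c / (1 + y ^ 2) = c * w)
    by (intros c; unfold w; field; pose proof (one_plus_sqr_pos y); lra).
  rewrite Ew in *.
  assert (M : forall z x c d : R, 0 <= z -> 0 <= x -> z <= c -> x <= d * w -> z * x <= c * d * w).
  { intros z x c d Hz Hx Hc Hd. rewrite Rmult_assoc. apply Rmult_le_compat; lra. }
  assert (N : forall x, Rabs x <= B -> Cmod (RtoC (- x / 2)) <= B).
  { intros x Hx. rewrite Cmod_R. replace (- x / 2) with (- (x * / 2)) by field.
    rewrite Rabs_Ropp, Rabs_mult, (Rabs_right (/ 2)) by lra. lra. }
  assert (I1 : forall j c d, Cmod (mellin_integrand nu (S j) (A u) (b u) y) <= c * w ->
     Cmod (mellin_integrand nu (S (S j)) (A u) (b u) y) <= d * w ->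
     Cmod (integrand1 j u y) <= (B * c + B * d) * w).
  { intros j c d Hc Hd. unfold integrand1. eapply Rle_trans; [apply Cmod_triangle|].
    rewrite !Cmod_mult, Cmod_opp.
    rewrite Rmult_plus_distr_r. apply Rplus_le_compat; apply M; auto using Cmod_ge_0. }
  unfold integrand2. eapply Rle_trans; [apply Cmod_triangle|].
  rewrite Rmult_plus_distr_r. apply Rplus_le_compat;
  (eapply Rle_trans; [apply Cmod_triangle|]); rewrite !Cmod_mult, ?Cmod_opp, Rmult_plus_distr_r;
    apply Rplus_le_compat; apply M; auto using Cmod_ge_0.
Qed.

(** A general curve [(A t, b t)] is allowed because the integral is later moved in three ways: along
    a ray, by scaling, and by rotating [A]. Uniform damping is needed only within distance 1 of [t],
    where the Taylor bound is applied. *)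
Lemma is_cderive_mellin (k : nat) :
  is_cderive (fun u => mellin nu k (A u) (b u)) t
    (Cplus (Cmult (Copp (A1 t)) (mellin nu (S k) (A t) (b t)))
           (Cmult (RtoC (- b1 t / 2)) (mellin nu (S (S k)) (A t) (b t)))).
Proof.
  assert (H0 : Rabs (t - t) <= 1) by (rewrite Rminus_diag, Rabs_R0; lra).
  destruct (clineint_lin (mellin_integrand nu (S k) (A t) (b t)) (mellin_integrand nu (S (S k)) (A t) (b t))
    (Copp (A1 t)) (RtoC (- b1 t / 2))) as [Ht Hi];
    try (apply (tame_mellin_integrand nu _ _ _ K), damp, H0).
  destruct (integrand2_bound k) as [c Hc].
  change (is_cderive (fun u => clineint (mellin_integrand nu k (A u) (b u))) t
    (Cplus (Cmult (Copp (A1 t)) (clineint (mellin_integrand nu (S k) (A t) (b t))))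
           (Cmult (RtoC (- b1 t / 2)) (clineint (mellin_integrand nu (S (S k)) (A t) (b t)))))).
  rewrite <- Hi. split; cbn [fst snd clineint].
  - apply (is_derive_lineint (fun u y => fst (mellin_integrand nu k (A u) (b u) y))
      (fun u y => fst (integrand1 k u y)) (fun u y => fst (integrand2 k u y)) t c).
    + intros u y Hu. exact (proj1 (is_cderive_mellin_integrand k u y (dA u) (db u))).
    + intros u y Hu. exact (proj1 (is_cderive_integrand1 k u y)).
    + intros u y Hu. eapply Rle_trans; [apply abs_fst_le_Cmod | now apply Hc].
    + intros u Hu. apply (tame_mellin_integrand nu k (A u) (b u) K), damp, Hu.
    + apply Ht.
  - apply (is_derive_lineint (fun u y => snd (mellin_integrand nu k (A u) (b u) y))
      (fun u y => snd (integrand1 k u y)) (fun u y => snd (integrand2 k u y)) t c).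
    + intros u y Hu. exact (proj2 (is_cderive_mellin_integrand k u y (dA u) (db u))).
    + intros u y Hu. exact (proj2 (is_cderive_integrand1 k u y)).
    + intros u y Hu. eapply Rle_trans; [apply abs_snd_le_Cmod | now apply Hc].
    + intros u Hu. apply (tame_mellin_integrand nu k (A u) (b u) K), damp, Hu.
    + apply Ht.
Qed.

End ParametricDerivative.

(** * Mellin integrals along rays: decay, scaling and rotation *)

Lemma damped_quadratic (A : C) (b b0 X : R) :
  - X <= fst A -> 0 < b0 <= b -> damped A b ((X + 1 / 2) ^ 2 / (2 * b0)).
Proof.
  intros HA Hb t Ht.
  assert (0 <= (fst A + X) * t) by (apply Rmult_le_pos; lra).
  assert (0 <= (b - b0) * t ^ 2 / 2) by (pose proof (pow2_ge_0 t); apply Rmult_le_pos; [apply Rmult_le_pos|]; lra).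
  (* Completing the square: the Gaussian factor absorbs a linear growth of rate [X], at the price of
     the constant. *)
  assert (E : b0 * t ^ 2 / 2 - (X + 1 / 2) * t + (X + 1 / 2) ^ 2 / (2 * b0)
    = b0 / 2 * (t - (X + 1 / 2) / b0) ^ 2) by (field; lra).
  assert (0 <= b0 / 2 * (t - (X + 1 / 2) / b0) ^ 2) by (apply Rmult_le_pos; [lra | apply pow2_ge_0]).
  nra.
Qed.

Lemma damped_half (A : C) (b : R) : 1 / 2 <= fst A -> 0 <= b -> damped A b 0.
Proof.
  intros HA Hb t Ht.
  assert (0 <= (fst A - 1 / 2) * t) by (apply Rmult_le_pos; lra).
  assert (0 <= b * t ^ 2) by (apply Rmult_le_pos; [lra | apply pow2_ge_0]).
  lra.
Qed.

Lemma damped_mult (x : R) (e : C) (X : R) : Cmod e = 1 -> Rabs x <= X ->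
  damped (Cmult (RtoC x) e) 1 ((X + 1 / 2) ^ 2 / (2 * 1)).
Proof.
  intros He Hx. apply damped_quadratic; [|lra].
  assert (H := abs_fst_le_Cmod (Cmult (RtoC x) e)). rewrite Cmod_mult, Cmod_R, He in H.
  apply Rabs_le_between in H. lra.
Qed.

Lemma is_cderive_mellin_ray (nu : R) (k : nat) (e : C) (x : R) : Cmod e = 1 ->
  is_cderive (fun x => mellin nu k (Cmult (RtoC x) e) 1) x
    (Copp (Cmult e (mellin nu (S k) (Cmult (RtoC x) e) 1))).
Proof.
  intros He. eapply is_cderive_val.
  - apply (is_cderive_mellin nu (fun x => Cmult (RtoC x) e) (fun _ => e) (fun _ => RtoC 0)
      (fun _ => 1) (fun _ => 0) (fun _ => 0) x 1 ((Rabs x + 1 + 1 / 2) ^ 2 / (2 * 1))).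
    + intros u. eapply is_cderive_val.
      * apply is_cderive_mult; [apply is_cderive_RtoC, is_derive_id | apply is_cderive_const].
      * cbv beta. change (@one R_AbsRing) with 1. ring.
    + intros u. apply is_cderive_const.
    + intros u. apply is_derive_Rconst.
    + intros u. apply is_derive_Rconst.
    + intros u _. rewrite He, Cmod_0, Rabs_R0. lra.
    + intros u Hu. apply damped_mult; [exact He|].
      replace u with (x + (u - x)) by ring. eapply Rle_trans; [apply Rabs_triang | lra].
  - cbv beta. replace (- 0 / 2) with 0 by field. ring.
Qed.

Lemma mellin_parts_ray (nu : R) (k : nat) (e : C) (x : R) : Cmod e = 1 ->
  Cmult (INR k + 1, nu) (mellin nu k (Cmult (RtoC x) e) 1)
  = Cplus (Cmult (Cmult (RtoC x) e) (mellin nu (S k) (Cmult (RtoC x) e) 1))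
          (mellin nu (S (S k)) (Cmult (RtoC x) e) 1).
Proof.
  intros He. rewrite (mellin_parts nu k _ 1 _ (damped_mult x e (Rabs x) He (Rle_refl _))). ring.
Qed.

(* Both sides of the scaling relation solve the same linear equation in [ln r], by [mellin_parts]. *)
Lemma Cmod_mellin_scale (nu : R) (k : nat) (e : C) (r : R) : Cmod e = 1 -> 0 <= fst e -> 0 < r ->
  Cmod (mellin nu k (Cmult (RtoC r) e) 1) * r ^ S k = Cmod (mellin nu k e (/ r ^ 2)).
Proof.
  intros He Hf Hr. set (b0 := / r ^ 2).
  assert (Hb0 : 0 < b0) by (apply Rinv_0_lt_compat, pow_lt, Hr).
  set (A := fun t : R => Cmult (RtoC (exp t)) e).
  set (b := fun t : R => exp t ^ 2 * b0).
  set (f := fun t : R => Cmult (Cexp (INR (S k) * t, nu * t)) (mellin nu k (A t) (b t))).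
  assert (dA : forall u, is_cderive A u (A u)).
  { intros u. eapply is_cderive_val.
    - apply is_cderive_mult; [apply is_cderive_RtoC, is_derive_Reals, derivable_pt_lim_exp | apply is_cderive_const].
    - unfold A. ring. }
  assert (db : forall u c, is_derive (fun t => c * b t) u (2 * c * b u)).
  { intros u c. unfold b. auto_derive; [exact I | ring]. }
  assert (Hfst : forall u, 0 <= fst (A u)).
  { intros u. unfold A; simpl. pose proof (exp_pos u). nra. }
  assert (D : forall t, is_cderive f t (RtoC 0)).
  { intros t. eapply is_cderive_val.
    - apply is_cderive_mult.
      + apply is_cderive_Cexp with (df := (INR (S k), nu)).
        split; apply is_derive_Rlin.
      + apply (is_cderive_mellin nu A A A b (fun t => 2 * b t) (fun t => 4 * b t) t
          (Rmax (exp (t + 1)) (4 * (exp (t + 1) ^ 2 * b0)))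
          ((0 + 1 / 2) ^ 2 / (2 * (exp (t - 1) ^ 2 * b0)))).
        * exact dA.
        * exact dA.
        * intros u. apply (is_derive_Rext (fun t => 1 * b t)); [intros; ring|].
          eapply is_derive_val; [apply db | ring].
        * intros u. eapply is_derive_val; [apply db | ring].
        * intros u Hu. apply Rabs_le_between in Hu.
          assert (Hexp : exp u <= exp (t + 1)).
          { destruct (Req_dec u (t + 1)) as [->|N]; [lra | left; apply exp_increasing; lra]. }
          pose proof (exp_pos u).
          assert (Cmod (A u) <= exp (t + 1)).
          { unfold A. rewrite Cmod_mult, Cmod_R, He, Rabs_right by lra. lra. }
          assert (0 < b u) by (unfold b; apply Rmult_lt_0_compat; [now apply pow_lt | lra]).
          assert (b u <= exp (t + 1) ^ 2 * b0).
          { unfold b. apply Rmult_le_compat_r; [lra|]. apply pow_incr; lra. }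
          pose proof (Rmax_l (exp (t + 1)) (4 * (exp (t + 1) ^ 2 * b0))).
          pose proof (Rmax_r (exp (t + 1)) (4 * (exp (t + 1) ^ 2 * b0))).
          rewrite !Rabs_right by lra. lra.
        * intros u Hu. apply Rabs_le_between in Hu.
          apply damped_quadratic; [pose proof (Hfst u); lra|]. split.
          -- apply Rmult_lt_0_compat; [apply pow_lt, exp_pos | lra].
          -- unfold b. apply Rmult_le_compat_r; [lra|]. apply pow_incr.
             split; [left; apply exp_pos|].
             destruct (Req_dec (t - 1) u) as [->|N]; [lra | left; apply exp_increasing; lra].
    - cbv beta.
      assert (P : Cmult (INR k + 1, nu) (mellin nu k (A t) (b t))
        = Cplus (Cmult (A t) (mellin nu (S k) (A t) (b t))) (Cmult (RtoC (b t)) (mellin nu (S (S k)) (A t) (b t)))).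
      { apply mellin_parts with ((0 + 1 / 2) ^ 2 / (2 * b t)).
        apply damped_quadratic; [pose proof (Hfst t); lra|]. split; [|lra].
        unfold b. apply Rmult_lt_0_compat; [apply pow_lt, exp_pos | lra]. }
      rewrite S_INR. replace (- (2 * b t) / 2) with (- b t) by field. rewrite RtoC_opp.
      set (E := Cexp _).
      transitivity (Cmult E (Cminus (Cmult (INR k + 1, nu) (mellin nu k (A t) (b t)))
        (Cplus (Cmult (A t) (mellin nu (S k) (A t) (b t))) (Cmult (RtoC (b t)) (mellin nu (S (S k)) (A t) (b t)))))).
      + ring.
      + rewrite P. ring. }
  (* At [t = ln r] the quadratic coefficient is 1, at [t = 0] the linear one is [e]; taking moduli
     removes the phase [r^(i nu)]. *)
  assert (E := is_cderive_constant_value f D (ln r) 0).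
  apply (f_equal Cmod) in E. unfold f in E. rewrite !Cmod_mult, !Cmod_Cexp in E. cbn [fst] in E.
  rewrite Rmult_0_r, exp_0, exp_INR_mult, exp_ln in E by exact Hr.
  unfold A, b in E. rewrite exp_0, exp_ln in E by exact Hr.
  replace (r ^ 2 * b0) with 1 in E by (unfold b0; field; lra).
  replace (1 ^ 2 * b0) with b0 in E by ring.
  replace (Cmult (RtoC 1) e) with e in E by ring.
  lra.
Qed.

Lemma cos_quarter_ge (p : R) : - (PI / 4) <= p <= PI / 4 -> 1 / 2 <= cos p.
Proof.
  intros Hp. pose proof PI_RGT_0.
  rewrite <- cos_PI3.
  destruct (Rle_dec 0 p).
  - apply cos_decr_1; lra.
  - rewrite <- (cos_neg p). apply cos_decr_1; lra.
Qed.

Definition unit_dir (p : R) : C := (cos p, sin p).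

Lemma Cmod_unit_dir (p : R) : Cmod (unit_dir p) = 1.
Proof.
  unfold unit_dir, Cmod; simpl. rewrite !Rmult_1_r.
  replace (cos p * cos p + sin p * sin p) with 1; [apply sqrt_1|].
  pose proof (sin2_cos2 p). unfold Rsqr in *. lra.
Qed.

(* Rotating [A = e^(ip)] through a quarter turn multiplies the Mellin integral by [e^(-i(1+i nu) pi/2)],
   exactly if [b = 0]; this is the source of the Landau-Zener exponent. *)
Lemma mellin_rotation (nu : R) : exists c, forall b, 0 < b ->
  Rabs (Cmod (mellin nu 0 (unit_dir (PI / 4)) b) * exp (- (nu * (PI / 4)))
        - Cmod (mellin nu 0 (unit_dir (- (PI / 4))) b) * exp (nu * (PI / 4))) <= c * b.
Proof.
  destruct (mellin_bound 2) as [c2 [Hc2 H2]].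
  pose proof PI_RGT_0 as Hpi.
  set (L := exp (Rabs nu * (PI / 4)) * c2 * (PI / 2)).
  exists (2 * L). intros b Hb.
  (* The prefactor is [e^(i p (1 + i nu))]. By the recurrence it cancels the part of the
     [p]-derivative that does not contain [b], so that [df] carries an explicit factor [b]. *)
  set (f := fun p => Cmult (Cexp (- (nu * p), p)) (mellin nu 0 (unit_dir p) b)).
  set (df := fun p => Cmult (Cmult Ci (RtoC b)) (Cmult (Cexp (- (nu * p), p)) (mellin nu 2 (unit_dir p) b))).
  (* This constant blows up as [b] tends to 0. It serves only to justify the derivative and the
     recurrence; the size of [df] is controlled below with [K = 0], which is where [|p| <= PI / 4]
     enters. *)
  assert (Hdamp : forall u, damped (unit_dir u) b ((1 + 1 / 2) ^ 2 / (2 * b))).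
  { intros u. apply damped_quadratic; [|lra]. simpl. pose proof (COS_bound u). lra. }
  assert (D : forall p, is_cderive f p (df p)).
  { intros p. eapply is_cderive_val.
    - apply is_cderive_mult.
      + apply is_cderive_Cexp with (df := (- nu, 1)). split; cbn [fst snd]; auto_derive; try exact I; ring.
      + apply (is_cderive_mellin nu unit_dir (fun u => Cmult Ci (unit_dir u)) (fun u => Copp (unit_dir u))
          (fun _ => b) (fun _ => 0) (fun _ => 0) p 1 ((1 + 1 / 2) ^ 2 / (2 * b))).
        * intros u. unfold unit_dir. split; simpl; auto_derive; try exact I; ring.
        * intros u. unfold unit_dir. split; simpl; auto_derive; try exact I; ring.
        * intros u. apply is_derive_Rconst.
        * intros u. apply is_derive_Rconst.
        * intros u _. rewrite Cmod_mult, Cmod_opp, Cmod_Ci, Cmod_unit_dir, Rabs_R0. lra.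
        * intros u _. apply Hdamp.
    - cbv beta.
      assert (P := mellin_parts nu 0 (unit_dir p) b _ (Hdamp p)).
      replace (INR 0 + 1, nu) with (Cplus (RtoC 1) (Cmult Ci (RtoC nu))) in P
        by (apply injective_projections; simpl; ring).
      unfold df. set (E := Cexp _). replace (- 0 / 2) with 0 by field.
      replace (- nu, 1) with (Cmult Ci (Cplus (RtoC 1) (Cmult Ci (RtoC nu))))
        by (apply injective_projections; simpl; ring).
      transitivity (Cmult (Cmult Ci E) (Cminus (Cmult (Cplus (RtoC 1) (Cmult Ci (RtoC nu))) (mellin nu 0 (unit_dir p) b))
         (Cmult (unit_dir p) (mellin nu 1 (unit_dir p) b)))).
      + ring.
      + rewrite P. ring. }
  assert (Bd : forall p, - (PI / 4) <= p <= PI / 4 -> Cmod (df p) <= exp (Rabs nu * (PI / 4)) * c2 * b).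
  { intros p Hp. unfold df. rewrite !Cmod_mult, Cmod_Ci, Cmod_R, Cmod_Cexp, (Rabs_right b) by lra. cbn [fst].
    assert (Cmod (mellin nu 2 (unit_dir p) b) <= c2).
    { assert (K := H2 nu (unit_dir p) b 0). rewrite exp_0, Rmult_1_r in K. apply K.
      apply damped_half; [now apply cos_quarter_ge | lra]. }
    assert (exp (- (nu * p)) <= exp (Rabs nu * (PI / 4))).
    { assert (Hle : - (nu * p) <= Rabs nu * (PI / 4)).
      { eapply Rle_trans; [apply Rle_abs|]. rewrite Rabs_Ropp, Rabs_mult.
        apply Rmult_le_compat_l; [apply Rabs_pos | apply Rabs_le; lra]. }
      destruct Hle as [h|h]; [left; now apply exp_increasing | rewrite h; lra]. }
    pose proof (exp_pos (- (nu * p))). pose proof (Cmod_ge_0 (mellin nu 2 (unit_dir p) b)).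
    assert (exp (- (nu * p)) * Cmod (mellin nu 2 (unit_dir p) b) <= exp (Rabs nu * (PI / 4)) * c2)
      by (apply Rmult_le_compat; lra).
    nra. }
  assert (M1 : Rabs (fst (f (PI / 4)) - fst (f (- (PI / 4)))) <= L * b).
  { destruct (MVT_point (fun p => fst (f p)) (fun p => fst (df p)) (- (PI / 4)) (PI / 4)) as [p [Hp E]];
      [intros; apply D|].
    cbv beta in E. rewrite E, Rabs_mult. replace (PI / 4 - - (PI / 4)) with (PI / 2) by field.
    rewrite (Rabs_right (PI / 2)) by lra.
    rewrite Rmin_left, Rmax_right in Hp by lra.
    pose proof (abs_fst_le_Cmod (df p)). specialize (Bd p Hp).
    replace (L * b) with (exp (Rabs nu * (PI / 4)) * c2 * b * (PI / 2)) by (unfold L; ring).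
    apply Rmult_le_compat_r; lra. }
  assert (M2 : Rabs (snd (f (PI / 4)) - snd (f (- (PI / 4)))) <= L * b).
  { destruct (MVT_point (fun p => snd (f p)) (fun p => snd (df p)) (- (PI / 4)) (PI / 4)) as [p [Hp E]];
      [intros; apply D|].
    cbv beta in E. rewrite E, Rabs_mult. replace (PI / 4 - - (PI / 4)) with (PI / 2) by field.
    rewrite (Rabs_right (PI / 2)) by lra.
    rewrite Rmin_left, Rmax_right in Hp by lra.
    pose proof (abs_snd_le_Cmod (df p)). specialize (Bd p Hp).
    replace (L * b) with (exp (Rabs nu * (PI / 4)) * c2 * b * (PI / 2)) by (unfold L; ring).
    apply Rmult_le_compat_r; lra. }
  replace (Cmod (mellin nu 0 (unit_dir (PI / 4)) b) * exp (- (nu * (PI / 4)))) with (Cmod (f (PI / 4)))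
    by (unfold f; rewrite Cmod_mult, Cmod_Cexp; cbn [fst]; ring).
  replace (Cmod (mellin nu 0 (unit_dir (- (PI / 4))) b) * exp (nu * (PI / 4))) with (Cmod (f (- (PI / 4))))
    by (unfold f; rewrite Cmod_mult, Cmod_Cexp; cbn [fst];
        replace (- (nu * - (PI / 4))) with (nu * (PI / 4)) by ring; ring).
  eapply Rle_trans; [apply Cmod_triangle_inv|]. eapply Rle_trans; [apply Cmod_le_abs|].
  replace (2 * L * b) with (L * b + L * b) by ring.
  apply Rplus_le_compat; [exact M1 | exact M2].
Qed.

(** * Non-vanishing of the Gaussian Mellin integrals *)

Lemma cos_ge_quadratic (x : R) : 1 - x ^ 2 / 2 <= cos x.
Proof.
  assert (S : forall y, sin y ^ 2 <= y ^ 2).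
  { intros y. destruct (MVT_point sin cos 0 y) as [c [_ E]].
    - intros; apply is_derive_Reals, derivable_pt_lim_sin.
    - rewrite sin_0 in E. replace (sin y) with (cos c * y) by lra.
      pose proof (COS_bound c). pose proof (pow2_ge_0 y). assert (cos c ^ 2 <= 1) by nra.
      rewrite Rpow_mult_distr. nra. }
  replace x with (2 * (x / 2)) at 2 by field. rewrite cos_2a_sin.
  specialize (S (x / 2)). nra.
Qed.

Lemma lineint_pos (f : R -> R) : tame f -> (forall y, 0 < f y) -> 0 < lineint f.
Proof.
  intros Ht Hp. assert (Hc := proj1 Ht).
  assert (Hex : forall a b, ex_RInt f a b) by (intros; now apply continuous_ex_RInt).
  apply Rlt_le_trans with (RInt f (- INR 1) (INR 1)).
  - apply RInt_gt_0; [simpl; lra | auto |]. intros; apply Hc.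
  - apply (is_lim_seq_incr_compare (fun n => RInt f (- INR n) (INR n)) (lineint f) (lineint_correct f Ht)).
    intros n. rewrite S_INR. pose proof (pos_INR n).
    rewrite <- (RInt_Chasles f (- (INR n + 1)) (- INR n) (INR n + 1)) by auto.
    rewrite <- (RInt_Chasles f (- INR n) (INR n) (INR n + 1)) by auto.
    unfold plus; simpl.
    assert (0 <= RInt f (- (INR n + 1)) (- INR n)) by (apply RInt_ge_0; auto; [lra | intros; left; auto]).
    assert (0 <= RInt f (INR n) (INR n + 1)) by (apply RInt_ge_0; auto; [lra | intros; left; auto]).
    lra.
Qed.

Lemma damped_gauss : damped (RtoC 0) 1 ((0 + 1 / 2) ^ 2 / (2 * 1)).
Proof. apply damped_quadratic; simpl; lra. Qed.

Lemma mellin_gauss_rec (nu : R) (k : nat) :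
  Cmult (INR k + 1, nu) (mellin nu k (RtoC 0) 1) = mellin nu (S (S k)) (RtoC 0) 1.
Proof. rewrite (mellin_parts nu k _ _ _ damped_gauss). ring. Qed.

(* For large [k] the weight [t^k exp (- t^2 / 2)] concentrates where the phase [t^(i nu)] hardly varies,
   and the recurrence carries vanishing from [k = 0, 1] to all [k]. *)
Lemma mellin_gauss_nonzero (nu : R) :
  ~ (mellin nu 0 (RtoC 0) 1 = RtoC 0 /\ mellin nu 1 (RtoC 0) 1 = RtoC 0).
Proof.
  intros [Z0 Z1].
  assert (Z : forall k, mellin nu k (RtoC 0) 1 = RtoC 0 /\ mellin nu (S k) (RtoC 0) 1 = RtoC 0).
  { induction k as [|k [I1 I2]]; [split; assumption|]. split; [exact I2|].
    rewrite <- mellin_gauss_rec, I1. ring. }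
  set (w := fun k y => fst (mellin_integrand 0 k (RtoC 0) 1 y)).
  set (N := fun k => lineint (w k)).
  assert (Ew : forall mu k y, mellin_integrand mu k (RtoC 0) 1 y = (w k y * cos (mu * y), w k y * sin (mu * y))).
  { intros mu k y. unfold w, mellin_integrand, Cexp. cbn [fst snd RtoC].
    replace (- 0 * exp y + 0 * y) with 0 by ring. replace (- 0 * exp y + mu * y) with (mu * y) by ring.
    rewrite cos_0, Rmult_1_r. reflexivity. }
  assert (wpos : forall k y, 0 < w k y).
  { intros k y. unfold w, mellin_integrand, Cexp. cbn [fst snd RtoC].
    replace (- 0 * exp y + 0 * y) with 0 by ring. rewrite cos_0, Rmult_1_r. apply exp_pos. }
  assert (wS : forall k y, w (S k) y = exp y * w k y).
  { intros k y. unfold w. rewrite mellin_integrand_S. simpl. ring. }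
  assert (tw : forall k, tame (w k)) by (intros k; apply (tame_mellin_integrand 0 k _ _ _ damped_gauss)).
  assert (Nrec : forall k, (INR k + 1) * N k = N (S (S k))).
  { intros k. assert (E := f_equal fst (mellin_gauss_rec 0 k)). unfold Cmult, mellin in E. cbn [fst snd] in E.
    unfold N, w. rewrite <- E. ring. }
  assert (Npos : forall k, 0 < N k) by (intros k; apply lineint_pos; auto).
  destruct (INR_unbounded (nu ^ 2)) as [j Hj].
  (* The weight [w k] peaks at [t^2 = k + 1], that is at [y = y0]; the shift by two makes
     [k - 2 = j] an available index. *)
  set (k := S (S j)). set (y0 := ln (INR k + 1) / 2).
  assert (Hk : 0 < INR k + 1) by (pose proof (pos_INR k); lra).
  assert (Ey0 : exp (2 * y0) = INR k + 1).
  { unfold y0. replace (2 * (ln (INR k + 1) / 2)) with (ln (INR k + 1)) by field. now apply exp_ln. }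
  set (F := mellin_integrand nu k (RtoC 0) 1).
  assert (TF : ctame F) by apply (tame_mellin_integrand nu k _ _ _ damped_gauss).
  set (cc := cos (nu * y0)). set (ss := sin (nu * y0)).
  (* Real part of [e^(- i nu y0)] times the vanishing integral, that is the integral of [w k]
     against [cos (nu (y - y0))]. *)
  assert (I0 : lineint (fun y => cc * fst (F y) + ss * snd (F y)) = 0).
  { rewrite (lineint_lin _ _ cc ss (proj1 TF) (proj2 TF)).
    assert (E := proj1 (Z k)). unfold mellin in E. fold F in E.
    pose proof (f_equal fst E) as E1. pose proof (f_equal snd E) as E2. cbn [fst snd RtoC] in E1, E2.
    rewrite E1, E2. ring. }
  (* From [cos x >= 1 - x^2 / 2] and [4 (y - y0)^2 <= exp (2 (y - y0)) + exp (- 2 (y - y0)) - 2].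
     The two exponentials shift the index of [w] by [+2] and [-2], so the lower bound integrates to
     a combination of the moments [N]. *)
  set (c := nu ^ 2 / 8).
  assert (Tg1 := tame_lin _ _ (1 + 2 * c) (- (c * / (INR k + 1))) (tw k) (tw (S (S k)))).
  assert (Tg := tame_lin _ _ 1 (- (c * (INR k + 1))) Tg1 (tw j)).
  assert (EL : lineint (fun y => 1 * ((1 + 2 * c) * w k y + - (c * / (INR k + 1)) * w (S (S k)) y) + - (c * (INR k + 1)) * w j y)
    = 1 * ((1 + 2 * c) * N k + - (c * / (INR k + 1)) * ((INR k + 1) * N k)) + - (c * (INR k + 1)) * N j).
  { refine (eq_trans (lineint_lin _ _ 1 _ Tg1 (tw j)) _).
    unfold N at 3. f_equal. f_equal. rewrite Nrec.
    exact (lineint_lin _ _ _ _ (tw k) (tw (S (S k)))). }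
  assert (Hle : 1 * ((1 + 2 * c) * N k + - (c * / (INR k + 1)) * ((INR k + 1) * N k)) + - (c * (INR k + 1)) * N j <= 0).
  { rewrite <- EL, <- I0. apply (lineint_le _ _ Tg (tame_lin _ _ cc ss (proj1 TF) (proj2 TF))). intros y.
    unfold F. rewrite Ew. cbn [fst snd].
    replace (cc * (w k y * cos (nu * y)) + ss * (w k y * sin (nu * y)))
      with (w k y * cos (nu * (y - y0))).
    2:{ rewrite Rmult_minus_distr_l, cos_minus. unfold cc, ss. ring. }
    assert (Q := cos_ge_quadratic (nu * (y - y0))).
    assert (P := exp_add_exp_opp_ge (2 * (y - y0))).
    replace (exp (2 * (y - y0))) with (exp y ^ 2 * / (INR k + 1)) in P.
    2:{ replace (2 * (y - y0)) with (INR 2 * y + - (2 * y0)) by (simpl; ring).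
        rewrite exp_plus, exp_Ropp, Ey0, exp_INR_mult. reflexivity. }
    replace (exp (- (2 * (y - y0)))) with ((INR k + 1) * / exp y ^ 2) in P.
    2:{ replace (- (2 * (y - y0))) with (2 * y0 + - (INR 2 * y)) by (simpl; ring).
        rewrite exp_plus, exp_Ropp, Ey0, exp_INR_mult. reflexivity. }
    assert (Wj : w j y = w k y * / exp y ^ 2).
    { unfold k. rewrite !wS. field. pose proof (exp_pos y); lra. }
    rewrite !wS, Wj.
    apply Rle_trans with (w k y * (1 - c * (exp y ^ 2 * / (INR k + 1) + (INR k + 1) * / exp y ^ 2 - 2))).
    - right. field. pose proof (exp_pos y); split; lra.
    - apply Rmult_le_compat_l; [left; apply wpos|].
      eapply Rle_trans; [|exact Q]. rewrite Rpow_mult_distr.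
      assert (0 <= c) by (unfold c; pose proof (pow2_ge_0 nu); lra).
      replace (nu ^ 2) with (8 * c) by (unfold c; field). nra. }
  assert (Nk : N k = (INR j + 1) * N j) by (unfold k; now rewrite Nrec).
  assert (Ek : INR k = INR j + 2) by (unfold k; rewrite !S_INR; ring).
  replace (- (c * / (INR k + 1)) * ((INR k + 1) * N k)) with (- c * N k) in Hle by (field; lra).
  rewrite Nk, Ek in Hle. pose proof (Npos j). pose proof (pos_INR j).
  (* The recurrence for the moments reduces the lower bound to exactly this expression; it is
     positive because [j > nu^2 = 8 c], against [Hle]. *)
  assert (0 < (INR j + 1 - 2 * c) * N j).
  { apply Rmult_lt_0_compat; [|assumption]. unfold c. pose proof (pow2_ge_0 nu). lra. }
  nra.
Qed.

(** * The Landau-Zener spinor *)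

Lemma Cmod2_components (z : C) : Cmod z ^ 2 = fst z ^ 2 + snd z ^ 2.
Proof. exact (Cmod2_alt z). Qed.

Lemma is_derive_Cmod2 (f : R -> C) (t : R) (l : C) : is_cderive f t l ->
  is_derive (fun t => Cmod (f t) ^ 2) t (2 * (fst (f t) * fst l + snd (f t) * snd l)).
Proof.
  intros [H1 H2].
  apply (is_derive_Rext (fun t => fst (f t) * fst (f t) + snd (f t) * snd (f t))).
  - intros u. rewrite Cmod2_components. ring.
  - eapply is_derive_val.
    + exact (is_derive_Rplus _ _ _ _ _ (is_derive_Rmult _ _ _ _ _ H1 H1) (is_derive_Rmult _ _ _ _ _ H2 H2)).
    + cbv beta; ring.
Qed.

Lemma unit_dir_quarter_sqr : Cmult (unit_dir (PI / 4)) (unit_dir (PI / 4)) = Ci.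
Proof.
  apply injective_projections; simpl.
  - rewrite sin_PI4, cos_PI4. ring.
  - transitivity (2 * sin (PI / 4) * cos (PI / 4)); [ring|].
    rewrite <- sin_2a. replace (2 * (PI / 4)) with (PI / 2) by field. apply sin_PI2.
Qed.

Lemma unit_dir_quarter_neg :
  unit_dir (- (PI / 4)) = Copp (Cmult Ci (unit_dir (PI / 4))).
Proof.
  unfold unit_dir. rewrite cos_neg, sin_neg, sin_PI4, cos_PI4.
  apply injective_projections; simpl; ring.
Qed.

Lemma is_lim_seq_inv_S : is_lim_seq (fun n => / (INR n + 1)) 0.
Proof.
  replace (Finite 0) with (Rbar_inv p_infty) by reflexivity.
  apply is_lim_seq_inv; [|discriminate].
  apply (is_lim_seq_ext (fun n => INR (S n))); [intros; apply S_INR|].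
  apply (is_lim_seq_incr_1 INR), is_lim_seq_INR.
Qed.

Lemma is_lim_seq_rate (f : nat -> R) (l c : R) :
  (forall n, Rabs (f n - l) <= c / (INR n + 1)) -> is_lim_seq f l.
Proof.
  intros H.
  assert (Z : is_lim_seq (fun n => f n - l) 0).
  { apply is_lim_seq_abs_0. apply (is_lim_seq_le_le (fun _ => 0) _ (fun n => c / (INR n + 1))).
    - intros n. split; [apply Rabs_pos | apply H].
    - apply is_lim_seq_const.
    - replace (Finite 0) with (Finite (c * 0)) by (f_equal; ring).
      apply (is_lim_seq_mult' (fun _ => c)); [apply is_lim_seq_const | apply is_lim_seq_inv_S]. }
  apply (is_lim_seq_ext (fun n => (f n - l) + l)); [intros; ring|].
  replace (Finite l) with (Finite (0 + l)) by (f_equal; ring).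
  apply is_lim_seq_plus'; [exact Z | apply is_lim_seq_const].
Qed.

Section LandauZener.

Variable nu : R.
Hypothesis nu_pos : 0 < nu.

Let e := unit_dir (PI / 4).
Let V k x := mellin nu k (Cmult (RtoC x) e) 1.
Let W k y := mellin nu k (Cmult (RtoC y) (unit_dir (- (PI / 4)))) 1.

(* The rescaled equation continues to complex [x]; [UV] is the solution on the real axis
   and [UW] its values at [- i y], where the conserved form becomes indefinite. *)
Let UV x := Cminus (Cmult (RtoC x) (V 0 x)) (Cmult (Cmult Ci e) (V 1 x)).
Let UW y := Cminus (Cmult (Copp (Cmult Ci (RtoC y))) (W 0 y)) (Cmult (Cmult Ci e) (W 1 y)).

Lemma lz_dV (k : nat) (x : R) : is_cderive (V k) x (Copp (Cmult e (V (S k) x))).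
Proof. exact (is_cderive_mellin_ray nu k e x (Cmod_unit_dir _)). Qed.

Lemma lz_dW (k : nat) (y : R) : is_cderive (W k) y (Cmult (Cmult Ci e) (W (S k) y)).
Proof.
  eapply is_cderive_val; [exact (is_cderive_mellin_ray nu k (unit_dir (- (PI / 4))) y (Cmod_unit_dir _))|].
  fold (W (S k) y). rewrite unit_dir_quarter_neg. fold e. ring.
Qed.

(** This equation dictates the choice of [UV]: it is what [V 0] and its derivative [- e V 1] leave
    over once the term [i x V 0] is split off. *)
Lemma lz_dV0 (x : R) :
  is_cderive (V 0) x (Cminus (Cmult (Cmult Ci (RtoC x)) (V 0 x)) (Cmult Ci (UV x))).
Proof.
  eapply is_cderive_val; [apply lz_dV|]. unfold UV.
  transitivity (Cmult (Cmult Ci Ci) (Cmult e (V 1 x))); [|ring].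
  replace (Cmult Ci Ci) with (Copp (RtoC 1)) by (apply injective_projections; simpl; ring). ring.
Qed.

(** The recurrence at [k = 0] eliminates [V 2]; since [e^2 = i], the terms in [V 1] cancel and so
    does the 1 in [1 + i nu], leaving only [nu]. *)
Lemma lz_dUV (x : R) : is_cderive UV x (Cmult (Copp (Cmult Ci (RtoC nu))) (V 0 x)).
Proof.
  eapply is_cderive_val.
  - apply is_cderive_minus; [apply is_cderive_mult; [apply is_cderive_RtoC, is_derive_id | apply lz_dV]
                            | apply is_cderive_scal, lz_dV].
  - change (@one R_AbsRing) with 1. cbv beta.
    assert (P := mellin_parts_ray nu 0 e x (Cmod_unit_dir _)). fold (V 0 x) (V 1 x) (V 2 x) in P.
    assert (Q := unit_dir_quarter_sqr). fold e in Q.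
    assert (P' : V 2 x = Cminus (Cmult (INR 0 + 1, nu) (V 0 x)) (Cmult (Cmult (RtoC x) e) (V 1 x))) by (rewrite P; ring).
    transitivity (Cplus (Cminus (V 0 x) (Cmult (Cmult (RtoC x) e) (V 1 x))) (Cmult (Cmult Ci (Cmult e e)) (V 2 x))); [ring|].
    rewrite Q, P'.
    replace (Cmult Ci Ci) with (Copp (RtoC 1)) by (apply injective_projections; simpl; ring).
    replace (INR 0 + 1, nu) with (Cplus (RtoC 1) (Cmult Ci (RtoC nu)))
      by (apply injective_projections; simpl; ring).
    ring.
Qed.

Lemma lz_dW0 (y : R) :
  is_cderive (W 0) y (Copp (Cplus (Cmult (Cmult Ci (RtoC y)) (W 0 y)) (UW y))).
Proof.
  eapply is_cderive_val; [apply lz_dW|]. unfold UW. ring.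
Qed.

Lemma lz_dUW (y : R) : is_cderive UW y (Copp (Cmult (RtoC nu) (W 0 y))).
Proof.
  eapply is_cderive_val.
  - apply is_cderive_minus; [apply is_cderive_mult; [|apply lz_dW] | apply is_cderive_scal, lz_dW].
    apply (is_cderive_ext (fun y => Cmult (Copp Ci) (RtoC y))); [intros; ring|].
    apply is_cderive_scal, is_cderive_RtoC, is_derive_id.
  - change (@one R_AbsRing) with 1. cbv beta.
    assert (P := mellin_parts_ray nu 0 (unit_dir (- (PI / 4))) y (Cmod_unit_dir _)).
    fold (W 0 y) (W 1 y) (W 2 y) in P.
    assert (Q := unit_dir_quarter_sqr). fold e in Q.
    assert (P' : W 2 y = Cminus (Cmult (INR 0 + 1, nu) (W 0 y)) (Cmult (Cmult (RtoC y) (unit_dir (- (PI / 4)))) (W 1 y))) by (rewrite P; ring).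
    rewrite unit_dir_quarter_neg in P'. fold e in P'.
    assert (II : Cmult Ci Ci = Copp (RtoC 1)) by (apply injective_projections; simpl; ring).
    transitivity (Cminus (Cminus (Copp (Cmult Ci (W 0 y))) (Cmult (Cmult (Cmult Ci Ci) (Cmult (RtoC y) e)) (W 1 y)))
       (Cmult (Cmult (Cmult Ci Ci) (Cmult e e)) (W 2 y))); [ring|].
    rewrite Q, P', II.
    replace (INR 0 + 1, nu) with (Cplus (RtoC 1) (Cmult Ci (RtoC nu)))
      by (apply injective_projections; simpl; ring).
    transitivity (Cplus (Cmult (Cmult (Cmult Ci Ci) (RtoC nu)) (W 0 y))
      (Cmult (Cplus (RtoC 1) (Cmult Ci Ci)) (Cmult (Cmult (RtoC y) e) (W 1 y)))); [ring|].
    rewrite II. ring.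
Qed.

Let N := Cmod (UV 0) ^ 2 / nu + Cmod (V 0 0) ^ 2.
Let N' := Cmod (UV 0) ^ 2 / nu - Cmod (V 0 0) ^ 2.

Lemma lz_conserved (x : R) : Cmod (UV x) ^ 2 / nu + Cmod (V 0 x) ^ 2 = N.
Proof.
  apply (is_derive_constant_value (fun x => Cmod (UV x) ^ 2 / nu + Cmod (V 0 x) ^ 2)).
  intros t. eapply is_derive_val.
  - apply is_derive_Rplus; [apply is_derive_Rmult; [|apply is_derive_Rconst]|]; apply is_derive_Cmod2;
      [apply lz_dUV | apply lz_dV0].
  - cbv beta. destruct (UV t) as [u1 u2], (V 0 t) as [v1 v2]. simpl. field. lra.
Qed.

(** The two axes meet at the origin, where [W k] and [V k] agree. The constant is thus built from
    the same two numbers as [N], and the asymptotics on both axes can be compared. *)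
Lemma lz_conserved' (y : R) : Cmod (UW y) ^ 2 / nu - Cmod (W 0 y) ^ 2 = N'.
Proof.
  assert (Z : forall k, W k 0 = V k 0).
  { intros k. unfold W, V. f_equal. ring. }
  assert (Z' : UW 0 = UV 0) by (unfold UW, UV; rewrite !Z; ring).
  unfold N'. rewrite <- Z', <- (Z 0%nat).
  apply (is_derive_constant_value (fun x => Cmod (UW x) ^ 2 / nu - Cmod (W 0 x) ^ 2)).
  intros t. eapply is_derive_val.
  - apply is_derive_Rminus; [apply is_derive_Rmult; [|apply is_derive_Rconst]|]; apply is_derive_Cmod2;
      [apply lz_dUW | apply lz_dW0].
  - cbv beta. destruct (UW t) as [u1 u2], (W 0 t) as [v1 v2]. simpl. field. lra.
Qed.

Lemma lz_N_pos : 0 < N.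
Proof.
  assert (0 <= Cmod (UV 0) ^ 2 / nu) by (apply Rmult_le_pos; [apply pow2_ge_0 | left; now apply Rinv_0_lt_compat]).
  assert (0 <= Cmod (V 0 0) ^ 2) by apply pow2_ge_0.
  destruct (Rle_lt_or_eq_dec 0 N) as [h|h]; [unfold N; lra | exact h | exfalso].
  assert (EV : forall k, mellin nu k (RtoC 0) 1 = V k 0) by (intros k; unfold V; f_equal; ring).
  apply (mellin_gauss_nonzero nu). unfold N in h.
  assert (E1 : Cmod (V 0 0) ^ 2 = 0) by lra.
  assert (E2 : Cmod (UV 0) ^ 2 / nu = 0) by lra.
  split; rewrite EV; apply Cmod_eq_0.
  - rewrite <- Rsqr_pow2 in E1. now apply Rsqr_0_uniq.
  - replace (Cmod (V 1 0)) with (Cmod (UV 0)).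
    + apply Rsqr_0_uniq. rewrite Rsqr_pow2.
      replace (Cmod (UV 0) ^ 2) with (Cmod (UV 0) ^ 2 / nu * nu) by (field; lra). rewrite E2; ring.
    + unfold UV. replace (Cminus (Cmult (RtoC 0) (V 0 0)) (Cmult (Cmult Ci e) (V 1 0)))
        with (Copp (Cmult (Cmult Ci e) (V 1 0))) by ring.
      rewrite Cmod_opp, !Cmod_mult, Cmod_Ci. unfold e. rewrite Cmod_unit_dir. ring.
Qed.

Lemma unit_dir_quarter_pos : 1 / 2 <= fst e /\ 1 / 2 <= fst (unit_dir (- (PI / 4))).
Proof. pose proof PI_RGT_0. split; apply cos_quarter_ge; lra. Qed.

(** Scaling trades large [x] for a small Gaussian coefficient [/ x^2]; with real part of the
    direction at least [1 / 2] the scaled integral is bounded uniformly in that coefficient. *)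
Lemma lz_decay (k : nat) : exists c, 0 <= c /\ forall x, 0 < x ->
  Cmod (V k x) <= c / x ^ S k /\ Cmod (W k x) <= c / x ^ S k.
Proof.
  destruct (mellin_bound k) as [c [Hc H]]. exists c. split; [exact Hc|].
  intros x Hx. destruct unit_dir_quarter_pos as [P1 P2].
  assert (Hb : 0 <= / x ^ 2) by (left; now apply Rinv_0_lt_compat, pow_lt).
  assert (Hp := pow_lt x (S k) Hx).
  assert (G : forall e', Cmod e' = 1 -> 1 / 2 <= fst e' -> Cmod (mellin nu k (Cmult (RtoC x) e') 1) <= c / x ^ S k).
  { intros e' E1 E2.
    assert (Sc := Cmod_mellin_scale nu k e' x E1 ltac:(lra) Hx).
    specialize (H nu e' (/ x ^ 2) 0 (damped_half _ _ E2 Hb)). rewrite exp_0 in H.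
    apply Rmult_le_reg_r with (x ^ S k); [exact Hp|]. rewrite Sc.
    unfold Rdiv. rewrite Rmult_assoc, Rinv_l by lra. lra. }
  split; apply G; auto; apply Cmod_unit_dir.
Qed.

(** Up to [V 1] and [W 1], which are of order [x^-2], the moduli of [UV] and [UW] are [x |V 0|] and
    [x |W 0|]. By scaling these are Mellin integrals in the directions [PI / 4] and [- PI / 4] with
    [b = / x^2], and the rotation lemma compares them. *)
Lemma lz_amplitude : exists c, forall n,
  Rabs (Cmod (UV (INR n + 1)) * exp (- (nu * (PI / 4))) - Cmod (UW (INR n + 1)) * exp (nu * (PI / 4)) - 0)
    <= c / (INR n + 1).
Proof.
  destruct (mellin_rotation nu) as [c1 H1]. destruct (lz_decay 1) as [c2 [Hc2 H2]].
  set (p := exp (- (nu * (PI / 4)))). set (q := exp (nu * (PI / 4))).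
  assert (Hp : 0 < p) by apply exp_pos. assert (Hq : 0 < q) by apply exp_pos.
  exists (Rabs c1 + c2 * p + c2 * q). intros n.
  set (x := INR n + 1). assert (Hx : 1 <= x) by (unfold x; pose proof (pos_INR n); lra).
  destruct (H2 x ltac:(lra)) as [A1 A2]. destruct unit_dir_quarter_pos as [P1 P2].
  assert (Hi : 0 < / x ^ 2) by (apply Rinv_0_lt_compat, pow_lt; lra).
  assert (Hii : / x ^ 2 <= / x) by (apply Rinv_le_contravar; [lra | nra]).
  specialize (H1 (/ x ^ 2) Hi). fold p q in H1.
  assert (S1 := Cmod_mellin_scale nu 0 e x (Cmod_unit_dir _) ltac:(lra) ltac:(lra)). fold (V 0 x) in S1.
  assert (S2 := Cmod_mellin_scale nu 0 (unit_dir (- (PI / 4))) x (Cmod_unit_dir _) ltac:(lra) ltac:(lra)). fold (W 0 x) in S2.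
  fold e in H1. rewrite <- S1, <- S2, pow_1 in H1.
  assert (B1 : Rabs (Cmod (UV x) - Cmod (V 0 x) * x) <= c2 / x).
  { replace (Cmod (V 0 x) * x) with (Cmod (Cmult (RtoC x) (V 0 x)))
      by (rewrite Cmod_mult, Cmod_R, Rabs_right by lra; ring).
    eapply Rle_trans; [apply Cmod_triangle_inv|]. unfold UV.
    replace (Cminus (Cminus (Cmult (RtoC x) (V 0 x)) (Cmult (Cmult Ci e) (V 1 x))) (Cmult (RtoC x) (V 0 x)))
      with (Copp (Cmult (Cmult Ci e) (V 1 x))) by ring.
    rewrite Cmod_opp, !Cmod_mult, Cmod_Ci. unfold e. rewrite Cmod_unit_dir. fold e.
    eapply Rle_trans; [|apply Rmult_le_compat_l; [exact Hc2 | exact Hii]]. unfold Rdiv in A1. lra. }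
  assert (B2 : Rabs (Cmod (UW x) - Cmod (W 0 x) * x) <= c2 / x).
  { replace (Cmod (W 0 x) * x) with (Cmod (Cmult (Copp (Cmult Ci (RtoC x))) (W 0 x)))
      by (rewrite Cmod_mult, Cmod_opp, Cmod_mult, Cmod_Ci, Cmod_R, Rabs_right by lra; ring).
    eapply Rle_trans; [apply Cmod_triangle_inv|]. unfold UW.
    replace (Cminus (Cminus (Cmult (Copp (Cmult Ci (RtoC x))) (W 0 x)) (Cmult (Cmult Ci e) (W 1 x))) (Cmult (Copp (Cmult Ci (RtoC x))) (W 0 x)))
      with (Copp (Cmult (Cmult Ci e) (W 1 x))) by ring.
    rewrite Cmod_opp, !Cmod_mult, Cmod_Ci. unfold e. rewrite Cmod_unit_dir. fold e.
    eapply Rle_trans; [|apply Rmult_le_compat_l; [exact Hc2 | exact Hii]]. unfold Rdiv in A2. lra. }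
  replace (Cmod (UV x) * p - Cmod (UW x) * q - 0) with
    ((Cmod (UV x) - Cmod (V 0 x) * x) * p + (- (Cmod (UW x) - Cmod (W 0 x) * x) * q
      + (Cmod (V 0 x) * x * p - Cmod (W 0 x) * x * q))) by ring.
  eapply Rle_trans; [apply Rabs_triang|]. rewrite Rabs_mult, (Rabs_right p) by lra.
  eapply Rle_trans; [apply Rplus_le_compat_l, Rabs_triang|]. rewrite Rabs_mult, Rabs_Ropp, (Rabs_right q) by lra.
  assert (B3 : c1 * / x ^ 2 <= Rabs c1 / x).
  { eapply Rle_trans; [apply Rmult_le_compat_r; [lra | apply Rle_abs]|].
    apply Rmult_le_compat_l; [apply Rabs_pos | exact Hii]. }
  apply Rle_trans with (c2 / x * p + (c2 / x * q + Rabs c1 / x)).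
  - apply Rplus_le_compat; [apply Rmult_le_compat_r; lra|].
    apply Rplus_le_compat; [apply Rmult_le_compat_r; lra|]. lra.
  - right. field. lra.
Qed.

(** Used with [s = 1] on the real axis and [s = -1] on the imaginary one. The nonnegativity of the
    conserved value is a genuine output in the second case, where the form is indefinite. *)
Lemma lz_sqr_rate (f g : R -> R) (n0 c s : R) :
  (forall x, 0 < x -> f x ^ 2 / nu + s * g x ^ 2 = n0) -> Rabs s <= 1 ->
  (forall x, 0 < x -> 0 <= g x <= c / x ^ 1) -> (forall x, 0 <= f x) ->
  is_lim_seq (fun n => f (INR n + 1)) (sqrt (nu * n0)) /\ 0 <= n0.
Proof.
  intros E Hs Hg Hf.
  assert (L2 : is_lim_seq (fun n => f (INR n + 1) ^ 2) (nu * n0)).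
  { apply is_lim_seq_rate with (nu * c ^ 2). intros n.
    set (x := INR n + 1). assert (Hx : 1 <= x) by (unfold x; pose proof (pos_INR n); lra).
    specialize (E x ltac:(lra)). specialize (Hg x ltac:(lra)). rewrite pow_1 in Hg.
    replace (f x ^ 2 - nu * n0) with (- (nu * (s * g x ^ 2))) by (rewrite <- E; field; lra).
    rewrite Rabs_Ropp, !Rabs_mult, (Rabs_right nu), (Rabs_right (g x ^ 2)) by (try lra; apply Rle_ge, pow2_ge_0).
    unfold Rdiv. rewrite Rmult_assoc. apply Rmult_le_compat_l; [lra|].
    apply Rle_trans with (1 * g x ^ 2); [apply Rmult_le_compat_r; [apply pow2_ge_0 | exact Hs]|].
    rewrite Rmult_1_l. apply Rle_trans with ((c / x) ^ 2); [apply pow_incr; lra|].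
    unfold Rdiv. rewrite Rpow_mult_distr. apply Rmult_le_compat_l; [apply pow2_ge_0|].
    rewrite pow_inv. apply Rinv_le_contravar; [lra | nra]. }
  assert (P : 0 <= nu * n0).
  { refine (is_lim_seq_le _ _ (Finite 0) (Finite (nu * n0)) _ (is_lim_seq_const 0) L2).
    intros n; apply pow2_ge_0. }
  split; [|nra].
  apply (is_lim_seq_ext (fun n => sqrt (f (INR n + 1) ^ 2))).
  - intros n. apply sqrt_pow2, Hf.
  - apply (is_lim_seq_continuous sqrt); [apply continuity_pt_sqrt, P | exact L2].
Qed.

(** The amplitudes at infinity are [sqrt (nu N)] and [sqrt (nu N')], and the rotation relates them
    by [p = e^(- nu PI / 4)] and [q = 1 / p]. Squaring gives the ratio [p^4]. *)
Lemma lz_ratio : N' = exp (- (PI * nu)) * N.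
Proof.
  destruct (lz_decay 0) as [c [Hc Hd]].
  destruct (lz_sqr_rate (fun x => Cmod (UV x)) (fun x => Cmod (V 0 x)) N c 1) as [L1 P1].
  { intros x _. rewrite Rmult_1_l. apply lz_conserved. }
  { rewrite Rabs_R1; lra. }
  { intros x Hx; split; [apply Cmod_ge_0 | apply (Hd x Hx)]. }
  { intros x; apply Cmod_ge_0. }
  destruct (lz_sqr_rate (fun x => Cmod (UW x)) (fun x => Cmod (W 0 x)) N' c (-1)) as [L2 P2].
  { intros x _. rewrite <- (lz_conserved' x). ring. }
  { rewrite Rabs_left; lra. }
  { intros x Hx; split; [apply Cmod_ge_0 | apply (Hd x Hx)]. }
  { intros x; apply Cmod_ge_0. }
  destruct lz_amplitude as [c' Ha]. apply is_lim_seq_rate in Ha.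
  set (p := exp (- (nu * (PI / 4)))) in *. set (q := exp (nu * (PI / 4))) in *.
  assert (E : sqrt (nu * N) * p - sqrt (nu * N') * q = 0).
  { assert (L := is_lim_seq_minus' _ _ _ _
      (is_lim_seq_mult' _ _ _ _ L1 (is_lim_seq_const p)) (is_lim_seq_mult' _ _ _ _ L2 (is_lim_seq_const q))).
    apply is_lim_seq_unique in L. apply is_lim_seq_unique in Ha. rewrite Ha in L. injection L. auto. }
  assert (pq : p * q = 1) by (unfold p, q; rewrite <- exp_plus, Rplus_opp_l; apply exp_0).
  assert (p4 : exp (- (PI * nu)) = p ^ 4).
  { unfold p. rewrite <- exp_INR_mult. f_equal. simpl. field. }
  assert (E2 : (sqrt (nu * N) * p) ^ 2 = (sqrt (nu * N') * q) ^ 2) by (f_equal; lra).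
  rewrite !Rpow_mult_distr, !pow2_sqrt in E2 by (apply Rmult_le_pos; lra).
  rewrite p4. apply Rmult_eq_reg_l with nu; [|lra].
  transitivity (nu * N' * q ^ 2 * p ^ 2).
  - replace (nu * N' * q ^ 2 * p ^ 2) with (nu * N' * (p * q) ^ 2) by ring. rewrite pq. ring.
  - rewrite <- E2. ring.
Qed.

(** If [(UV, V 0)] solves the system, so does [(UV (- x), - V 0 (- x))]; the Hermitian form of two
    solutions is conserved, and the sign change makes its value at 0 equal to [N'] instead of
    [N]. *)
Lemma lz_reflection (x : R) :
  Cminus (Cmult (RtoC (/ nu)) (Cmult (Cconj (UV (- x))) (UV x))) (Cmult (Cconj (V 0 (- x))) (V 0 x)) = RtoC N'.
Proof.
  set (f := fun x => Cminus (Cmult (RtoC (/ nu)) (Cmult (Cconj (UV (- x))) (UV x))) (Cmult (Cconj (V 0 (- x))) (V 0 x))).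
  assert (dn : forall t, is_derive (fun x => - x) t (-1)) by (intros; auto_derive; [exact I | ring]).
  transitivity (f 0).
  - apply (is_cderive_constant_value f). intros t. eapply is_cderive_val.
    + apply is_cderive_minus.
      * apply is_cderive_scal, is_cderive_mult; [|apply lz_dUV].
        apply is_cderive_Cconj. apply (is_cderive_comp UV (fun x => - x)); [apply lz_dUV | apply dn].
      * apply is_cderive_mult; [|apply lz_dV0].
        apply is_cderive_Cconj. apply (is_cderive_comp (V 0) (fun x => - x)); [apply lz_dV0 | apply dn].
    + cbv beta. destruct (UV t) as [u1 u2], (V 0 t) as [v1 v2], (UV (- t)) as [s1 s2], (V 0 (- t)) as [t1 t2].
      apply injective_projections; simpl; field; lra.
  - unfold f, N'. rewrite Ropp_0, !Cmod2_components.
    destruct (UV 0) as [u1 u2], (V 0 0) as [v1 v2].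
    apply injective_projections; simpl; field; lra.
Qed.

(** After division by [sqrt N] the reflection identity has the value [q = e^(- PI nu)]. Since [v]
    vanishes at [+oo], [|u (x)|] tends to 1 there and the identity leaves [|u (- x)|] tending to
    [q]. *)
Lemma landau_zener_spinor : exists u v : R -> C,
  (forall x, is_cderive u x (Cmult (Copp (Cmult Ci (RtoC (sqrt nu)))) (v x))) /\
  (forall x, is_cderive v x (Cminus (Cmult (Cmult Ci (RtoC x)) (v x)) (Cmult (Cmult Ci (RtoC (sqrt nu))) (u x)))) /\
  (forall x, Cmod (u x) ^ 2 + Cmod (v x) ^ 2 = 1) /\
  exists c, forall x, 1 <= x ->
    Cmod (v x) <= c / x /\ Rabs (Cmod (u (- x)) ^ 2 - exp (- (2 * PI * nu))) <= c / x.
Proof.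
  pose proof lz_N_pos as HN. pose proof nu_pos as Hnu.
  set (sn := sqrt nu). assert (Hsn : 0 < sn) by (apply sqrt_lt_R0, Hnu).
  assert (Esn : sn * sn = nu) by (apply sqrt_sqrt; lra).
  set (r := sqrt N). assert (Hr : 0 < r) by (apply sqrt_lt_R0, HN).
  assert (Er : r * r = N) by (apply sqrt_sqrt; lra).
  set (u := fun x => Cmult (RtoC (/ (sn * r))) (UV x)).
  set (v := fun x => Cmult (RtoC (/ r)) (V 0 x)).
  set (q := exp (- (PI * nu))).
  assert (Hq : 0 < q <= 1).
  { split; [apply exp_pos|]. unfold q. rewrite <- exp_0. left; apply exp_increasing.
    pose proof PI_RGT_0. nra. }
  assert (Nrm : forall x, Cmod (u x) ^ 2 + Cmod (v x) ^ 2 = 1).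
  { intros x. unfold u, v. rewrite !Cmod_mult, !Cmod_R, !Rpow_mult_distr, !pow2_abs.
    assert (E := lz_conserved x).
    transitivity ((Cmod (UV x) ^ 2 / nu + Cmod (V 0 x) ^ 2) / N); [|rewrite E; field; lra].
    rewrite <- Esn, <- Er. field. lra. }
  assert (Rfl : forall x, Cminus (Cmult (Cconj (u (- x))) (u x)) (Cmult (Cconj (v (- x))) (v x)) = RtoC q).
  { intros x. assert (E := lz_reflection x). rewrite lz_ratio in E. fold q in E.
    apply (f_equal (Cmult (RtoC (/ N)))) in E.
    replace (Cmult (RtoC (/ N)) (RtoC (q * N))) with (RtoC q) in E
      by (rewrite <- RtoC_mult; f_equal; field; lra).
    rewrite <- E. unfold u, v. rewrite <- Esn, <- Er.
    destruct (UV x) as [u1 u2], (V 0 x) as [v1 v2], (UV (- x)) as [s1 s2], (V 0 (- x)) as [t1 t2].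
    apply injective_projections; simpl; field; lra. }
  exists u, v. split; [|split; [|split; [exact Nrm|]]].
  - intros x. eapply is_cderive_val; [exact (is_cderive_scal (RtoC (/ (sn * r))) _ _ _ (lz_dUV x))|].
    unfold v. fold sn. rewrite <- Esn. destruct (V 0 x) as [v1 v2].
    apply injective_projections; simpl; field; lra.
  - intros x. eapply is_cderive_val; [exact (is_cderive_scal (RtoC (/ r)) _ _ _ (lz_dV0 x))|].
    unfold v, u. fold sn. destruct (V 0 x) as [v1 v2], (UV x) as [u1 u2].
    apply injective_projections; simpl; field; lra.
  - destruct (lz_decay 0) as [c [Hc Hd]].
    exists (3 * (c / r)). intros x Hx.
    assert (Hv : Cmod (v x) <= c / r / x).
    { unfold v. rewrite Cmod_mult, Cmod_R, Rabs_right by (left; now apply Rinv_0_lt_compat).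
      destruct (Hd x ltac:(lra)) as [D _]. rewrite pow_1 in D.
      replace (c / r / x) with (/ r * (c / x)) by (field; lra).
      apply Rmult_le_compat_l; [left; now apply Rinv_0_lt_compat | exact D]. }
    assert (Hcr : 0 <= c / r / x).
    { pose proof (Cmod_ge_0 (v x)). lra. }
    replace (3 * (c / r) / x) with (3 * (c / r / x)) by (field; lra).
    split; [lra|].
    assert (Hpm : exp (- (2 * PI * nu)) = q * q) by (unfold q; rewrite <- exp_plus; f_equal; ring).
    rewrite Hpm.
    assert (N1 := Nrm x). assert (N2 := Nrm (- x)).
    pose proof (Cmod_ge_0 (u x)) as g1. pose proof (Cmod_ge_0 (v x)) as g2.
    pose proof (Cmod_ge_0 (u (- x))) as g3. pose proof (Cmod_ge_0 (v (- x))) as g4.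
    set (d := Cmod (v x)) in *.
    assert (b1 : Cmod (u x) <= 1) by nra. assert (b2 : d <= 1) by nra.
    assert (b3 : Cmod (u (- x)) <= 1) by nra. assert (b4 : Cmod (v (- x)) <= 1) by nra.
    assert (R1 : Rabs (Cmod (u (- x)) * Cmod (u x) - q) <= d).
    { replace (Cmod (u (- x)) * Cmod (u x)) with (Cmod (Cmult (Cconj (u (- x))) (u x)))
        by (rewrite Cmod_mult, Cmod_conj; ring).
      replace q with (Cmod (RtoC q)) at 1 by (rewrite Cmod_R, Rabs_right; lra).
      eapply Rle_trans; [apply Cmod_triangle_inv|].
      rewrite <- (Rfl x).
      match goal with |- Cmod ?z <= _ => replace z with (Cmult (Cconj (v (- x))) (v x)) by ring end.
      rewrite Cmod_mult, Cmod_conj. fold d. nra. }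
    apply Rabs_le_between in R1. apply Rabs_le.
    (* Passing from [|u (- x)|^2] to [m^2] costs at most [d], and from [m^2] to [q^2] at most [2 d]:
       hence the factor 3 in the witness. *)
    set (m := Cmod (u (- x)) * Cmod (u x)) in *.
    assert (m0 : 0 <= m <= 1) by (unfold m; split; nra).
    assert (Em : m ^ 2 = Cmod (u (- x)) ^ 2 * (1 - d ^ 2)).
    { unfold m. rewrite Rpow_mult_distr. f_equal. lra. }
    assert (K1 : 0 <= Cmod (u (- x)) ^ 2 - m ^ 2 <= d).
    { rewrite Em. pose proof (pow2_ge_0 (Cmod (u (- x)))). pose proof (pow2_ge_0 d).
      assert (Cmod (u (- x)) ^ 2 <= 1) by nra. assert (d ^ 2 <= d) by nra. nra. }
    assert (K2 : - (2 * d) <= m ^ 2 - q * q <= 2 * d).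
    { replace (m ^ 2 - q * q) with ((m - q) * (m + q)) by ring. split; nra. }
    lra.
Qed.

End LandauZener.

(** * Growth estimates *)

(** A propagator is differentiable only after its starting time and merely right-continuous there,
    so every estimate starting from the initial state has to accept this form of continuity at the
    left end. *)
Definition rcont (f : R -> R) (a : R) : Prop :=
  filterlim f (at_right a) (locally (f a)).

Lemma rcont_continuous (f : R -> R) (a : R) : continuous f a -> rcont f a.
Proof.
  intros H P HP. apply H in HP. unfold filtermap in *.
  unfold at_right, within. revert HP. apply filter_imp. auto.
Qed.

Lemma rcont_derive (f : R -> R) (a l : R) : is_derive f a l -> rcont f a.
Proof.
  intros H. apply rcont_continuous, (ex_derive_continuous (K := R_AbsRing) (V := R_NormedModule)).
  exists l. exact H.
Qed.

Lemma rcont_plus (f h : R -> R) (a : R) : rcont f a -> rcont h a -> rcont (fun s => f s + h s) a.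
Proof.
  intros Hf Hh. refine (filterlim_comp_2 _ _ Rplus Hf Hh _).
  exact (filterlim_plus (V := R_NormedModule) (f a) (h a)).
Qed.

Lemma rcont_mult (f h : R -> R) (a : R) : rcont f a -> rcont h a -> rcont (fun s => f s * h s) a.
Proof.
  intros Hf Hh. refine (filterlim_comp_2 _ _ Rmult Hf Hh _).
  exact (filterlim_mult (K := R_AbsRing) (f a) (h a)).
Qed.

Lemma rcont_const (c a : R) : rcont (fun _ => c) a.
Proof. apply filterlim_const. Qed.

Lemma rcont_opp (f : R -> R) (a : R) : rcont f a -> rcont (fun s => - f s) a.
Proof. intros Hf. apply (filterlim_comp _ _ _ f Ropp _ _ _ Hf). apply (filterlim_opp (V := R_NormedModule)). Qed.

Lemma rcont_comp (f h : R -> R) (a : R) : rcont f a -> continuous h (f a) -> rcont (fun s => h (f s)) a.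
Proof. intros Hf Hh. apply (filterlim_comp _ _ _ f h _ _ _ Hf Hh). Qed.

Lemma rcont_ext (f h : R -> R) (a : R) : (forall s, f s = h s) -> rcont f a -> rcont h a.
Proof. intros E Hf. unfold rcont. rewrite <- E. eapply filterlim_ext; [|exact Hf]. auto. Qed.

Lemma nonincreasing_rcont (f df : R -> R) (a b : R) : a <= b -> rcont f a ->
  (forall s, a < s <= b -> is_derive f s (df s)) ->
  (forall s, a < s <= b -> df s <= 0) -> f b <= f a.
Proof.
  intros Hab Hc Hd Hn.
  destruct (Req_dec a b) as [->|N]; [lra|].
  apply Rnot_lt_le. intros Hlt.
  assert (Hm : 0 < (f b - f a) / 2) by lra.
  assert (L : locally (f a) (fun y => Rabs (y - f a) < (f b - f a) / 2)).
  { exists (mkposreal _ Hm). intros y Hy. exact Hy. }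
  apply Hc in L. destruct L as [d Hd'].
  set (m := Rmin (a + d / 2) b).
  assert (Hdp := cond_pos d).
  assert (Hma : a < m <= b) by (unfold m, Rmin; destruct Rle_dec; lra).
  assert (Hmd : m <= a + d / 2) by apply Rmin_l.
  assert (Hfm : Rabs (f m - f a) < (f b - f a) / 2).
  { apply Hd'; [|lra]. change (Rabs (m - a) < d). rewrite Rabs_right; lra. }
  apply Rabs_def2 in Hfm.
  destruct (MVT_point f df m b) as [c [Hcc E]].
  - intros t. rewrite Rmin_left, Rmax_right by lra. intros Ht; apply Hd; lra.
  - rewrite Rmin_left, Rmax_right in Hcc by lra.
    specialize (Hn c ltac:(lra)). nra.
Qed.

Lemma Re_conj_le (z w : C) : fst z * fst w + snd z * snd w <= Cmod z * Cmod w.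
Proof.
  apply Rle_trans with (Cmod (Cmult (Cconj z) w)).
  - eapply Rle_trans; [|apply abs_fst_le_Cmod]. eapply Rle_trans; [|apply Rle_abs]. right. simpl. ring.
  - rewrite Cmod_mult, Cmod_conj. lra.
Qed.

(** Only the real inner product of [h] with its derivative is bounded, so a rotating part of any
    speed costs nothing and a damping part may be discarded. *)
Lemma norm_growth (h dh : R -> C) (G dG : R -> R) (a b : R) : a <= b ->
  rcont (fun s => fst (h s)) a -> rcont (fun s => snd (h s)) a ->
  (forall s, a < s <= b -> is_cderive h s (dh s)) ->
  (forall s, is_derive G s (dG s)) ->
  (forall s, a < s <= b -> 0 <= dG s) ->
  (forall s, a < s <= b -> fst (h s) * fst (dh s) + snd (h s) * snd (dh s) <= Cmod (h s) * dG s) ->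
  Cmod (h b) <= Cmod (h a) + (G b - G a).
Proof.
  intros Hab c1 c2 Hh HG HdG Hb.
  apply le_epsilon. intros d Hd.
  (* The modulus is not differentiable at zeros of [h]; [sqrt (|h|^2 + d^2)] is, and [d] is
     arbitrary. *)
  set (q := fun s => Cmod (h s) ^ 2 + d ^ 2).
  assert (Hq : forall s, 0 < q s) by (intros s; unfold q; pose proof (pow2_ge_0 (Cmod (h s))); nra).
  assert (K : sqrt (q b) - G b <= sqrt (q a) - G a).
  { apply (nonincreasing_rcont (fun s => sqrt (q s) - G s)
      (fun s => 2 * (fst (h s) * fst (dh s) + snd (h s) * snd (dh s)) * / (2 * sqrt (q s)) - dG s) a b Hab).
    - apply (rcont_plus (fun s => sqrt (q s)) (fun s => - G s)).
      + apply (rcont_comp q sqrt); [|apply continuous_sqrt].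
        apply (rcont_ext (fun s => (fst (h s) * fst (h s) + snd (h s) * snd (h s)) + d ^ 2)).
        * intros s. unfold q. rewrite Cmod2_components. ring.
        * apply (rcont_plus (fun s => fst (h s) * fst (h s) + snd (h s) * snd (h s))); [|apply rcont_const].
          apply rcont_plus; apply rcont_mult; assumption.
      + apply rcont_opp. eapply rcont_derive, HG.
    - intros s Hs. apply is_derive_Rminus; [|apply HG].
      apply (is_derive_Rcomp sqrt q).
      + apply is_derive_Reals, derivable_pt_lim_sqrt, Hq.
      + unfold q. eapply is_derive_val.
        * apply is_derive_Rplus; [apply is_derive_Cmod2, Hh, Hs | apply is_derive_Rconst].
        * ring.
    - intros s Hs. specialize (Hb s Hs). specialize (HdG s Hs).
      assert (Hsq : Cmod (h s) <= sqrt (q s)).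
      { rewrite <- (sqrt_pow2 (Cmod (h s))) by apply Cmod_ge_0. apply sqrt_le_1_alt. unfold q. nra. }
      assert (Hp : 0 < sqrt (q s)) by (apply sqrt_lt_R0, Hq).
      assert (Hfr : (fst (h s) * fst (dh s) + snd (h s) * snd (dh s)) * / sqrt (q s) <= dG s).
      { apply Rmult_le_reg_r with (sqrt (q s)); [exact Hp|].
        rewrite Rmult_assoc, Rinv_l, Rmult_1_r by lra.
        eapply Rle_trans; [exact Hb|]. rewrite Rmult_comm. apply Rmult_le_compat_l; lra. }
      replace (2 * (fst (h s) * fst (dh s) + snd (h s) * snd (dh s)) * / (2 * sqrt (q s)))
        with ((fst (h s) * fst (dh s) + snd (h s) * snd (dh s)) * / sqrt (q s)) by (field; lra).
      lra. }
  assert (K1 : Cmod (h b) <= sqrt (q b)).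
  { rewrite <- (sqrt_pow2 (Cmod (h b))) by apply Cmod_ge_0. apply sqrt_le_1_alt. unfold q. nra. }
  assert (K2 : sqrt (q a) <= Cmod (h a) + d).
  { rewrite <- (sqrt_pow2 (Cmod (h a) + d)) by (pose proof (Cmod_ge_0 (h a)); lra).
    apply sqrt_le_1_alt. unfold q. pose proof (Cmod_ge_0 (h a)). nra. }
  lra.
Qed.

(** * The slow manifold of the dephasing flow *)

Definition om (g s : R) : R := sqrt (s ^ 2 + g ^ 2).
Definition th (g s : R) : R := - g / om g s ^ 2.
(** An explicit increasing majorant, up to a constant, of the primitive of [om^-4] that vanishes at
    [-oo]: of order [|s|^-3] on the left, bounded by [g^-3] on the right. *)
Definition kw (g s : R) : R := / (om g s - s + g) ^ 3.
(** The reciprocal of [i - y]. *)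
Definition chi (y : R) : C := (- y / (1 + y ^ 2), - (1) / (1 + y ^ 2)).

Section Omega.

Variable g : R.
Hypothesis g_pos : 0 < g.

Lemma om_sqr (s : R) : om g s ^ 2 = s ^ 2 + g ^ 2.
Proof. unfold om. apply pow2_sqrt. nra. Qed.

Lemma om_ge_g (s : R) : g <= om g s.
Proof.
  rewrite <- (sqrt_pow2 g) at 1 by lra. apply sqrt_le_1_alt. nra.
Qed.

Lemma om_pos (s : R) : 0 < om g s.
Proof. pose proof (om_ge_g s); lra. Qed.

Lemma om_ge_abs (s : R) : Rabs s <= om g s.
Proof.
  rewrite <- (sqrt_pow2 (Rabs s)) by apply Rabs_pos. apply sqrt_le_1_alt. rewrite pow2_abs. nra.
Qed.

Lemma om_even (s : R) : om g (- s) = om g s.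
Proof. unfold om. f_equal. ring. Qed.

Lemma om_le (s : R) : om g s <= Rabs s + g.
Proof.
  rewrite <- (sqrt_pow2 (Rabs s + g)) by (pose proof (Rabs_pos s); lra).
  apply sqrt_le_1_alt. rewrite <- (pow2_abs s). pose proof (Rabs_pos s). nra.
Qed.

Lemma is_derive_om (s : R) : is_derive (om g) s (s / om g s).
Proof.
  eapply is_derive_val.
  - apply (is_derive_Rcomp sqrt (fun s => s ^ 2 + g ^ 2)).
    + apply is_derive_Reals, derivable_pt_lim_sqrt. nra.
    + instantiate (1 := 2 * s). auto_derive; [exact I | ring].
  - fold (om g s). field. pose proof (om_pos s). lra.
Qed.

Lemma is_derive_inv_om_pow (n : nat) (s : R) :
  is_derive (fun s => / om g s ^ n) s (- INR n * s / om g s ^ (n + 2)).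
Proof.
  pose proof (om_pos s) as Hp. pose proof (pow_lt _ n Hp) as Hn.
  induction n as [|n IH].
  - apply (is_derive_Rext (fun _ => 1)); [intros t; simpl; now rewrite Rinv_1|].
    eapply is_derive_val; [apply is_derive_Rconst|]. simpl. field. lra.
  - specialize (IH (pow_lt _ n Hp)).
    assert (D1 : is_derive (fun s => / om g s) s (- (s / om g s) / om g s ^ 2)).
    { apply (is_derive_inv (om g) s); [apply is_derive_om | lra]. }
    apply (is_derive_Rext (fun s => / om g s * / om g s ^ n)).
    { intros t. simpl. rewrite Rinv_mult. reflexivity. }
    eapply is_derive_val; [apply is_derive_Rmult; [exact D1 | exact IH]|].
    rewrite S_INR, !pow_add. simpl. field. pose proof (pow_lt _ n Hp). split; lra.
Qed.

Lemma om_sub_pos (s : R) : 0 < om g s - s.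
Proof.
  pose proof (om_sqr s). pose proof (om_pos s).
  destruct (Rle_dec s 0); [lra|]. nra.
Qed.

Lemma om_bounds (s : R) : - om g s <= s <= om g s.
Proof. apply Rabs_le_between, om_ge_abs. Qed.

Lemma is_derive_kw (s : R) :
  is_derive (kw g) s (3 * (1 - s / om g s) / (om g s - s + g) ^ 4).
Proof.
  pose proof (om_sub_pos s). pose proof (om_pos s).
  set (w := om g s - s + g). assert (0 < w) by (unfold w; lra).
  assert (D : is_derive (fun s => om g s - s + g) s (s / om g s - 1 + 0)).
  { apply is_derive_Rplus; [apply is_derive_Rminus; [apply is_derive_om | exact (is_derive_id s)] | apply is_derive_Rconst]. }
  assert (D3 := is_derive_pow _ 3 s _ D).
  unfold kw. eapply is_derive_val.
  - apply (is_derive_inv (fun s => (om g s - s + g) ^ 3) s); [exact D3 | apply pow_nonzero; fold w; lra].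
  - cbv beta. fold w. simpl. field. split; lra.
Qed.

(** For [s <= 0] both [om - s] and [om - s + g] are comparable to [om]. For [s > 0] the sum
    [om - s + g] is at most [2 g], and [om - s = g^2 / (om + s)] is at least [g^2 / (2 om)]. *)
Lemma kw_deriv_ge (s : R) :
  / om g s ^ 4 <= 27 * (3 * (1 - s / om g s) / (om g s - s + g) ^ 4).
Proof.
  pose proof (om_pos s) as Hp. pose proof (om_sqr s) as Hq. pose proof (om_ge_g s) as Hg.
  pose proof (om_bounds s) as Hb. pose proof (om_sub_pos s) as Hs. set (o := om g s) in *.
  assert (Hw : 0 < o - s + g) by lra.
  replace (1 - s / o) with ((o - s) / o) by (field; lra).
  assert (P4 : 0 < (o - s + g) ^ 4) by now apply pow_lt.
  assert (O4 : 0 < o ^ 4) by now apply pow_lt.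
  apply Rmult_le_reg_r with (o ^ 4 * (o - s + g) ^ 4); [now apply Rmult_lt_0_compat|].
  replace (/ o ^ 4 * (o ^ 4 * (o - s + g) ^ 4)) with ((o - s + g) ^ 4) by (field; lra).
  replace (27 * (3 * ((o - s) / o) / (o - s + g) ^ 4) * (o ^ 4 * (o - s + g) ^ 4))
    with (81 * (o - s) * o ^ 3) by (field; lra).
  destruct (Rle_dec s 0) as [h|h].
  - assert ((o - s + g) ^ 3 <= (3 * o) ^ 3) by (apply pow_incr; lra).
    assert (E : (o - s + g) ^ 4 <= (o - s + g) * (27 * o ^ 3)).
    { replace ((o - s + g) ^ 4) with ((o - s + g) * (o - s + g) ^ 3) by ring.
      apply Rmult_le_compat_l; [lra|]. nra. }
    assert (0 <= (3 * (o - s) - (o - s + g)) * (27 * o ^ 3)).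
    { apply Rmult_le_pos; [lra|]. pose proof (pow_lt o 3 Hp). lra. }
    lra.
  - assert (L : o - s <= g) by nra.
    assert (E : (o - s) * (o + s) = g ^ 2) by nra.
    assert (E1 : g ^ 2 <= (o - s) * (2 * o)) by nra.
    assert ((o - s + g) ^ 4 <= (2 * g) ^ 4) by (apply pow_incr; lra).
    assert (G2 : g ^ 2 <= o ^ 2) by nra.
    assert (F : g ^ 2 * g ^ 2 <= (o - s) * (2 * o) * o ^ 2) by (apply Rmult_le_compat; nra).
    nra.
Qed.

Lemma kw_pos (s : R) : 0 < kw g s.
Proof. apply Rinv_0_lt_compat, pow_lt. pose proof (om_sub_pos s). lra. Qed.

Lemma kw_le_const (s : R) : kw g s <= / g ^ 3.
Proof.
  pose proof (om_sub_pos s). apply Rinv_le_contravar; [now apply pow_lt|]. apply pow_incr; lra.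
Qed.

Lemma kw_le_om (s : R) : s <= 0 -> kw g s <= / om g s ^ 3.
Proof.
  intros Hs. pose proof (om_pos s). apply Rinv_le_contravar; [now apply pow_lt|]. apply pow_incr; lra.
Qed.

Lemma om3_le_kw (s : R) : / om g s ^ 3 <= 27 * kw g s.
Proof.
  pose proof (om_pos s) as Hp. pose proof (om_sub_pos s). pose proof (om_ge_g s). pose proof (om_bounds s).
  assert (P : 0 < (om g s - s + g) ^ 3) by (apply pow_lt; lra).
  assert ((om g s - s + g) ^ 3 <= (3 * om g s) ^ 3) by (apply pow_incr; lra).
  pose proof (pow_lt _ 3 Hp).
  apply Rmult_le_reg_r with (om g s ^ 3 * (om g s - s + g) ^ 3); [now apply Rmult_lt_0_compat|].
  unfold kw. replace (/ om g s ^ 3 * (om g s ^ 3 * (om g s - s + g) ^ 3)) with ((om g s - s + g) ^ 3) by (field; lra).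
  replace (27 * / (om g s - s + g) ^ 3 * (om g s ^ 3 * (om g s - s + g) ^ 3)) with (27 * om g s ^ 3) by (field; lra).
  nra.
Qed.

Lemma inv_om_pow_le (n : nat) (s : R) : / om g s ^ S n <= / g * / om g s ^ n.
Proof.
  pose proof (om_pos s) as Hp. pose proof (om_ge_g s). simpl. rewrite Rinv_mult.
  apply Rmult_le_compat_r; [left; now apply Rinv_0_lt_compat, pow_lt|].
  apply Rinv_le_contravar; lra.
Qed.

Lemma is_derive_atan_scaled (s : R) : is_derive (fun s => atan (s / g)) s (g / om g s ^ 2).
Proof.
  eapply is_derive_val.
  - apply (is_derive_Rcomp atan (fun s => s / g)).
    + apply is_derive_Reals, derivable_pt_lim_atan.
    + instantiate (1 := / g). auto_derive; [exact I | field; lra].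
  - rewrite om_sqr. unfold Rsqr. field. split; nra.
Qed.

End Omega.

Lemma chi_inv (y : R) : Cmult (Cminus Ci (RtoC y)) (chi y) = RtoC 1.
Proof.
  unfold chi. pose proof (one_plus_sqr_pos y). apply injective_projections; simpl; field; nra.
Qed.

Lemma Cmod_chi_le (y : R) : Cmod (chi y) <= 1.
Proof.
  apply Rle_trans with (sqrt 1); [|rewrite sqrt_1; lra].
  unfold Cmod, chi. apply sqrt_le_1_alt. cbn [fst snd].
  pose proof (one_plus_sqr_pos y).
  replace ((- y / (1 + y ^ 2)) ^ 2 + (- (1) / (1 + y ^ 2)) ^ 2) with (/ (1 + y ^ 2)) by (field; lra).
  replace 1 with (/ 1) at 2 by field. apply Rinv_le_contravar; nra.
Qed.

Lemma is_cderive_chi (f : R -> R) (s df : R) : is_derive f s df ->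
  is_cderive (fun t => chi (f t)) s (Cmult (RtoC df) (Cmult (chi (f s)) (chi (f s)))).
Proof.
  intros H. pose proof (one_plus_sqr_pos (f s)) as Hp. split; unfold chi; cbn [fst snd].
  - eapply is_derive_val.
    + apply (is_derive_Rcomp (fun y => - y / (1 + y ^ 2)) f s ((f s ^ 2 - 1) / (1 + f s ^ 2) ^ 2)); [|exact H].
      auto_derive; [nra | field; nra].
    + simpl. field. nra.
  - eapply is_derive_val.
    + apply (is_derive_Rcomp (fun y => - (1) / (1 + y ^ 2)) f s (2 * f s / (1 + f s ^ 2) ^ 2)); [|exact H].
      auto_derive; [nra | field; nra].
    + simpl. field. nra.
Qed.

(** First coefficient of the adiabatic expansion, [th / (om (i - gam))]: the value of [z / (eps a)]
    at which the right-hand side of the equation for [z] vanishes. *)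
Definition kap (g : R) (gam : R -> R) (s : R) : C :=
  Cmult (RtoC (- g * / om g s ^ 3)) (chi (gam s)).

Definition dephasing_flow (g : R) (gam : R -> R) (eps : R) (a : R -> R) (z : R -> C) (s : R) : Prop :=
  is_derive a s (th g s * fst (z s)) /\
  is_cderive z s (Cminus (Cmult (RtoC (om g s / eps)) (Cmult (Cminus Ci (RtoC (gam s))) (z s)))
                         (RtoC (a s * th g s))).

Lemma th_bound (g s : R) : 0 < g -> Rabs (th g s) <= g * / om g s ^ 2.
Proof.
  intros Hg. pose proof (om_pos g Hg s). unfold th, Rdiv.
  assert (0 < / om g s ^ 2) by now apply Rinv_0_lt_compat, pow_lt.
  rewrite Rabs_mult, Rabs_Ropp, !Rabs_right; nra.
Qed.

(** The derivative of [a] is at most [Z |th|], and [|th| = g / om^2] is the derivative of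
    [atan (s / g)]. *)
Lemma flow_a_growth (g : R) (gam : R -> R) (eps s0 s Z : R) (a : R -> R) (z : R -> C) : 0 < g ->
  (forall u, s0 < u -> dephasing_flow g gam eps a z u) -> rcont a s0 ->
  (forall u, s0 <= u -> Cmod (z u) <= Z) -> s0 <= s ->
  Rabs (a s - a s0) <= Z * (atan (s / g) - atan (s0 / g)).
Proof.
  intros Hg Fl Ra HZ Hs.
  assert (HZ0 : 0 <= Z) by (pose proof (HZ s Hs); pose proof (Cmod_ge_0 (z s)); lra).
  assert (G : Cmod (RtoC (a s - a s0)) <= Cmod (RtoC (a s0 - a s0)) + (Z * atan (s / g) - Z * atan (s0 / g))).
  { apply (norm_growth (fun s => RtoC (a s - a s0)) (fun s => RtoC (th g s * fst (z s)))
      (fun s => Z * atan (s / g)) (fun s => Z * (g / om g s ^ 2)) s0 s Hs).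
    - apply (rcont_plus a (fun _ => - a s0)); [exact Ra | apply rcont_const].
    - apply rcont_const.
    - intros u Hu. apply is_cderive_RtoC. eapply is_derive_val.
      + exact (is_derive_Rminus _ _ _ _ _ (proj1 (Fl u (proj1 Hu))) (is_derive_Rconst (a s0) u)).
      + ring.
    - intros u. eapply is_derive_val; [apply is_derive_Rmult; [apply is_derive_Rconst | apply is_derive_atan_scaled, Hg]|].
      cbv beta. ring.
    - intros u Hu. apply Rmult_le_pos; [exact HZ0|]. left. apply Rdiv_lt_0_compat; [exact Hg | apply pow_lt, om_pos, Hg].
    - intros u Hu. eapply Rle_trans; [apply Re_conj_le|]. apply Rmult_le_compat_l; [apply Cmod_ge_0|].
      rewrite Cmod_R, Rabs_mult, Rmult_comm.
      pose proof (th_bound g u Hg). pose proof (abs_fst_le_Cmod (z u)). pose proof (HZ u ltac:(lra)).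
      pose proof (Rabs_pos (th g u)). pose proof (Rabs_pos (fst (z u))). unfold Rdiv.
      apply Rmult_le_compat; lra. }
  rewrite Rminus_diag, Cmod_0, Cmod_R in G. lra.
Qed.

(** * Two-step adiabatic expansion and its remainder *)

Section SlowManifold.

Variables (g M : R) (gam gam1 gam2 : R -> R).
Hypothesis g_pos : 0 < g.
Hypothesis gam_nonneg : forall s, 0 <= gam s.
Hypothesis gam1_bound : forall s, Rabs (gam1 s) <= M.
Hypothesis gam2_bound : forall s, Rabs (gam2 s) <= M.
Hypothesis d_gam : forall s, is_derive gam s (gam1 s).
Hypothesis d_gam1 : forall s, is_derive gam1 s (gam2 s).

Let X s := chi (gam s).
Let dkap s : C :=
  Cplus (Cmult (RtoC (3 * g * s * / om g s ^ 5)) (X s))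
        (Cmult (RtoC (- g * / om g s ^ 3 * gam1 s)) (Cmult (X s) (X s))).
(** Second coefficient of the expansion, the derivative of [kap] divided by [om (i - gam)]. Since
    the derivative of [X = 1 / (i - gam)] is [gam1 X^2], everything stays polynomial in [X], whose
    modulus is at most 1. *)
Let mu s : C :=
  Cplus (Cmult (RtoC (3 * g * s * / om g s ^ 6)) (Cmult (X s) (X s)))
        (Cmult (RtoC (- g * / om g s ^ 4 * gam1 s)) (Cmult (X s) (Cmult (X s) (X s)))).
Let dmu s : C :=
  Cplus (Cmult (RtoC (3 * g * / om g s ^ 6 - 18 * g * s ^ 2 * / om g s ^ 8)) (Cmult (X s) (X s)))
   (Cplus (Cmult (RtoC (10 * g * s * / om g s ^ 6 * gam1 s - g * / om g s ^ 4 * gam2 s)) (Cmult (X s) (Cmult (X s) (X s))))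
          (Cmult (RtoC (- 3 * g * / om g s ^ 4 * gam1 s ^ 2)) (Cmult (Cmult (X s) (X s)) (Cmult (X s) (X s))))).

Lemma slow_dX (s : R) : is_cderive X s (Cmult (RtoC (gam1 s)) (Cmult (X s) (X s))).
Proof. apply is_cderive_chi, d_gam. Qed.

Lemma slow_dkap (s : R) : is_cderive (kap g gam) s (dkap s).
Proof.
  pose proof (om_pos g g_pos s) as Hp. eapply is_cderive_val.
  - apply is_cderive_mult; [|apply slow_dX].
    apply is_cderive_RtoC. apply is_derive_Rmult; [apply is_derive_Rconst | apply is_derive_inv_om_pow, g_pos].
  - unfold dkap. fold (X s). destruct (X s) as [x1 x2].
    apply injective_projections; simpl; field; lra.
Qed.

Lemma slow_dmu (s : R) : is_cderive mu s (dmu s).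
Proof.
  pose proof (om_pos g g_pos s) as Hp. eapply is_cderive_val.
  - apply is_cderive_plus; apply is_cderive_mult.
    + apply is_cderive_RtoC. apply is_derive_Rmult; [apply (is_derive_Rlin (3 * g)) | apply is_derive_inv_om_pow, g_pos].
    + apply is_cderive_mult; apply slow_dX.
    + apply is_cderive_RtoC. apply is_derive_Rmult; [|apply d_gam1].
      apply is_derive_Rmult; [apply is_derive_Rconst | apply is_derive_inv_om_pow, g_pos].
    + apply is_cderive_mult; [|apply is_cderive_mult]; apply slow_dX.
  - unfold dmu. cbv beta. destruct (X s) as [x1 x2].
    apply injective_projections; simpl; field; lra.
Qed.

Lemma slow_kap_eq (s : R) :
  Cmult (Cmult (RtoC (om g s)) (Cminus Ci (RtoC (gam s)))) (kap g gam s) = RtoC (th g s).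
Proof.
  pose proof (om_pos g g_pos s) as Hp. unfold kap.
  transitivity (Cmult (RtoC (om g s * (- g * / om g s ^ 3))) (Cmult (Cminus Ci (RtoC (gam s))) (chi (gam s)))).
  - rewrite (RtoC_mult (om g s) (- g * / om g s ^ 3)). ring.
  - rewrite chi_inv, <- RtoC_mult. f_equal. unfold th. field. lra.
Qed.

Lemma slow_mu_eq (s : R) :
  Cmult (Cmult (RtoC (om g s)) (Cminus Ci (RtoC (gam s)))) (mu s) = dkap s.
Proof.
  pose proof (om_pos g g_pos s) as Hp. unfold mu, dkap.
  transitivity (Cmult (Cmult (Cminus Ci (RtoC (gam s))) (X s))
    (Cplus (Cmult (RtoC (om g s * (3 * g * s * / om g s ^ 6))) (X s))
           (Cmult (RtoC (om g s * (- g * / om g s ^ 4 * gam1 s))) (Cmult (X s) (X s))))).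
  - rewrite (RtoC_mult (om g s) (3 * g * s * / om g s ^ 6)), (RtoC_mult (om g s) (- g * / om g s ^ 4 * gam1 s)). ring.
  - unfold X at 1. rewrite chi_inv.
    replace (om g s * (3 * g * s * / om g s ^ 6)) with (3 * g * s * / om g s ^ 5) by (field; lra).
    replace (om g s * (- g * / om g s ^ 4 * gam1 s)) with (- g * / om g s ^ 3 * gam1 s) by (field; lra).
    ring.
Qed.

Lemma Cmod_scal_le (c : R) (w : C) (B : R) : Cmod w <= 1 -> Rabs c <= B -> Cmod (Cmult (RtoC c) w) <= B.
Proof.
  intros Hw Hc. rewrite Cmod_mult, Cmod_R.
  pose proof (Rabs_pos c). pose proof (Cmod_ge_0 w). nra.
Qed.

Lemma Cmod_mult_le1 (w w' : C) : Cmod w <= 1 -> Cmod w' <= 1 -> Cmod (Cmult w w') <= 1.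
Proof.
  intros H H'. rewrite Cmod_mult. pose proof (Cmod_ge_0 w). pose proof (Cmod_ge_0 w'). nra.
Qed.

(** Bounds of [mu] and of its derivative relative to [om^-4]. In [Cd] the summand [21 / g] comes
    from [|3 - 18 (s / om)^2| <= 21], the others from the terms with [gam1], [gam2] and [gam1^2].
    [K] adds what the source terms containing the derivative of [a] contribute. *)
Let Cm := 3 + g * M.
Let Cd := 21 / g + 10 * M + g * M + 3 * g * M ^ 2.
Let K := Cd + g + Cm / g.

Lemma slow_M_nonneg : 0 <= M.
Proof. pose proof (gam1_bound 0). pose proof (Rabs_pos (gam1 0)). lra. Qed.

Lemma slow_scalars (s : R) : exists t j, / om g s = j /\ s = t * / j /\ 0 < j /\ g * j <= 1 /\ -1 <= t <= 1.
Proof.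
  pose proof (om_pos g g_pos s) as Hp. pose proof (om_ge_g g g_pos s). pose proof (om_bounds g s).
  assert (Hj : 0 < / om g s) by now apply Rinv_0_lt_compat.
  exists (s * / om g s), (/ om g s). repeat split; auto.
  - field. lra.
  - apply Rmult_le_reg_r with (om g s); [exact Hp|]. rewrite Rmult_assoc, Rinv_l; lra.
  - apply Rmult_le_reg_r with (om g s); [exact Hp|]. rewrite Rmult_assoc, Rinv_l; lra.
  - apply Rmult_le_reg_r with (om g s); [exact Hp|]. rewrite Rmult_assoc, Rinv_l; lra.
Qed.

Lemma slow_kap_bound (s : R) : Cmod (kap g gam s) <= g * / om g s ^ 3.
Proof.
  apply Cmod_scal_le; [apply Cmod_chi_le|].
  pose proof (om_pos g g_pos s). assert (0 < / om g s ^ 3) by now apply Rinv_0_lt_compat, pow_lt.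
  rewrite Rabs_left; nra.
Qed.

Lemma slow_mu_bound (s : R) : Cmod (mu s) <= Cm * / om g s ^ 4.
Proof.
  pose proof slow_M_nonneg as HM. assert (HX : Cmod (X s) <= 1) by apply Cmod_chi_le.
  destruct (slow_scalars s) as [t [j [Ej [Es [Hj [Hgj Ht]]]]]].
  unfold mu. eapply Rle_trans; [apply Cmod_triangle|].
  rewrite <- !pow_inv, Ej. pose proof (pow_lt j 4 Hj) as Hj4. unfold Cm. rewrite Rmult_plus_distr_r.
  apply Rplus_le_compat; (apply Cmod_scal_le; [repeat apply Cmod_mult_le1; exact HX|]).
  - replace (3 * g * s * j ^ 6) with (t * (g * j) * (3 * j ^ 4)) by (rewrite Es at 1; field; lra).
    rewrite !Rabs_mult, (Rabs_right g), (Rabs_right j), (Rabs_right 3), (Rabs_right (j ^ 4)) by lra.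
    assert (Rabs t <= 1) by (apply Rabs_le; lra). pose proof (Rabs_pos t).
    assert (Rabs t * (g * j) <= 1) by nra. nra.
  - rewrite !Rabs_mult, (Rabs_left (- g)), (Rabs_right (j ^ 4)) by lra.
    pose proof (gam1_bound s). pose proof (Rabs_pos (gam1 s)).
    replace (g * M * j ^ 4) with (g * j ^ 4 * M) by ring. rewrite Ropp_involutive.
    apply Rmult_le_compat_l; nra.
Qed.

Lemma slow_dmu_bound (s : R) : Cmod (dmu s) <= Cd * / om g s ^ 4.
Proof.
  pose proof slow_M_nonneg as HM. assert (HX : Cmod (X s) <= 1) by apply Cmod_chi_le.
  destruct (slow_scalars s) as [t [j [Ej [Es [Hj [Hgj Ht]]]]]].
  assert (G1 := gam1_bound s). assert (G2 := gam2_bound s). apply Rabs_le_between in G1. apply Rabs_le_between in G2.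
  unfold dmu. eapply Rle_trans; [apply Cmod_triangle|].
  eapply Rle_trans; [apply Rplus_le_compat_l, Cmod_triangle|].
  rewrite <- !pow_inv, Ej. pose proof (pow_lt j 4 Hj) as Hj4.
  replace (Cd * j ^ 4) with (21 / g * j ^ 4 + ((10 * M + g * M) * j ^ 4 + 3 * g * M ^ 2 * j ^ 4)) by (unfold Cd; ring).
  apply Rplus_le_compat; [|apply Rplus_le_compat]; (apply Cmod_scal_le; [repeat apply Cmod_mult_le1; exact HX|]).
  - replace (3 * g * j ^ 6 - 18 * g * s ^ 2 * j ^ 8) with ((3 - 18 * t ^ 2) * (g * j ^ 2) * j ^ 4)
      by (rewrite Es at 1; field; lra).
    rewrite Rabs_mult, (Rabs_right (j ^ 4)) by lra. apply Rmult_le_compat_r; [lra|].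
    assert (Rabs (3 - 18 * t ^ 2) <= 21) by (apply Rabs_le; nra).
    rewrite Rabs_mult, (Rabs_right (g * j ^ 2)) by nra.
    assert (g * j ^ 2 <= / g).
    { apply Rmult_le_reg_l with g; [lra|]. rewrite Rinv_r by lra. assert (0 <= g * j) by nra. replace (g * (g * j ^ 2)) with ((g * j) * (g * j)) by ring. set (q := g * j) in *. nra. }
    assert (0 <= g * j ^ 2) by nra. pose proof (Rabs_pos (3 - 18 * t ^ 2)).
    apply Rmult_le_compat; lra.
  - replace (10 * g * s * j ^ 6 * gam1 s - g * j ^ 4 * gam2 s)
      with ((10 * (t * (g * j)) * gam1 s - g * gam2 s) * j ^ 4) by (generalize (gam1 s) (gam2 s); intros p1 p2; rewrite Es; field; lra).
    rewrite Rabs_mult, (Rabs_right (j ^ 4)) by lra. apply Rmult_le_compat_r; [lra|].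
    set (p := t * (g * j)). assert (-1 <= p <= 1) by (unfold p; assert (0 <= g * j) by nra; nra).
    assert (- M <= p * gam1 s <= M) by nra.
    assert (- (g * M) <= g * gam2 s <= g * M) by nra.
    apply Rabs_le; lra.
  - assert (0 <= gam1 s ^ 2 <= M ^ 2) by nra.
    rewrite Rabs_left1.
    + replace (- (-3 * g * j ^ 4 * gam1 s ^ 2)) with (3 * g * j ^ 4 * gam1 s ^ 2) by ring.
      replace (3 * g * M ^ 2 * j ^ 4) with (3 * g * j ^ 4 * M ^ 2) by ring.
      apply Rmult_le_compat_l; nra.
    + assert (0 <= g * j ^ 4) by nra. nra.
Qed.

Lemma slow_K_pos : 0 <= Cm /\ 0 <= Cd /\ 0 <= Cm / g /\ 0 < K.
Proof.
  pose proof slow_M_nonneg.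
  assert (0 <= Cm) by (unfold Cm; nra).
  assert (0 < / g) by now apply Rinv_0_lt_compat.
  assert (0 <= Cd) by (unfold Cd, Rdiv; assert (0 <= g * M) by nra; assert (0 <= g * M ^ 2) by (pose proof (pow2_ge_0 M); nra); nra).
  assert (0 <= Cm / g) by (unfold Rdiv; nra). unfold K. lra.
Qed.

Section Trajectory.

Variables (eps s0 : R) (a : R -> R) (z : R -> C).
Hypothesis eps_pos : 0 < eps.
Hypothesis flow : forall s, s0 < s -> dephasing_flow g gam eps a z s.
Hypothesis rc_a : rcont a s0.
Hypothesis rc_z1 : rcont (fun s => fst (z s)) s0.
Hypothesis rc_z2 : rcont (fun s => snd (z s)) s0.
Hypothesis a_bound : forall s, s0 <= s -> Rabs (a s) <= 1.
Hypothesis z_bound : forall s, s0 <= s -> Cmod (z s) <= 1.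

(* What remains of [z] after two steps of the adiabatic expansion. *)
Let h s : C := Cminus (Cminus (z s) (Cmult (RtoC (eps * a s)) (kap g gam s)))
                      (Cmult (RtoC (eps ^ 2 * a s)) (mu s)).
Let src s : C :=
  Copp (Cplus (Cmult (RtoC (eps * (th g s * fst (z s)))) (kap g gam s))
        (Cplus (Cmult (RtoC (eps ^ 2 * (th g s * fst (z s)))) (mu s)) (Cmult (RtoC (eps ^ 2 * a s)) (dmu s)))).

(** The equations defining [kap] and [mu] cancel the terms of order 1 and [eps] that carry [a]
    itself. What remains as source comes from the derivative of [a], small because it contains [z],
    and from the derivative of [mu], which has the factor [eps^2]. *)
Lemma slow_dh (s : R) : s0 < s ->
  is_cderive h s (Cplus (Cmult (Cmult (RtoC (om g s / eps)) (Cminus Ci (RtoC (gam s)))) (h s)) (src s)).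
Proof.
  intros Hs. destruct (flow s Hs) as [Da Dz]. eapply is_cderive_val.
  - apply is_cderive_minus; [apply is_cderive_minus; [exact Dz|]|].
    + apply is_cderive_mult; [|apply slow_dkap].
      apply is_cderive_RtoC, is_derive_Rmult; [apply is_derive_Rconst | exact Da].
    + apply is_cderive_mult; [|apply slow_dmu].
      apply is_cderive_RtoC, is_derive_Rmult; [apply is_derive_Rconst | exact Da].
  - cbv beta. unfold h, src. rewrite <- slow_mu_eq.
    rewrite (RtoC_mult (a s) (th g s)), <- slow_kap_eq.
    unfold Rdiv. rewrite (RtoC_mult (om g s)).
    rewrite !RtoC_plus, !(RtoC_mult 0), !(RtoC_mult eps), !(RtoC_mult (eps ^ 2)).
    replace (RtoC (eps ^ 2)) with (Cmult (RtoC eps) (RtoC eps)) by (rewrite <- RtoC_mult; f_equal; ring).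
    assert (E : Cmult (RtoC (/ eps)) (RtoC eps) = RtoC 1) by (rewrite <- RtoC_mult; f_equal; field; lra).
    set (l := RtoC (/ eps)) in *. set (ee := RtoC eps) in *. set (L := Cminus Ci (RtoC (gam s))).
    set (o := RtoC (om g s)). set (a0 := RtoC (a s)). set (a1 := RtoC (th g s * fst (z s))).
    set (k := kap g gam s). set (m := mu s). set (dm := dmu s).
    transitivity (Cminus (Cminus (Cminus (Cmult (Cmult (Cmult o l) L) (z s)) (Cmult (Cmult l ee) (Cmult a0 (Cmult (Cmult o L) k))))
       (Cplus (Cmult (Cmult ee a1) k) (Cmult (Cmult (Cmult l ee) (Cmult ee a0)) (Cmult (Cmult o L) m))))
       (Cplus (Cmult (Cmult (Cmult ee ee) a1) m) (Cmult (Cmult (Cmult ee ee) a0) dm))).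
    + rewrite E. ring.
    + ring.
Qed.

(** The bound [Z] is spent only on the one term of first order in [eps]; elsewhere [|z| <= 1] is
    enough. This is what makes a second pass with a smaller [Z] profitable. *)
Lemma slow_src_bound (s Z : R) : s0 <= s -> Cmod (z s) <= Z ->
  Cmod (src s) <= K * (2 * eps ^ 2 + eps * Z) * / om g s ^ 4.
Proof.
  intros Hs HZ.
  destruct slow_K_pos as [Hcm [Hcd [Hcmg HK]]].
  pose proof (slow_kap_bound s) as Bk. pose proof (slow_mu_bound s) as Bm. pose proof (slow_dmu_bound s) as Bd.
  pose proof (th_bound g s g_pos) as Bt. specialize (a_bound s Hs). specialize (z_bound s Hs).
  destruct (slow_scalars s) as [t [j [Ej [_ [Hj [Hgj _]]]]]].
  rewrite <- !pow_inv, Ej in *. pose proof (pow_lt j 4 Hj) as Hj4.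
  pose proof (abs_fst_le_Cmod (z s)) as Hf. pose proof (Rabs_pos (fst (z s))) as Hf0.
  pose proof (Cmod_ge_0 (kap g gam s)). pose proof (Cmod_ge_0 (mu s)). pose proof (Cmod_ge_0 (dmu s)).
  pose proof (Rabs_pos (th g s)). pose proof (Rabs_pos (a s)).
  assert (T1 : Rabs (th g s) * Cmod (kap g gam s) <= g * j ^ 4).
  { apply Rle_trans with (g * j ^ 2 * (g * j ^ 3)); [apply Rmult_le_compat; assumption|].
    replace (g * j ^ 2 * (g * j ^ 3)) with ((g * j) * (g * j ^ 4)) by ring.
    assert (0 <= g * j ^ 4) by nra. nra. }
  assert (T2 : Rabs (th g s) * Cmod (mu s) <= Cm / g * j ^ 4).
  { apply Rle_trans with (g * j ^ 2 * (Cm * j ^ 4)); [apply Rmult_le_compat; assumption|].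
    replace (g * j ^ 2 * (Cm * j ^ 4)) with ((g * j) ^ 2 * (Cm / g * j ^ 4)) by (field; lra).
    assert (0 <= Cm / g * j ^ 4) by (apply Rmult_le_pos; lra).
    assert (0 <= g * j) by nra. assert ((g * j) ^ 2 <= 1) by nra. nra. }
  assert (P1 : Cmod (Cmult (RtoC (eps * (th g s * fst (z s)))) (kap g gam s)) <= eps * Z * (g * j ^ 4)).
  { rewrite Cmod_mult, Cmod_R, !Rabs_mult, (Rabs_right eps) by lra.
    replace (eps * (Rabs (th g s) * Rabs (fst (z s))) * Cmod (kap g gam s))
      with (eps * Rabs (fst (z s)) * (Rabs (th g s) * Cmod (kap g gam s))) by ring.
    apply Rmult_le_compat; try nra. }
  assert (P2 : Cmod (Cmult (RtoC (eps ^ 2 * (th g s * fst (z s)))) (mu s)) <= eps ^ 2 * (Cm / g * j ^ 4)).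
  { rewrite Cmod_mult, Cmod_R, !Rabs_mult, (Rabs_right (eps ^ 2)) by nra.
    replace (eps ^ 2 * (Rabs (th g s) * Rabs (fst (z s))) * Cmod (mu s))
      with (eps ^ 2 * Rabs (fst (z s)) * (Rabs (th g s) * Cmod (mu s))) by ring.
    apply Rmult_le_compat; try nra. }
  assert (P3 : Cmod (Cmult (RtoC (eps ^ 2 * a s)) (dmu s)) <= eps ^ 2 * (Cd * j ^ 4)).
  { rewrite Cmod_mult, Cmod_R, !Rabs_mult, (Rabs_right (eps ^ 2)) by nra.
    apply Rmult_le_compat; try nra. }
  unfold src. rewrite Cmod_opp.
  eapply Rle_trans; [apply Cmod_triangle|]. eapply Rle_trans; [apply Rplus_le_compat_l, Cmod_triangle|].
  apply Rle_trans with (eps * Z * (g * j ^ 4) + (eps ^ 2 * (Cm / g * j ^ 4) + eps ^ 2 * (Cd * j ^ 4))); [lra|].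
  assert (Hq : 0 <= eps * Z * j ^ 4).
  { apply Rmult_le_pos; [|lra]. apply Rmult_le_pos; lra. }
  assert (Hr : 0 <= eps ^ 2 * j ^ 4) by (apply Rmult_le_pos; [apply pow2_ge_0 | lra]).
  replace (eps * Z * (g * j ^ 4) + (eps ^ 2 * (Cm / g * j ^ 4) + eps ^ 2 * (Cd * j ^ 4)))
    with (g * (eps * Z * j ^ 4) + (Cm / g + Cd) * (eps ^ 2 * j ^ 4)) by ring.
  replace (K * (2 * eps ^ 2 + eps * Z) * j ^ 4) with (K * (eps * Z * j ^ 4) + 2 * K * (eps ^ 2 * j ^ 4)) by ring.
  apply Rplus_le_compat; apply Rmult_le_compat_r; try assumption; unfold K; lra.
Qed.

(** The large factor [om / eps] multiplies a rotation, invisible to the norm, and a damping of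
    favourable sign. Only the source contributes, and [kw] integrates its weight [om^-4]. *)
Lemma slow_growth (Z : R) : (forall s, s0 <= s -> Cmod (z s) <= Z) -> forall s, s0 <= s ->
  Cmod (h s) <= Cmod (h s0) + 27 * K * (2 * eps ^ 2 + eps * Z) * kw g s.
Proof.
  intros HZ s Hs.
  destruct slow_K_pos as [_ [_ [_ HK]]].
  assert (HZ0 : 0 <= Z) by (pose proof (HZ s Hs); pose proof (Cmod_ge_0 (z s)); lra).
  set (c := 27 * K * (2 * eps ^ 2 + eps * Z)).
  assert (Hc0 : 0 <= K * (2 * eps ^ 2 + eps * Z)).
  { apply Rmult_le_pos; [lra|]. pose proof (pow2_ge_0 eps). assert (0 <= eps * Z) by (apply Rmult_le_pos; lra). lra. }
  assert (Hc : 0 <= c) by (unfold c; lra).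
  set (dk := fun s => 3 * (1 - s / om g s) / (om g s - s + g) ^ 4).
  assert (Hdk : forall s, K * (2 * eps ^ 2 + eps * Z) * / om g s ^ 4 <= c * dk s).
  { intros u. pose proof (kw_deriv_ge g g_pos u) as Hk. fold (dk u) in Hk.
    replace (c * dk u) with (K * (2 * eps ^ 2 + eps * Z) * (27 * dk u)) by (unfold c; ring).
    apply Rmult_le_compat_l; assumption. }
  assert (G : Cmod (h s) <= Cmod (h s0) + (c * kw g s - c * kw g s0)).
  { apply (norm_growth h (fun s => Cplus (Cmult (Cmult (RtoC (om g s / eps)) (Cminus Ci (RtoC (gam s)))) (h s)) (src s))
      (fun s => c * kw g s) (fun s => c * dk s) s0 s Hs).
    - apply (rcont_ext (fun s => fst (z s) + - (eps * a s * fst (kap g gam s)) + - (eps ^ 2 * a s * fst (mu s)))).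
      { intros u. unfold h. simpl. ring. }
      apply rcont_plus; [apply rcont_plus; [exact rc_z1|]|]; apply rcont_opp.
      + apply (rcont_mult (fun s => eps * a s) (fun s => fst (kap g gam s))).
        * exact (rcont_mult _ _ _ (rcont_const eps s0) rc_a).
        * exact (rcont_derive _ _ _ (proj1 (slow_dkap s0))).
      + apply (rcont_mult (fun s => eps ^ 2 * a s) (fun s => fst (mu s))).
        * exact (rcont_mult _ _ _ (rcont_const (eps ^ 2) s0) rc_a).
        * exact (rcont_derive _ _ _ (proj1 (slow_dmu s0))).
    - apply (rcont_ext (fun s => snd (z s) + - (eps * a s * snd (kap g gam s)) + - (eps ^ 2 * a s * snd (mu s)))).
      { intros u. unfold h. simpl. ring. }
      apply rcont_plus; [apply rcont_plus; [exact rc_z2|]|]; apply rcont_opp.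
      + apply (rcont_mult (fun s => eps * a s) (fun s => snd (kap g gam s))).
        * exact (rcont_mult _ _ _ (rcont_const eps s0) rc_a).
        * exact (rcont_derive _ _ _ (proj2 (slow_dkap s0))).
      + apply (rcont_mult (fun s => eps ^ 2 * a s) (fun s => snd (mu s))).
        * exact (rcont_mult _ _ _ (rcont_const (eps ^ 2) s0) rc_a).
        * exact (rcont_derive _ _ _ (proj2 (slow_dmu s0))).
    - intros u Hu. apply slow_dh. lra.
    - intros u. eapply is_derive_val; [apply is_derive_Rmult; [apply is_derive_Rconst | apply is_derive_kw, g_pos]|].
      unfold dk. ring.
    - intros u Hu. eapply Rle_trans; [|apply Hdk]. apply Rmult_le_pos; [exact Hc0|].
      left. apply Rinv_0_lt_compat, pow_lt, om_pos, g_pos.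
    - intros u Hu.
      pose proof (slow_src_bound u Z ltac:(lra) (HZ u ltac:(lra))) as Hsrc.
      pose proof (Re_conj_le (h u) (src u)) as Hre. specialize (Hdk u).
      assert (Hdamp : 0 <= om g u / eps * gam u * (fst (h u) ^ 2 + snd (h u) ^ 2)).
      { apply Rmult_le_pos; [apply Rmult_le_pos; [|apply gam_nonneg]|].
        - left. apply Rdiv_lt_0_compat; [apply om_pos, g_pos | exact eps_pos].
        - pose proof (pow2_ge_0 (fst (h u))). pose proof (pow2_ge_0 (snd (h u))). lra. }
      set (hh := h u) in *. set (ss := src u) in *.
      apply Rle_trans with (fst hh * fst ss + snd hh * snd ss).
      + set (oe := om g u / eps) in *.
        assert (E : fst hh * fst (Cplus (Cmult (Cmult (RtoC oe) (Cminus Ci (RtoC (gam u)))) hh) ss)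
          + snd hh * snd (Cplus (Cmult (Cmult (RtoC oe) (Cminus Ci (RtoC (gam u)))) hh) ss)
          = fst hh * fst ss + snd hh * snd ss - oe * gam u * (fst hh ^ 2 + snd hh ^ 2)) by (simpl; ring).
        lra.
      + eapply Rle_trans; [exact Hre|]. apply Rmult_le_compat_l; [apply Cmod_ge_0 | lra]. }
  pose proof (kw_pos g g_pos s0). fold c. nra.
Qed.

Lemma slow_a_growth (Z : R) : (forall s, s0 <= s -> Cmod (z s) <= Z) -> forall s, s0 <= s ->
  Rabs (a s - a s0) <= Z * PI.
Proof.
  intros HZ s Hs.
  assert (HZ0 : 0 <= Z) by (pose proof (HZ s Hs); pose proof (Cmod_ge_0 (z s)); lra).
  pose proof (flow_a_growth g gam eps s0 s Z a z g_pos flow rc_a HZ Hs).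
  pose proof (atan_bound (s / g)). pose proof (atan_bound (s0 / g)). pose proof PI_RGT_0. nra.
Qed.

(** [slow_C3] collects remainder, [kap] and [mu] after the first pass; [slow_C4] doubles it to
    absorb numerical factors and adds 1 for the case [eps > 1]. [slow_Ce] measures the initial
    remainder against [zeta], and [slow_const] sums the coefficients of the final bound. *)
Definition slow_C3 : R := 54 * K / g ^ 3 + / g ^ 2 + Cm / g ^ 4.
Definition slow_C4 : R := 2 * slow_C3 + 1.
Definition slow_Ce : R := 1 + g + Cm / g.
Definition slow_const : R :=
  (27 * K * (2 + slow_C4) + 27 * Cm / g + 27 * g * PI * slow_C4)
  + (slow_Ce * (1 + 27 * K / g ^ 3) + 27 / g ^ 2 * (1 + PI * slow_Ce)) + (slow_C4 + slow_Ce).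

Variable sg : R.
(** Mismatch at the starting time: distance of [z] from 0, of [a] from its intended asymptotic value
    [sg], and the size of the slow manifold itself there. It tends to 0 when [s0] goes to [-oo]
    along correctly prepared states. *)
Let zeta := Cmod (z s0) + Rabs (a s0 - sg) + (eps + eps ^ 2) * / om g s0 ^ 3.

Lemma slow_const_pos : 0 <= slow_C3 /\ 1 <= slow_C4 /\ 1 <= slow_Ce /\ 0 <= slow_const /\ slow_C4 + slow_Ce <= slow_const.
Proof.
  destruct slow_K_pos as [Hcm [Hcd [Hcmg HK]]]. pose proof PI_RGT_0.
  assert (I1 : 0 < / g) by now apply Rinv_0_lt_compat.
  assert (I2 : 0 < / g ^ 2) by (apply Rinv_0_lt_compat; nra).
  assert (I3 : 0 < / g ^ 3) by (apply Rinv_0_lt_compat, pow_lt; lra).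
  assert (I4 : 0 < / g ^ 4) by (apply Rinv_0_lt_compat, pow_lt; lra).
  assert (0 <= 54 * K / g ^ 3) by (unfold Rdiv; apply Rmult_le_pos; lra).
  assert (0 <= Cm / g ^ 4) by (unfold Rdiv; apply Rmult_le_pos; lra).
  assert (P3 : 0 <= slow_C3) by (unfold slow_C3; lra).
  assert (P4 : 1 <= slow_C4) by (unfold slow_C4; lra).
  assert (Pe : 1 <= slow_Ce) by (unfold slow_Ce; lra).
  assert (0 <= 27 * K * (2 + slow_C4)) by (apply Rmult_le_pos; lra).
  assert (0 <= 27 * Cm / g) by (unfold Rdiv; apply Rmult_le_pos; lra).
  assert (0 <= 27 * g * PI * slow_C4) by (apply Rmult_le_pos; [apply Rmult_le_pos|]; lra).
  assert (0 <= slow_Ce * (1 + 27 * K / g ^ 3)).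
  { apply Rmult_le_pos; [lra|]. assert (0 <= 27 * K / g ^ 3) by (unfold Rdiv; apply Rmult_le_pos; lra). lra. }
  assert (0 <= 27 / g ^ 2 * (1 + PI * slow_Ce)).
  { apply Rmult_le_pos; [unfold Rdiv; lra|]. nra. }
  unfold slow_const. repeat split; lra.
Qed.

Lemma slow_init : Cmod (h s0) <= slow_Ce * zeta /\ 0 <= zeta.
Proof.
  destruct slow_K_pos as [Hcm [Hcd [Hcmg HK]]].
  pose proof (slow_kap_bound s0) as Bk. pose proof (slow_mu_bound s0) as Bm.
  pose proof (inv_om_pow_le g g_pos 3 s0) as I4. specialize (a_bound s0 (Rle_refl _)).
  set (i3 := / om g s0 ^ 3) in *. set (i4 := / om g s0 ^ 4) in *.
  assert (H3 : 0 < i3) by (apply Rinv_0_lt_compat, pow_lt, om_pos, g_pos).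
  pose proof (Cmod_ge_0 (z s0)) as Pz. pose proof (Rabs_pos (a s0 - sg)) as Pa. pose proof (Rabs_pos (a s0)).
  assert (He2 := pow2_ge_0 eps).
  assert (Hz : 0 <= zeta) by (unfold zeta; fold i3; assert (0 <= (eps + eps ^ 2) * i3) by (apply Rmult_le_pos; lra); lra).
  split; [|exact Hz].
  assert (P1 : Cmod (Cmult (RtoC (eps * a s0)) (kap g gam s0)) <= eps * (g * i3)).
  { rewrite Cmod_mult, Cmod_R, Rabs_mult, (Rabs_right eps) by lra.
    apply Rmult_le_compat; [apply Rmult_le_pos; lra | apply Cmod_ge_0 | nra | exact Bk]. }
  assert (P2 : Cmod (Cmult (RtoC (eps ^ 2 * a s0)) (mu s0)) <= eps ^ 2 * (Cm / g * i3)).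
  { rewrite Cmod_mult, Cmod_R, Rabs_mult, (Rabs_right (eps ^ 2)) by lra.
    apply Rmult_le_compat; [apply Rmult_le_pos; lra | apply Cmod_ge_0 | nra |].
    eapply Rle_trans; [exact Bm|]. unfold Rdiv. rewrite Rmult_assoc. apply Rmult_le_compat_l; assumption. }
  assert (T : Cmod (h s0) <= Cmod (z s0) + eps * (g * i3) + eps ^ 2 * (Cm / g * i3)).
  { unfold h, Cminus. eapply Rle_trans; [apply Cmod_triangle|]. rewrite Cmod_opp.
    apply Rplus_le_compat; [|exact P2].
    eapply Rle_trans; [apply Cmod_triangle|]. rewrite Cmod_opp. apply Rplus_le_compat_l, P1. }
  eapply Rle_trans; [exact T|].
  assert (Hei : 0 <= eps * i3) by (apply Rmult_le_pos; lra).
  assert (Hei2 : 0 <= eps ^ 2 * i3) by (apply Rmult_le_pos; lra).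
  assert (Hc1 : 1 <= slow_Ce) by (unfold slow_Ce; lra).
  apply Rle_trans with (slow_Ce * Cmod (z s0) + slow_Ce * Rabs (a s0 - sg) + slow_Ce * (eps * i3) + slow_Ce * (eps ^ 2 * i3)).
  - assert (1 * Cmod (z s0) <= slow_Ce * Cmod (z s0)) by (apply Rmult_le_compat_r; lra).
    assert (0 <= slow_Ce * Rabs (a s0 - sg)) by (apply Rmult_le_pos; lra).
    assert (g * (eps * i3) <= slow_Ce * (eps * i3)) by (apply Rmult_le_compat_r; unfold slow_Ce; lra).
    assert (Cm / g * (eps ^ 2 * i3) <= slow_Ce * (eps ^ 2 * i3)) by (apply Rmult_le_compat_r; unfold slow_Ce; lra).
    lra.
  - right. unfold zeta. fold i3. ring.
Qed.

(* Bootstrapping: the trivial bound [Cmod z <= 1] makes [z] of order [eps] by [slow_growth],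
   and inserting this in [slow_growth] again makes the remainder of order [eps ^ 2]. *)
Lemma slow_z_order (s : R) : s0 <= s -> Cmod (z s) <= Cmod (h s0) + slow_C4 * eps.
Proof.
  intros Hs. destruct slow_K_pos as [Hcm [Hcd [Hcmg HK]]].
  destruct slow_const_pos as [P3 [P4 _]].
  pose proof (Cmod_ge_0 (h s0)) as Ph.
  (* For [eps > 1] the expansion is worthless, but then [1 <= slow_C4 * eps] and [|z| <= 1]
     suffices. *)
  destruct (Rle_dec eps 1) as [He|He].
  2:{ specialize (z_bound s Hs). nra. }
  pose proof (slow_growth 1 z_bound s Hs) as G.
  pose proof (slow_kap_bound s) as Bk. pose proof (slow_mu_bound s) as Bm.
  pose proof (kw_le_const g g_pos s) as Hk. pose proof (kw_pos g g_pos s) as Hk0.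
  specialize (a_bound s Hs). pose proof (Rabs_pos (a s)).
  pose proof (om_ge_g g g_pos s) as Hog.
  assert (I3 : / om g s ^ 3 <= / g ^ 3) by (apply Rinv_le_contravar; [apply pow_lt; lra | apply pow_incr; lra]).
  assert (I4 : / om g s ^ 4 <= / g ^ 4) by (apply Rinv_le_contravar; [apply pow_lt; lra | apply pow_incr; lra]).
  assert (He2 : 0 <= eps ^ 2 <= eps) by nra.
  assert (Q1 : Cmod (Cmult (RtoC (eps * a s)) (kap g gam s)) <= eps * / g ^ 2).
  { rewrite Cmod_mult, Cmod_R, Rabs_mult, (Rabs_right eps) by lra.
    apply Rmult_le_compat; [apply Rmult_le_pos; lra | apply Cmod_ge_0 | nra |].
    eapply Rle_trans; [exact Bk|]. apply Rle_trans with (g * / g ^ 3); [apply Rmult_le_compat_l; lra|].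
    right. field. lra. }
  assert (Q2 : Cmod (Cmult (RtoC (eps ^ 2 * a s)) (mu s)) <= eps * (Cm / g ^ 4)).
  { rewrite Cmod_mult, Cmod_R, Rabs_mult, (Rabs_right (eps ^ 2)) by lra.
    apply Rmult_le_compat; [apply Rmult_le_pos; lra | apply Cmod_ge_0 | nra |].
    eapply Rle_trans; [exact Bm|]. unfold Rdiv. apply Rmult_le_compat_l; lra. }
  assert (Q3 : 27 * K * (2 * eps ^ 2 + eps * 1) * kw g s <= 2 * (eps * (54 * K / g ^ 3))).
  { apply Rle_trans with (27 * K * (3 * eps) * / g ^ 3).
    - apply Rmult_le_compat; [|lra| |lra].
      + apply Rmult_le_pos; lra.
      + apply Rmult_le_compat_l; lra.
    - assert (0 <= K * eps * / g ^ 3).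
      { apply Rmult_le_pos; [apply Rmult_le_pos; lra|]. left. apply Rinv_0_lt_compat, pow_lt; lra. }
      unfold Rdiv. nra. }
  assert (T : Cmod (z s) <= Cmod (h s) + Cmod (Cmult (RtoC (eps * a s)) (kap g gam s)) + Cmod (Cmult (RtoC (eps ^ 2 * a s)) (mu s))).
  { replace (z s) with (Cplus (Cplus (h s) (Cmult (RtoC (eps * a s)) (kap g gam s))) (Cmult (RtoC (eps ^ 2 * a s)) (mu s)))
      at 1 by (unfold h; ring).
    eapply Rle_trans; [apply Cmod_triangle|]. apply Rplus_le_compat_r, Cmod_triangle. }
  assert (0 <= eps * / g ^ 2) by (apply Rmult_le_pos; [lra | left; apply Rinv_0_lt_compat; nra]).
  assert (0 <= eps * (Cm / g ^ 4)).
  { apply Rmult_le_pos; [lra|]. unfold Rdiv. apply Rmult_le_pos; [lra | left; apply Rinv_0_lt_compat, pow_lt; lra]. }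
  unfold slow_C4, slow_C3. lra.
Qed.

(** The second pass, with [Z] now of order [eps] up to the initial mismatch, makes the remainder of
    order [eps^2 kw]. As [a] drifts by at most [Z PI], freezing it at [sg] costs another term of the
    same order. The mismatch enters without decaying weight, which is harmless once [s0] tends to
    [-oo]. *)
Lemma slow_manifold_bound (s : R) : s0 <= s ->
  Cmod (Cminus (z s) (Cmult (RtoC (eps * sg)) (kap g gam s)))
    <= slow_const * (eps ^ 2 * kw g s + (1 + eps) * zeta) /\
  Cmod (z s) <= slow_const * (eps + zeta).
Proof.
  intros Hs. destruct slow_K_pos as [Hcm [Hcd [Hcmg HK]]].
  destruct slow_const_pos as [P3 [P4 [Pe [Pc Pc']]]].
  destruct slow_init as [Hin Hz]. set (eta := Cmod (h s0)) in *.
  pose proof (Cmod_ge_0 (h s0)) as Pn. fold eta in Pn.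
  split.
  2:{ eapply Rle_trans; [apply (slow_z_order s Hs)|]. fold eta.
      rewrite Rmult_plus_distr_l.
      assert (slow_C4 * eps <= slow_const * eps) by (apply Rmult_le_compat_r; lra).
      assert (slow_Ce * zeta <= slow_const * zeta) by (apply Rmult_le_compat_r; lra). lra. }
  set (Z := eta + slow_C4 * eps).
  assert (HZ : forall u, s0 <= u -> Cmod (z u) <= Z) by (intros u Hu; apply slow_z_order, Hu).
  pose proof (slow_growth Z HZ s Hs) as G. fold eta in G.
  pose proof (slow_a_growth Z HZ s Hs) as Ga.
  pose proof (slow_kap_bound s) as Bk. pose proof (slow_mu_bound s) as Bm.
  pose proof (kw_le_const g g_pos s) as Hk. pose proof (kw_pos g g_pos s) as Hk0.
  pose proof (om3_le_kw g g_pos s) as H3k. pose proof (inv_om_pow_le g g_pos 3 s) as I4.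
  specialize (a_bound s Hs). pose proof (Rabs_pos (a s)). pose proof PI_RGT_0 as Hpi.
  assert (Ig : 0 < / g) by now apply Rinv_0_lt_compat.
  set (k := kw g s) in *.
  assert (Bk' : Cmod (kap g gam s) <= 27 * g * k).
  { eapply Rle_trans; [exact Bk|]. replace (27 * g * k) with (g * (27 * k)) by ring. apply Rmult_le_compat_l; lra. }
  assert (Bm' : Cmod (mu s) <= 27 * Cm / g * k).
  { eapply Rle_trans; [exact Bm|].
    replace (27 * Cm / g * k) with (Cm * (/ g * (27 * k))) by (field; lra).
    apply Rmult_le_compat_l; [lra|]. eapply Rle_trans; [exact I4|]. apply Rmult_le_compat_l; lra. }
  assert (Aa : Rabs (a s - sg) <= zeta + Z * PI).
  { replace (a s - sg) with ((a s - a s0) + (a s0 - sg)) by ring.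
    eapply Rle_trans; [apply Rabs_triang|].
    assert (Rabs (a s0 - sg) <= zeta).
    { unfold zeta. pose proof (Cmod_ge_0 (z s0)).
      assert (0 <= (eps + eps ^ 2) * / om g s0 ^ 3).
      { apply Rmult_le_pos; [nra|]. left. apply Rinv_0_lt_compat, pow_lt, om_pos, g_pos. }
      lra. }
    lra. }
  assert (T : Cmod (Cminus (z s) (Cmult (RtoC (eps * sg)) (kap g gam s)))
    <= Cmod (h s) + eps ^ 2 * Cmod (mu s) + eps * Rabs (a s - sg) * Cmod (kap g gam s)).
  { replace (Cminus (z s) (Cmult (RtoC (eps * sg)) (kap g gam s))) with
      (Cplus (Cplus (h s) (Cmult (RtoC (eps ^ 2 * a s)) (mu s))) (Cmult (RtoC (eps * (a s - sg))) (kap g gam s))).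
    2:{ unfold h. rewrite !(RtoC_mult eps), RtoC_minus. ring. }
    eapply Rle_trans; [apply Cmod_triangle|]. apply Rplus_le_compat.
    - eapply Rle_trans; [apply Cmod_triangle|]. apply Rplus_le_compat_l.
      rewrite Cmod_mult, Cmod_R, Rabs_mult, (Rabs_right (eps ^ 2)) by nra.
      apply Rmult_le_compat_r; [apply Cmod_ge_0|]. nra.
    - rewrite Cmod_mult, Cmod_R, Rabs_mult, (Rabs_right eps) by lra. lra. }
  assert (E2 : 0 <= eps ^ 2) by apply pow2_ge_0.
  assert (Ek2 : 0 <= eps ^ 2 * k) by (apply Rmult_le_pos; lra).
  assert (S1 : Cmod (h s) <= eta + 27 * K * (2 + slow_C4) * (eps ^ 2 * k) + 27 * K / g ^ 3 * (eps * eta)).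
  { eapply Rle_trans; [exact G|]. unfold Z.
    replace (27 * K * (2 * eps ^ 2 + eps * (eta + slow_C4 * eps)) * k)
      with (27 * K * (2 + slow_C4) * (eps ^ 2 * k) + 27 * K * (eps * eta) * k) by ring.
    assert (27 * K * (eps * eta) * k <= 27 * K * (eps * eta) * / g ^ 3).
    { apply Rmult_le_compat_l; [|lra]. apply Rmult_le_pos; [lra|]. apply Rmult_le_pos; lra. }
    unfold Rdiv. lra. }
  assert (S2 : eps ^ 2 * Cmod (mu s) <= 27 * Cm / g * (eps ^ 2 * k)).
  { replace (27 * Cm / g * (eps ^ 2 * k)) with (eps ^ 2 * (27 * Cm / g * k)) by ring.
    apply Rmult_le_compat_l; lra. }
  assert (S3 : eps * Rabs (a s - sg) * Cmod (kap g gam s)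
    <= 27 * g * PI * slow_C4 * (eps ^ 2 * k) + 27 / g ^ 2 * (eps * (zeta + PI * eta))).
  { apply Rle_trans with (eps * (zeta + Z * PI) * (27 * g * k)).
    - apply Rmult_le_compat; [apply Rmult_le_pos; [lra | apply Rabs_pos] | apply Cmod_ge_0 | apply Rmult_le_compat_l; lra | exact Bk'].
    - unfold Z.
      replace (eps * (zeta + (eta + slow_C4 * eps) * PI) * (27 * g * k))
        with (27 * g * PI * slow_C4 * (eps ^ 2 * k) + 27 * g * (eps * (zeta + PI * eta)) * k) by ring.
      apply Rplus_le_compat_l.
      apply Rle_trans with (27 * g * (eps * (zeta + PI * eta)) * / g ^ 3).
      + apply Rmult_le_compat_l; [|lra]. apply Rmult_le_pos; [lra|]. apply Rmult_le_pos; [lra|]. nra.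
      + right. field. lra. }
  assert (I3 : 0 <= 27 * K / g ^ 3).
  { unfold Rdiv. apply Rmult_le_pos; [lra | left; apply Rinv_0_lt_compat, pow_lt; lra]. }
  assert (I2 : 0 <= 27 / g ^ 2).
  { unfold Rdiv. apply Rmult_le_pos; [lra | left; apply Rinv_0_lt_compat; nra]. }
  assert (Hez : 0 <= eps * zeta) by (apply Rmult_le_pos; lra).
  assert (S4 : eta + 27 * K / g ^ 3 * (eps * eta) <= slow_Ce * (1 + 27 * K / g ^ 3) * ((1 + eps) * zeta)).
  { assert (eps * eta <= eps * (slow_Ce * zeta)) by (apply Rmult_le_compat_l; lra).
    assert (27 * K / g ^ 3 * (eps * eta) <= 27 * K / g ^ 3 * (eps * (slow_Ce * zeta))) by (apply Rmult_le_compat_l; lra).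
    assert (0 <= slow_Ce * (eps * zeta)) by (apply Rmult_le_pos; lra).
    assert (0 <= 27 * K / g ^ 3 * (slow_Ce * zeta)) by (apply Rmult_le_pos; [lra | apply Rmult_le_pos; lra]).
    lra. }
  assert (S5 : 27 / g ^ 2 * (eps * (zeta + PI * eta)) <= 27 / g ^ 2 * (1 + PI * slow_Ce) * ((1 + eps) * zeta)).
  { rewrite Rmult_assoc. apply Rmult_le_compat_l; [exact I2|].
    assert (PI * eta <= PI * (slow_Ce * zeta)) by (apply Rmult_le_compat_l; lra).
    apply Rle_trans with (eps * (zeta + PI * (slow_Ce * zeta))); [apply Rmult_le_compat_l; lra|].
    assert (0 <= (1 + PI * slow_Ce) * zeta) by (apply Rmult_le_pos; [nra | lra]). lra. }
  set (w := (1 + eps) * zeta) in *.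
  assert (Hw : 0 <= w) by (unfold w; apply Rmult_le_pos; lra).
  set (c1 := 27 * K * (2 + slow_C4) + 27 * Cm / g + 27 * g * PI * slow_C4).
  set (c2 := slow_Ce * (1 + 27 * K / g ^ 3) + 27 / g ^ 2 * (1 + PI * slow_Ce)).
  assert (Hc1 : 0 <= c1).
  { unfold c1. assert (0 <= 27 * K * (2 + slow_C4)) by (apply Rmult_le_pos; lra).
    assert (0 <= 27 * Cm / g) by (unfold Rdiv; apply Rmult_le_pos; lra).
    assert (0 <= 27 * g * PI * slow_C4) by (apply Rmult_le_pos; [apply Rmult_le_pos|]; lra). lra. }
  assert (Hc2 : 0 <= c2).
  { unfold c2. assert (0 <= slow_Ce * (1 + 27 * K / g ^ 3)) by (apply Rmult_le_pos; lra).
    assert (0 <= 27 / g ^ 2 * (1 + PI * slow_Ce)) by (apply Rmult_le_pos; [lra | nra]). lra. }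
  assert (F : c1 * (eps ^ 2 * k) + c2 * w <= slow_const * (eps ^ 2 * k + w)).
  { rewrite Rmult_plus_distr_l. apply Rplus_le_compat; apply Rmult_le_compat_r; try assumption;
      unfold slow_const; fold c1 c2; lra. }
  unfold c1, c2 in F. lra.
Qed.

End Trajectory.

End SlowManifold.

(** * Bloch vectors and the moving frame *)

Definition bloch_a (g : R) (X Z : R -> R) (s : R) : R := (g * X s + s * Z s) / om g s.
Definition bloch_z (g : R) (X Y Z : R -> R) (s : R) : C := ((s * X s - g * Z s) / om g s, Y s).

Definition bloch_eq (g : R) (gam : R -> R) (eps : R) (X Y Z : R -> R) (s : R) : Prop :=
  is_derive X s ((- s * Y s - gam s * (om g s * X s - g * bloch_a g X Z s)) / eps) /\
  is_derive Y s ((s * X s - g * Z s - gam s * om g s * Y s) / eps) /\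
  is_derive Z s ((g * Y s - gam s * (om g s * Z s - s * bloch_a g X Z s)) / eps).

Lemma bloch_eq_flow (g : R) (gam : R -> R) (eps : R) (X Y Z : R -> R) (s : R) : 0 < g -> 0 < eps ->
  bloch_eq g gam eps X Y Z s ->
  dephasing_flow g gam eps (bloch_a g X Z) (bloch_z g X Y Z) s.
Proof.
  intros Hg He [DX [DY DZ]].
  pose proof (om_pos g Hg s) as Ho. pose proof (om_sqr g s) as Hq.
  assert (Di : is_derive (fun s => / om g s) s (- s / om g s ^ 3)).
  { apply (is_derive_Rext (fun s => / om g s ^ 1)); [intros; now rewrite pow_1|].
    eapply is_derive_val; [apply is_derive_inv_om_pow, Hg|]. simpl. field. lra. }
  assert (DI : is_derive (fun s => s) s 1) by exact (is_derive_id s).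
  split; [|split].
  - unfold bloch_a at 1, Rdiv. eapply is_derive_val.
    + apply is_derive_Rmult; [|exact Di].
      apply is_derive_Rplus; apply is_derive_Rmult; [apply is_derive_Rconst | exact DX | exact DI | exact DZ].
    + unfold bloch_z, th, bloch_a. cbn [fst]. cbv beta.
      apply Rminus_diag_uniq.
      (* The two sides differ by a multiple of the relation [om^2 = s^2 + g^2]; that multiple is
         displayed here, and similarly in the next case. *)
      transitivity ((om g s ^ 2 - (s ^ 2 + g ^ 2)) * (Z s * / om g s ^ 3 - gam s * (g * X s + s * Z s) * / (eps * om g s ^ 2))); [|rewrite Hq; ring].
      field. lra.
  - unfold bloch_z at 1. cbn [fst]. unfold Rdiv. eapply is_derive_val.
    + apply is_derive_Rmult; [|exact Di].
      apply is_derive_Rminus; apply is_derive_Rmult; [exact DI | exact DX | apply is_derive_Rconst | exact DZ].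
    + unfold bloch_z, th, bloch_a. simpl. cbv beta.
      apply Rminus_diag_uniq.
      transitivity ((om g s ^ 2 - (s ^ 2 + g ^ 2)) * (Y s * / eps * / om g s + X s * / om g s ^ 3)); [|rewrite Hq; ring].
      field. lra.
  - unfold bloch_z at 1. cbn [snd]. eapply is_derive_val; [exact DY|].
    unfold bloch_z. simpl. field. lra.
Qed.

Lemma bloch_norm (g : R) (X Y Z : R -> R) (s : R) : 0 < g ->
  bloch_a g X Z s ^ 2 + Cmod (bloch_z g X Y Z s) ^ 2 = X s ^ 2 + Y s ^ 2 + Z s ^ 2.
Proof.
  intros Hg. rewrite Cmod2_components. unfold bloch_a, bloch_z. cbn [fst snd].
  pose proof (om_pos g Hg s) as Ho. pose proof (om_sqr g s) as Hq.
  transitivity ((s ^ 2 + g ^ 2) / om g s ^ 2 * (X s ^ 2 + Z s ^ 2) + Y s ^ 2).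
  - field. lra.
  - rewrite <- Hq. field. lra.
Qed.

Definition kap0 (g s : R) : C := kap g (fun _ => 0) s.

(* The solution of the undamped equation which is asymptotic to the upper level as [s -> oo];
   pairing it with a damped solution isolates the effect of the damping. *)
Lemma landau_zener_bloch (g eps : R) : 0 < g -> 0 < eps ->
  exists X Y Z : R -> R,
    (forall s, bloch_eq g (fun _ => 0) eps X Y Z s) /\
    (forall s, X s ^ 2 + Y s ^ 2 + Z s ^ 2 = 1) /\
    exists c s1, 0 < s1 /\ forall s, s1 <= s ->
      Rabs (X s) <= c / s /\ Rabs (Y s) <= c / s /\ Rabs (Z s - 1) <= c / s /\
      Rabs (Z (- s) - (2 * exp (- PI * g ^ 2 / (2 * eps)) - 1)) <= c / s.
Proof.
  intros Hg He. set (nu := g ^ 2 / (4 * eps)).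
  assert (Hnu : 0 < nu) by (apply Rdiv_lt_0_compat; nra).
  destruct (landau_zener_spinor nu Hnu) as [u [v [Du [Dv [Nrm [c Hc]]]]]].
  (* Rescaling by [x = s / sqrt eps] turns the coupling into [sqrt nu = g / (2 sqrt eps)]; the
     survival probability [e^(- 2 PI nu)] is then the stated exponential. *)
  set (q := sqrt eps). assert (Hq : 0 < q) by (apply sqrt_lt_R0, He).
  assert (Eq : q * q = eps) by (apply sqrt_sqrt; lra).
  assert (Esn : sqrt nu = g / (2 * q)).
  { apply sqrt_lem_1; [lra | left; apply Rdiv_lt_0_compat; lra|]. unfold nu. rewrite <- Eq. field. lra. }
  assert (Hc0 : 0 <= c).
  { destruct (Hc 1 ltac:(lra)) as [H _]. pose proof (Cmod_ge_0 (v 1)). unfold Rdiv in H. rewrite Rinv_1 in H. lra. }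
  assert (Du1 : forall s, is_derive (fun s => fst (u (s / q))) s (g / (2 * eps) * snd (v (s / q)))
                       /\ is_derive (fun s => snd (u (s / q))) s (- (g / (2 * eps)) * fst (v (s / q)))).
  { intros s. assert (H := is_cderive_comp u (fun s => s / q) s (/ q) _ (Du (s / q))).
    destruct H as [H1 H2]; [auto_derive; [exact I | field; lra]|]. rewrite Esn in H1, H2.
    split; (eapply is_derive_val; [eassumption|]); rewrite <- Eq; simpl; field; lra. }
  assert (Dv1 : forall s, is_derive (fun s => fst (v (s / q))) s (- (s / eps) * snd (v (s / q)) + g / (2 * eps) * snd (u (s / q)))
                       /\ is_derive (fun s => snd (v (s / q))) s (s / eps * fst (v (s / q)) - g / (2 * eps) * fst (u (s / q)))).
  { intros s. assert (H := is_cderive_comp v (fun s => s / q) s (/ q) _ (Dv (s / q))).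
    destruct H as [H1 H2]; [auto_derive; [exact I | field; lra]|]. rewrite Esn in H1, H2.
    split; (eapply is_derive_val; [eassumption|]); rewrite <- Eq; simpl; field; lra. }
  set (U1 := fun s => fst (u (s / q))) in *. set (U2 := fun s => snd (u (s / q))) in *.
  set (V1 := fun s => fst (v (s / q))) in *. set (V2 := fun s => snd (v (s / q))) in *.
  assert (N1 : forall s, U1 s * U1 s + U2 s * U2 s + V1 s * V1 s + V2 s * V2 s = 1).
  { intros s. unfold U1, U2, V1, V2. rewrite <- (Nrm (s / q)), !Cmod2_components. ring. }
  (* The Hopf map: real and imaginary part of [2 conj(u) v], and [|u|^2 - |v|^2]. It sends unit
     spinors to unit vectors and the spinor equation to rotation about [n]. *)
  exists (fun s => 2 * (U1 s * V1 s + U2 s * V2 s)), (fun s => 2 * (U1 s * V2 s - U2 s * V1 s)),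
    (fun s => U1 s * U1 s + U2 s * U2 s - (V1 s * V1 s + V2 s * V2 s)).
  split; [|split].
  - intros s. destruct (Du1 s) as [d1 d2], (Dv1 s) as [e1 e2].
    split; [|split]; eapply is_derive_val.
    + apply is_derive_Rmult; [apply is_derive_Rconst|].
      exact (is_derive_Rplus _ _ _ _ _ (is_derive_Rmult _ _ _ _ _ d1 e1) (is_derive_Rmult _ _ _ _ _ d2 e2)).
    + cbv beta. fold (U1 s) (U2 s) (V1 s) (V2 s). field. lra.
    + apply is_derive_Rmult; [apply is_derive_Rconst|].
      exact (is_derive_Rminus _ _ _ _ _ (is_derive_Rmult _ _ _ _ _ d1 e2) (is_derive_Rmult _ _ _ _ _ d2 e1)).
    + cbv beta. fold (U1 s) (U2 s) (V1 s) (V2 s). field. lra.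
    + exact (is_derive_Rminus _ _ _ _ _
        (is_derive_Rplus _ _ _ _ _ (is_derive_Rmult _ _ _ _ _ d1 d1) (is_derive_Rmult _ _ _ _ _ d2 d2))
        (is_derive_Rplus _ _ _ _ _ (is_derive_Rmult _ _ _ _ _ e1 e1) (is_derive_Rmult _ _ _ _ _ e2 e2))).
    + cbv beta. fold (U1 s) (U2 s) (V1 s) (V2 s). field. lra.
  - intros s. transitivity ((U1 s * U1 s + U2 s * U2 s + V1 s * V1 s + V2 s * V2 s) ^ 2); [ring|].
    rewrite N1. ring.
  - exists (4 * c * q), q. split; [exact Hq|]. intros s Hs.
    assert (Hx : 1 <= s / q).
    { apply Rmult_le_reg_r with q; [lra|]. replace (s / q * q) with s by (field; lra). lra. }
    destruct (Hc (s / q) Hx) as [Hv Hu]. specialize (N1 s). pose proof (Nrm (- s / q)) as N2.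
    replace (c / (s / q)) with (c * q / s) in * by (field; lra).
    replace (- (s / q)) with (- s / q) in Hu by (field; lra).
    rewrite Cmod2_components in Hu, N2. rewrite Cmod2_components in N2.
    replace (4 * c * q / s) with (4 * (c * q / s)) by (field; lra). set (d := c * q / s) in *.
    assert (Hd : 0 <= d) by (pose proof (Cmod_ge_0 (v (s / q))); lra).
    pose proof (abs_fst_le_Cmod (v (s / q))) as A1. pose proof (abs_snd_le_Cmod (v (s / q))) as A2.
    fold (V1 s) in A1. fold (V2 s) in A2.
    apply Rabs_le_between in Hu.
    assert (B1 : - d <= V1 s <= d) by (apply Rabs_le_between; lra).
    assert (B2 : - d <= V2 s <= d) by (apply Rabs_le_between; lra).
    assert (Q1 : U1 s * U1 s <= 1) by nra. assert (Q2 : U2 s * U2 s <= 1) by nra.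
    assert (C1 : -1 <= U1 s <= 1) by nra. assert (C2 : -1 <= U2 s <= 1) by nra.
    assert (C3 : -1 <= V1 s <= 1) by nra. assert (C4 : -1 <= V2 s <= 1) by nra.
    assert (P : forall x y, -1 <= x <= 1 -> - d <= y <= d -> - d <= x * y <= d) by (intros; nra).
    pose proof (P _ _ C1 B1). pose proof (P _ _ C1 B2). pose proof (P _ _ C2 B1). pose proof (P _ _ C2 B2).
    pose proof (P _ _ C3 B1). pose proof (P _ _ C4 B2).
    repeat split.
    + apply Rabs_le; lra.
    + apply Rabs_le; lra.
    + apply Rabs_le; lra.
    + replace (- PI * g ^ 2 / (2 * eps)) with (- (2 * PI * nu)) by (unfold nu; field; lra).
      unfold U1, U2, V1, V2. apply Rabs_le. lra.
Qed.

(** * The undamped solution prescribed at [+oo] *)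

Lemma le_of_rate (x y c T0 : R) : (forall T, T0 <= T -> 0 < T -> x <= y + c / T) -> x <= y.
Proof.
  intros H. apply le_epsilon. intros d Hd.
  set (T := Rmax 1 (Rmax T0 (Rabs c / d))).
  assert (H1 : 1 <= T) by apply Rmax_l.
  assert (H2 : T0 <= T) by (eapply Rle_trans; [apply Rmax_l | apply Rmax_r]).
  assert (H3 : Rabs c / d <= T) by (eapply Rle_trans; [apply Rmax_r | apply Rmax_r]).
  specialize (H T H2 ltac:(lra)).
  assert (c / T <= d).
  { apply Rmult_le_reg_r with T; [lra|]. replace (c / T * T) with c by (field; lra).
    apply (Rmult_le_compat_r d) in H3; [|lra]. replace (Rabs c / d * d) with (Rabs c) in H3 by (field; lra).
    pose proof (Rle_abs c). lra. }
  lra.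
Qed.

Lemma th_even (g s : R) : th g (- s) = th g s.
Proof. unfold th. now rewrite om_even. Qed.

(** Time reversal of the undamped flow. It carries a solution prescribed at [+oo] to one prescribed
    at [-oo], to which the forward slow-manifold estimate applies. *)
Lemma dephasing_flow_reflect (g eps : R) (a : R -> R) (z : R -> C) (s : R) :
  dephasing_flow g (fun _ => 0) eps a z (- s) ->
  dephasing_flow g (fun _ => 0) eps (fun s => a (- s)) (fun s => Copp (Cconj (z (- s)))) s.
Proof.
  intros [Da [D1 D2]]. rewrite om_even, th_even in *.
  assert (dn : is_derive (fun s => - s) s (-1)) by (auto_derive; [exact I | ring]).
  split; [|split].
  - eapply is_derive_val; [exact (is_derive_Rcomp a (fun s => - s) s _ _ Da dn)|]. simpl. ring.
  - eapply is_derive_val.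
    + exact (is_derive_Ropp _ _ _ (is_derive_Rcomp (fun s => fst (z s)) (fun s => - s) s _ _ D1 dn)).
    + simpl. ring.
  - eapply is_derive_val.
    + exact (is_derive_Ropp _ _ _ (is_derive_Ropp _ _ _ (is_derive_Rcomp (fun s => snd (z s)) (fun s => - s) s _ _ D2 dn))).
    + simpl. ring.
Qed.

Lemma abs_Cmod_le_1 (x : R) (z : C) : x ^ 2 + Cmod z ^ 2 <= 1 -> Rabs x <= 1 /\ Cmod z <= 1.
Proof.
  intros H. pose proof (Cmod_ge_0 z). split; [apply Rabs_le|]; nra.
Qed.

(** The slow-manifold bound is applied to the reflected solution with [gam = 0], [M = 0] and
    [sg = 1]; reflecting back replaces the weight [kw g s] by [kw g (- s)], which decays at [+oo].
    At [-oo] the axis [n] points down, so the limit of [a] there is minus that of [Z]. *)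
Lemma landau_zener_dual (g eps : R) : 0 < g -> 0 < eps ->
  exists (a : R -> R) (z : R -> C),
    (forall s, dephasing_flow g (fun _ => 0) eps a z s) /\
    (forall s, a s ^ 2 + Cmod (z s) ^ 2 = 1) /\
    (forall s, Cmod (Cminus (z s) (Cmult (RtoC eps) (kap0 g s))) <= slow_const g 0 * (eps ^ 2 * kw g (- s))) /\
    (forall s, Cmod (z s) <= slow_const g 0 * eps) /\
    exists c s1, 0 < s1 /\ forall s, s1 <= s ->
      Cmod (z s) <= c / s /\ Rabs (a s - 1) <= c / s /\
      Rabs (a (- s) - (1 - 2 * exp (- PI * g ^ 2 / (2 * eps)))) <= c / s.
Proof.
  intros Hg He. destruct (landau_zener_bloch g eps Hg He) as [X [Y [Z [Beq [Nrm [c [s1 [Hs1 As]]]]]]]].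
  set (a := bloch_a g X Z). set (z := bloch_z g X Y Z).
  assert (Fl : forall s, dephasing_flow g (fun _ => 0) eps a z s) by (intros s; apply bloch_eq_flow; auto).
  assert (Naz : forall s, a s ^ 2 + Cmod (z s) ^ 2 = 1) by (intros s; unfold a, z; rewrite bloch_norm; auto).
  set (P := exp (- PI * g ^ 2 / (2 * eps))) in *.
  assert (Asy : forall s, s1 <= s -> Cmod (z s) <= (3 * c + 3 * g) / s /\ Rabs (a s - 1) <= (3 * c + 3 * g) / s /\
      Rabs (a (- s) - (1 - 2 * P)) <= (3 * c + 3 * g) / s).
  { intros s Hs. destruct (As s Hs) as [A1 [A2 [A3 A4]]].
    pose proof (om_pos g Hg s) as Ho. pose proof (om_ge_g g Hg s) as Hog.
    pose proof (om_bounds g s) as Hb. pose proof (om_le g Hg s) as Hl. rewrite Rabs_right in Hl by lra.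
    assert (Hp : 0 <= g / om g s <= g / s).
    { split; [left; now apply Rdiv_lt_0_compat|]. unfold Rdiv. apply Rmult_le_compat_l; [lra|].
      apply Rinv_le_contravar; lra. }
    assert (Hp1 : g / om g s <= 1).
    { apply Rmult_le_reg_r with (om g s); [exact Ho|]. replace (g / om g s * om g s) with g by (field; lra). lra. }
    assert (Hr : 0 <= s / om g s <= 1).
    { split; [left; apply Rdiv_lt_0_compat; lra|].
      apply Rmult_le_reg_r with (om g s); [exact Ho|]. replace (s / om g s * om g s) with s by (field; lra). lra. }
    assert (Hr' : 1 - s / om g s <= g / s).
    { eapply Rle_trans; [|apply Hp]. apply Rmult_le_reg_r with (om g s); [exact Ho|].
      replace ((1 - s / om g s) * om g s) with (om g s - s) by (field; lra).
      replace (g / om g s * om g s) with g by (field; lra). lra. }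
    replace ((3 * c + 3 * g) / s) with (3 * (c / s) + 3 * (g / s)) by (field; lra).
    apply Rabs_le_between in A1. apply Rabs_le_between in A2. apply Rabs_le_between in A3. apply Rabs_le_between in A4.
    pose proof (Nrm s) as N1. pose proof (Nrm (- s)) as N2.
    assert (B1 : -1 <= Z s <= 1) by nra. assert (B2 : -1 <= Z (- s) <= 1) by nra. assert (B3 : -1 <= X (- s) <= 1) by nra.
    assert (Ez : z s = (s / om g s * X s - g / om g s * Z s, Y s)) by (unfold z, bloch_z; f_equal; field; lra).
    assert (Ea : a s = g / om g s * X s + s / om g s * Z s) by (unfold a, bloch_a; field; lra).
    assert (Ea' : a (- s) = g / om g s * X (- s) - s / om g s * Z (- s)) by (unfold a, bloch_a; rewrite om_even; field; lra).
    set (p := g / om g s) in *. set (r := s / om g s) in *. set (d := c / s) in *. set (e := g / s) in *.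
    assert (Hd : 0 <= d) by lra.
    assert (M : forall x y D, 0 <= x <= 1 -> - D <= y <= D -> - D <= x * y <= D) by (intros; nra).
    pose proof (M r (X s) d Hr A1) as m1.
    pose proof (M p (X s) d ltac:(lra) A1) as m2.
    pose proof (M r (Z s - 1) d Hr A3) as m3.
    assert (m4 : - e <= p * Z s <= e) by (assert (- p <= p * Z s <= p) by nra; lra).
    assert (m5 : - e <= p * X (- s) <= e) by (assert (- p <= p * X (- s) <= p) by nra; lra).
    assert (m6 : - e <= (1 - r) * Z (- s) <= e) by (assert (- (1 - r) <= (1 - r) * Z (- s) <= 1 - r) by nra; lra).
    split; [|split].
    - rewrite Ez. eapply Rle_trans; [apply Cmod_le_abs|]. cbn [fst snd].
      assert (Rabs (r * X s - p * Z s) <= d + e) by (apply Rabs_le; lra).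
      assert (Rabs (Y s) <= d) by (apply Rabs_le; lra). lra.
    - rewrite Ea. replace (p * X s + r * Z s - 1) with (p * X s + r * (Z s - 1) - (1 - r)) by ring. apply Rabs_le; lra.
    - rewrite Ea'. replace (p * X (- s) - r * Z (- s) - (1 - 2 * P))
        with (p * X (- s) + (1 - r) * Z (- s) - (Z (- s) - (2 * P - 1))) by ring. apply Rabs_le; lra. }
  set (c' := 3 * c + 3 * g) in *.
  set (ar := fun s => a (- s)). set (zr := fun s => Copp (Cconj (z (- s)))).
  assert (Flr : forall s, dephasing_flow g (fun _ => 0) eps ar zr s) by (intros s; apply dephasing_flow_reflect, Fl).
  assert (Mz : forall s, Cmod (zr s) = Cmod (z (- s))) by (intros s; unfold zr; now rewrite Cmod_opp, Cmod_conj).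
  set (K := slow_const g 0).
  assert (HK : 0 <= K).
  { apply (slow_const_pos g 0 (fun _ => 0) Hg). intros; rewrite Rabs_R0; lra. }
  (* Every starting time [-T] is admissible for the same solution; its mismatch there is of order
     [1 / T] and disappears when [T] tends to infinity at fixed [s]. *)
  assert (Sl : forall s T, Rmax s1 (- s) <= T -> 0 < T ->
     Cmod (Cminus (zr s) (Cmult (RtoC eps) (kap0 g s))) <= K * (eps ^ 2 * kw g s) + K * (1 + eps) * (2 * c' + (eps + eps ^ 2) / g ^ 2) / T /\
     Cmod (zr s) <= K * eps + K * (1 + eps) * (2 * c' + (eps + eps ^ 2) / g ^ 2) / T).
  { intros s T HT HT0. assert (HT1 : s1 <= T) by (eapply Rle_trans; [apply Rmax_l | exact HT]).
    assert (HT2 : - s <= T) by (eapply Rle_trans; [apply Rmax_r | exact HT]).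
    destruct (slow_manifold_bound g 0 (fun _ => 0) (fun _ => 0) (fun _ => 0) Hg) with (eps := eps) (s0 := - T)
      (a := ar) (z := zr) (sg := 1) (s := s) as [B1 B2]; auto.
    - intros; lra.
    - intros; rewrite Rabs_R0; lra.
    - intros; rewrite Rabs_R0; lra.
    - intros; apply is_derive_Rconst.
    - intros; apply is_derive_Rconst.
    - exact (rcont_derive _ _ _ (proj1 (Flr (- T)))).
    - exact (rcont_derive _ _ _ (proj1 (proj2 (Flr (- T))))).
    - exact (rcont_derive _ _ _ (proj2 (proj2 (Flr (- T))))).
    - intros u _. apply (abs_Cmod_le_1 _ (z (- u))). unfold ar. rewrite Naz. lra.
    - intros u _. rewrite Mz. apply (abs_Cmod_le_1 (a (- u))). rewrite Naz. lra.
    - lra.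
    - rewrite Rmult_1_r in B1. fold (kap0 g s) in B1. fold K in B1, B2.
      rewrite (Mz (- T)) in B1, B2. unfold ar in B1, B2. rewrite Ropp_involutive, om_even in B1, B2.
      destruct (Asy T HT1) as [Q1 [Q2 _]].
      assert (Q3 : (eps + eps ^ 2) * / om g T ^ 3 <= (eps + eps ^ 2) / g ^ 2 / T).
      { unfold Rdiv. rewrite (Rmult_assoc (eps + eps ^ 2)). apply Rmult_le_compat_l; [nra|].
        rewrite <- Rinv_mult. pose proof (om_ge_g g Hg T). pose proof (om_bounds g T).
        apply Rinv_le_contravar; [apply Rmult_lt_0_compat; nra|].
        replace (om g T ^ 3) with (om g T ^ 2 * om g T) by ring.
        apply Rmult_le_compat; try nra. }
      set (zt := Cmod (z T) + Rabs (a T - 1) + (eps + eps ^ 2) * / om g T ^ 3) in *.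
      assert (Hzt : zt <= (2 * c' + (eps + eps ^ 2) / g ^ 2) / T).
      { replace ((2 * c' + (eps + eps ^ 2) / g ^ 2) / T) with (c' / T + c' / T + (eps + eps ^ 2) / g ^ 2 / T) by (field; lra).
        unfold zt. lra. }
      assert (Hzt0 : 0 <= zt).
      { unfold zt. pose proof (Cmod_ge_0 (z T)). pose proof (Rabs_pos (a T - 1)).
        assert (0 <= (eps + eps ^ 2) * / om g T ^ 3).
        { apply Rmult_le_pos; [nra|]. left. apply Rinv_0_lt_compat, pow_lt, om_pos, Hg. } lra. }
      replace (K * (1 + eps) * (2 * c' + (eps + eps ^ 2) / g ^ 2) / T)
        with (K * ((1 + eps) * ((2 * c' + (eps + eps ^ 2) / g ^ 2) / T))) by (unfold Rdiv; ring).
      set (w := (2 * c' + (eps + eps ^ 2) / g ^ 2) / T) in *.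
      assert (W : (1 + eps) * zt <= (1 + eps) * w) by (apply Rmult_le_compat_l; lra).
      assert (W2 : zt <= (1 + eps) * w) by nra.
      split.
      + eapply Rle_trans; [exact B1|]. rewrite <- Rmult_plus_distr_l. apply Rmult_le_compat_l; [exact HK | lra].
      + eapply Rle_trans; [exact B2|]. rewrite <- Rmult_plus_distr_l. apply Rmult_le_compat_l; [exact HK | lra]. }
  exists a, z. split; [exact Fl|]. split; [exact Naz|]. split; [|split].
  - intros s.
    replace (Cmod (Cminus (z s) (Cmult (RtoC eps) (kap0 g s)))) with (Cmod (Cminus (zr (- s)) (Cmult (RtoC eps) (kap0 g (- s))))).
    + eapply le_of_rate. intros T HT HT0. exact (proj1 (Sl (- s) T HT HT0)).
    (* [kap0] is purely imaginary and even in [s], hence fixed by the reflection. *)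
    + rewrite <- Cmod_conj, <- Cmod_opp. f_equal. unfold zr, kap0, kap, chi. rewrite Ropp_involutive, om_even.
      destruct (z s) as [z1 z2]. apply injective_projections; simpl; field; pose proof (om_pos g Hg s); lra.
  - intros s. replace (z s) with (z (- - s)) by now rewrite Ropp_involutive. rewrite <- Mz.
    eapply le_of_rate. intros T HT HT0. exact (proj2 (Sl (- s) T HT HT0)).
  - exists c', s1. split; [exact Hs1 | exact Asy].
Qed.

(** * Density matrices *)

(** Real parts of the traces against the Pauli matrices and the identity. No Hermiticity is built
    in: the imaginary parts are the same functionals evaluated at [- i r]. *)
Definition bx (r : M2) : R := fst (m12 r) + fst (m21 r).
Definition by_ (r : M2) : R := snd (m21 r) - snd (m12 r).
Definition bz (r : M2) : R := fst (m11 r) - fst (m22 r).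
Definition bt (r : M2) : R := fst (m11 r) + fst (m22 r).

Lemma is_derive_fst {U V : NormedModule R_AbsRing} (f : R -> U * V) (s : R) (l : U * V) :
  is_derive (V := prod_NormedModule R_AbsRing U V) f s l -> is_derive (fun t => fst (f t)) s (fst l).
Proof.
  intros H. unfold is_derive in *.
  apply (filterdiff_comp' f fst s (fun y => scal y l) fst H).
  apply filterdiff_linear, is_linear_fst.
Qed.

Lemma is_derive_snd {U V : NormedModule R_AbsRing} (f : R -> U * V) (s : R) (l : U * V) :
  is_derive (V := prod_NormedModule R_AbsRing U V) f s l -> is_derive (fun t => snd (f t)) s (snd l).
Proof.
  intros H. unfold is_derive in *.
  apply (filterdiff_comp' f snd s (fun y => scal y l) snd H).
  apply filterdiff_linear, is_linear_snd.
Qed.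

Lemma is_derive_entries (f : R -> M2) (s : R) (l : M2) : is_derive f s l ->
  is_cderive (fun t => m11 (f t)) s (m11 l) /\ is_cderive (fun t => m12 (f t)) s (m12 l) /\
  is_cderive (fun t => m21 (f t)) s (m21 l) /\ is_cderive (fun t => m22 (f t)) s (m22 l).
Proof.
  intros H.
  assert (H1 := is_derive_fst _ _ _ H). assert (H2 := is_derive_snd _ _ _ H).
  assert (H11 := is_derive_fst _ _ _ H1). assert (H12 := is_derive_snd _ _ _ H1).
  assert (H21 := is_derive_fst _ _ _ H2). assert (H22 := is_derive_snd _ _ _ H2).
  split; [|split; [|split]]; split.
  - exact (is_derive_fst _ _ _ H11).
  - exact (is_derive_snd _ _ _ H11).
  - exact (is_derive_fst _ _ _ H12).
  - exact (is_derive_snd _ _ _ H12).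
  - exact (is_derive_fst _ _ _ H21).
  - exact (is_derive_snd _ _ _ H21).
  - exact (is_derive_fst _ _ _ H22).
  - exact (is_derive_snd _ _ _ H22).
Qed.

Lemma filterlim_entries (f : R -> M2) (a : R) (p : M2 -> R) :
  filterlim f (at_right a) (locally (f a)) ->
  (forall x y e, ball x e y -> ball (p x) e (p y)) -> rcont (fun s => p (f s)) a.
Proof.
  intros H Hp P [e HP]. apply (H (fun y => P (p y))). exists e. intros y Hy. apply HP, Hp, Hy.
Qed.

Lemma en_om (g s : R) : en g s = om g s / 2.
Proof. reflexivity. Qed.

Lemma sqrtH_entries (g s : R) : 0 < g -> exists q, q ^ 2 = / (2 * om g s) /\
  sqrtH g s = mk2 (RtoC (q * s)) (RtoC (q * g)) (RtoC (q * g)) (RtoC (- q * s)).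
Proof.
  intros Hg. pose proof (om_pos g Hg s) as Ho.
  exists (sqrt (om g s / 2) / om g s). split.
  - unfold Rdiv at 1. rewrite Rpow_mult_distr, pow2_sqrt by lra. field. lra.
  - unfold sqrtH, Eproj_plus, Eproj_minus, Ham. rewrite en_om. generalize (sqrt (om g s / 2)). intros q.
    unfold Mscal, Msub, Madd, Defs.Mopp, Mid, mk2, m11, m12, m21, m22. cbn [fst snd].
    repeat (apply injective_projections); simpl; field; lra.
Qed.

(** A commutator with a Hermitian matrix exchanges Hermitian and anti-Hermitian parts. This factor
    [- i] switches back, and applying it twice gives a sign. *)
Definition mi (r : M2) : M2 := Mscal (Copp Ci) r.

Lemma bloch_mi_mi (r : M2) :
  bx (mi (mi r)) = - bx r /\ by_ (mi (mi r)) = - by_ r /\ bz (mi (mi r)) = - bz r /\ bt (mi (mi r)) = - bt r.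
Proof.
  destruct r as [[[r1 r2] [r3 r4]] [[r5 r6] [r7 r8]]].
  unfold mi, bx, by_, bz, bt, Mscal, mk2, m11, m12, m21, m22. simpl. repeat split; ring.
Qed.

Lemma bloch_lin (c : R) (r r' : M2) :
  bx (Madd r (Mscal (RtoC c) r')) = bx r + c * bx r' /\ by_ (Madd r (Mscal (RtoC c) r')) = by_ r + c * by_ r' /\
  bz (Madd r (Mscal (RtoC c) r')) = bz r + c * bz r' /\ bt (Madd r (Mscal (RtoC c) r')) = bt r + c * bt r'.
Proof.
  destruct r as [[[r1 r2] [r3 r4]] [[r5 r6] [r7 r8]]], r' as [[[t1 t2] [t3 t4]] [[t5 t6] [t7 t8]]].
  unfold bx, by_, bz, bt, Madd, Mscal, mk2, m11, m12, m21, m22. simpl. repeat split; ring.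
Qed.

Lemma bloch_scal (c : R) (r : M2) :
  bx (Mscal (RtoC c) r) = c * bx r /\ by_ (Mscal (RtoC c) r) = c * by_ r /\
  bz (Mscal (RtoC c) r) = c * bz r /\ bt (Mscal (RtoC c) r) = c * bt r.
Proof.
  destruct r as [[[r1 r2] [r3 r4]] [[r5 r6] [r7 r8]]].
  unfold bx, by_, bz, bt, Mscal, mk2, m11, m12, m21, m22. simpl. repeat split; ring.
Qed.

Definition zx_matrix (p q : R) : M2 := mk2 (RtoC p) (RtoC q) (RtoC q) (RtoC (- p)).

(** In Bloch coordinates [- i] times the commutator is the cross product with [2 (q, 0, p)]; the
    coordinates of [- i r] appear because the factor [- i] is missing on the left. *)
Lemma bloch_comm (p q : R) (r : M2) :
  bx (Mcomm (zx_matrix p q) r) = 2 * p * by_ (mi r) /\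
  by_ (Mcomm (zx_matrix p q) r) = - 2 * (p * bx (mi r) - q * bz (mi r)) /\
  bz (Mcomm (zx_matrix p q) r) = - 2 * q * by_ (mi r) /\
  bt (Mcomm (zx_matrix p q) r) = 0.
Proof.
  destruct r as [[[r1 r2] [r3 r4]] [[r5 r6] [r7 r8]]].
  unfold mi, zx_matrix, bx, by_, bz, bt, Mcomm, Msub, Defs.Mopp, Madd, Mmul, Mscal, mk2, m11, m12, m21, m22. simpl.
  repeat split; ring.
Qed.

Lemma Mscal_comm (c : C) (A r : M2) : Mscal c (Mcomm A r) = Mcomm A (Mscal c r).
Proof.
  unfold Mcomm, Msub, Defs.Mopp, Madd, Mmul, Mscal, mk2, m11, m12, m21, m22. cbn [fst snd].
  apply injective_projections; apply injective_projections; cbn [fst snd]; ring.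
Qed.

Lemma Mscal_add (c : C) (r r' : M2) : Mscal c (Madd r r') = Madd (Mscal c r) (Mscal c r').
Proof.
  unfold Madd, Mscal, mk2, m11, m12, m21, m22. cbn [fst snd]. apply injective_projections; apply injective_projections; cbn [fst snd]; ring.
Qed.

Lemma Mscal_swap (c d : C) (r : M2) : Mscal c (Mscal d r) = Mscal d (Mscal c r).
Proof.
  unfold Mscal, mk2, m11, m12, m21, m22. cbn [fst snd]. apply injective_projections; apply injective_projections; cbn [fst snd]; ring.
Qed.

(** The Hamiltonian rotates about [(g, 0, s)]. The double commutator is a double cross product along
    the same axis, hence a multiple of the transverse part; with [q^2 = 1 / (2 om)] its rate becomes
    [gam om], proportional to the rotation frequency, which is why [i - gam] factors out. *)
Lemma lind_bloch (g : R) (gam : R -> R) (eps s : R) (r : M2) : 0 < g -> 0 < eps ->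
  let a := (g * bx r + s * bz r) / om g s in
  let L := Mscal (RtoC (/ eps)) (Lind g gam s r) in
  bx L = (- s * by_ r - gam s * (om g s * bx r - g * a)) / eps /\
  by_ L = (s * bx r - g * bz r - gam s * om g s * by_ r) / eps /\
  bz L = (g * by_ r - gam s * (om g s * bz r - s * a)) / eps /\
  bt L = 0.
Proof.
  intros Hg He a L. destruct (sqrtH_entries g s Hg) as [q [Eq E]].
  pose proof (om_pos g Hg s) as Ho. pose proof (om_sqr g s) as Hq.
  assert (X : om g s = 2 * q ^ 2 * (s ^ 2 + g ^ 2)) by (rewrite Eq, <- Hq; field; lra).
  assert (Ea : a = 2 * q ^ 2 * (g * bx r + s * bz r)) by (unfold a; rewrite Eq; field; lra).
  assert (EH : Ham g s = zx_matrix (s / 2) (g / 2)).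
  { unfold Ham, zx_matrix. do 2 f_equal. f_equal. field. }
  assert (ES : sqrtH g s = zx_matrix (q * s) (q * g)).
  { rewrite E. unfold zx_matrix. do 2 f_equal. f_equal. ring. }
  destruct (bloch_scal (/ eps) (Lind g gam s r)) as [B1 [B2 [B3 B4]]]. fold L in B1, B2, B3, B4.
  unfold Lind in B1, B2, B3, B4. rewrite EH, ES in B1, B2, B3, B4.
  destruct (bloch_lin (- gam s / 2) (Mscal (Copp Ci) (Mcomm (zx_matrix (s / 2) (g / 2)) r))
    (Mcomm (zx_matrix (q * s) (q * g)) (Mcomm (zx_matrix (q * s) (q * g)) r))) as [C1 [C2 [C3 C4]]].
  rewrite C1 in B1. rewrite C2 in B2. rewrite C3 in B3. rewrite C4 in B4.
  rewrite Mscal_comm in B1, B2, B3, B4. fold (mi r) in B1, B2, B3, B4.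
  destruct (bloch_comm (s / 2) (g / 2) (mi r)) as [D1 [D2 [D3 D4]]].
  destruct (bloch_comm (q * s) (q * g) (Mcomm (zx_matrix (q * s) (q * g)) r)) as [F1 [F2 [F3 F4]]].
  destruct (bloch_comm (q * s) (q * g) (mi r)) as [G1 [G2 [G3 G4]]].
  destruct (bloch_mi_mi r) as [N1 [N2 [N3 _]]].
  assert (Emi : forall A, mi (Mcomm A r) = Mcomm A (mi r)) by (intros; apply Mscal_comm).
  rewrite !Emi in F1, F2, F3.
  rewrite D1, F1, G2, N1, N2, N3 in B1. rewrite D2, F2, G1, G3, N1, N2, N3 in B2.
  rewrite D3, F3, G2, N1, N2, N3 in B3. rewrite D4, F4 in B4.
  rewrite B1, B2, B3, B4, Ea, X.
  repeat split; field; lra.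
Qed.

Lemma transition_entries (g s : R) (r : M2) : 0 < g ->
  Mtr (Mmul (Eproj_plus g s) r) =
  ((bt r + (g * bx r + s * bz r) / om g s) / 2,
   (bt (Mscal (Copp Ci) r) + (g * bx (Mscal (Copp Ci) r) + s * bz (Mscal (Copp Ci) r)) / om g s) / 2).
Proof.
  intros Hg. pose proof (om_pos g Hg s) as Ho.
  unfold Eproj_plus, Ham. rewrite en_om.
  destruct r as [[[r1 r2] [r3 r4]] [[r5 r6] [r7 r8]]].
  unfold Mtr, bx, bz, bt, Madd, Mmul, Mscal, Mid, mk2, m11, m12, m21, m22.
  apply injective_projections; simpl; field; lra.
Qed.

Lemma lower_state_bloch (g s : R) : 0 < g ->
  let r := Eproj_minus g s in let r' := Mscal (Copp Ci) r in
  bx r = - g / om g s /\ by_ r = 0 /\ bz r = - s / om g s /\ bt r = 1 /\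
  bx r' = 0 /\ by_ r' = 0 /\ bz r' = 0 /\ bt r' = 0.
Proof.
  intros Hg r r'. pose proof (om_pos g Hg s) as Ho.
  unfold r', r, Eproj_minus, Ham. rewrite en_om.
  unfold bx, by_, bz, bt, Msub, Defs.Mopp, Madd, Mscal, Mid, mk2, m11, m12, m21, m22. simpl.
  repeat split; field; lra.
Qed.

Lemma Lind_scal (g : R) (gam : R -> R) (s : R) (c d : C) (r : M2) :
  Mscal c (Mscal d (Lind g gam s r)) = Mscal d (Lind g gam s (Mscal c r)).
Proof.
  rewrite Mscal_swap. f_equal. unfold Lind.
  rewrite Mscal_add, (Mscal_swap c (Copp Ci)), (Mscal_swap c (RtoC _)), !Mscal_comm. reflexivity.
Qed.

Section Propagator.

Variables (g eps : R) (gam : R -> R) (U : R -> R -> M2 -> M2).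
Hypothesis g_pos : 0 < g.
Hypothesis eps_pos : 0 < eps.
Hypothesis prop : is_propagator g gam eps U.

Lemma propagator_bloch (s0 s : R) (c : C) (r : M2) : s0 < s ->
  let f t := Mscal c (U t s0 r) in
  bloch_eq g gam eps (fun t => bx (f t)) (fun t => by_ (f t)) (fun t => bz (f t)) s /\
  is_derive (fun t => bt (f t)) s 0.
Proof.
  intros Hs f. destruct prop as [_ [_ HD]]. specialize (HD s0 s r Hs).
  apply is_derive_entries in HD. destruct HD as [D1 [D2 [D3 D4]]].
  apply (is_cderive_scal c) in D1. apply (is_cderive_scal c) in D2.
  apply (is_cderive_scal c) in D3. apply (is_cderive_scal c) in D4.
  set (L := Mscal (RtoC (/ eps)) (Lind g gam s (U s s0 r))) in *.
  destruct (lind_bloch g gam eps s (f s) g_pos eps_pos) as [Ex [Ey [Ez Et]]].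
  unfold f in Ex, Ey, Ez, Et. rewrite <- Lind_scal in Ex, Ey, Ez, Et. fold L in Ex, Ey, Ez, Et. fold (f s) in Ex, Ey, Ez.
  split; [split; [|split]|].
  - unfold bloch_a. rewrite <- Ex. exact (is_derive_Rplus _ _ _ _ _ (proj1 D2) (proj1 D3)).
  - rewrite <- Ey. exact (is_derive_Rminus _ _ _ _ _ (proj2 D3) (proj2 D2)).
  - unfold bloch_a. rewrite <- Ez. exact (is_derive_Rminus _ _ _ _ _ (proj1 D1) (proj1 D4)).
  - rewrite <- Et. exact (is_derive_Rplus _ _ _ _ _ (proj1 D1) (proj1 D4)).
Qed.

Lemma propagator_rcont (s0 : R) (c : C) (r : M2) :
  let f t := Mscal c (U t s0 r) in
  rcont (fun t => bx (f t)) s0 /\ rcont (fun t => by_ (f t)) s0 /\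
  rcont (fun t => bz (f t)) s0 /\ rcont (fun t => bt (f t)) s0.
Proof.
  intros f. destruct prop as [H0 [HC _]]. specialize (HC s0 r).
  assert (HC' : filterlim (fun s => U s s0 r) (at_right s0) (locally (U s0 s0 r))) by (rewrite H0; exact HC).
  assert (R : forall p : M2 -> R, (forall x y e, ball x e y -> ball (p x) e (p y)) -> rcont (fun s => p (U s s0 r)) s0).
  { intros p Hp. exact (filterlim_entries (fun s => U s s0 r) s0 p HC' Hp). }
  assert (r1 := R (fun x => fst (m11 x)) ltac:(intros x y e [[[h _] _] _]; exact h)).
  assert (r2 := R (fun x => snd (m11 x)) ltac:(intros x y e [[[_ h] _] _]; exact h)).
  assert (r3 := R (fun x => fst (m12 x)) ltac:(intros x y e [[_ [h _]] _]; exact h)).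
  assert (r4 := R (fun x => snd (m12 x)) ltac:(intros x y e [[_ [_ h]] _]; exact h)).
  assert (r5 := R (fun x => fst (m21 x)) ltac:(intros x y e [_ [[h _] _]]; exact h)).
  assert (r6 := R (fun x => snd (m21 x)) ltac:(intros x y e [_ [[_ h] _]]; exact h)).
  assert (r7 := R (fun x => fst (m22 x)) ltac:(intros x y e [_ [_ [h _]]]; exact h)).
  assert (r8 := R (fun x => snd (m22 x)) ltac:(intros x y e [_ [_ [_ h]]]; exact h)).
  destruct c as [c1 c2].
  assert (lin : forall p q, rcont p s0 -> rcont q s0 -> rcont (fun s => c1 * p s + - (c2 * q s)) s0).
  { intros p q Hp Hq. apply rcont_plus; [apply rcont_mult; [apply rcont_const | exact Hp]|].
    apply rcont_opp, rcont_mult; [apply rcont_const | exact Hq]. }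
  assert (lin' : forall p q, rcont p s0 -> rcont q s0 -> rcont (fun s => c1 * q s + c2 * p s) s0).
  { intros p q Hp Hq. apply rcont_plus; (apply rcont_mult; [apply rcont_const | assumption]). }
  split; [|split; [|split]].
  - exact (rcont_plus _ _ _ (lin _ _ r3 r4) (lin _ _ r5 r6)).
  - exact (rcont_plus _ _ _ (lin' _ _ r5 r6) (rcont_opp _ _ (lin' _ _ r3 r4))).
  - exact (rcont_plus _ _ _ (lin _ _ r1 r2) (rcont_opp _ _ (lin _ _ r7 r8))).
  - exact (rcont_plus _ _ _ (lin _ _ r1 r2) (lin _ _ r7 r8)).
Qed.

End Propagator.

(** * Trajectories of the dephasing flow *)

Record trajectory (g : R) (gam : R -> R) (eps s0 : R) (a : R -> R) (z : R -> C) : Prop := {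
  traj_flow : forall s, s0 < s -> dephasing_flow g gam eps a z s;
  traj_rc_a : rcont a s0;
  traj_rc_z1 : rcont (fun s => fst (z s)) s0;
  traj_rc_z2 : rcont (fun s => snd (z s)) s0 }.

Lemma trajectory_contract (g : R) (gam : R -> R) (eps s0 : R) (a : R -> R) (z : R -> C) (s : R) :
  0 < g -> 0 < eps -> (forall s, 0 <= gam s) -> trajectory g gam eps s0 a z -> s0 <= s ->
  a s ^ 2 + Cmod (z s) ^ 2 <= a s0 ^ 2 + Cmod (z s0) ^ 2.
Proof.
  intros Hg He Hgam [Fl Ra R1 R2] Hs. rewrite !Cmod2_components.
  apply (nonincreasing_rcont (fun s => a s ^ 2 + (fst (z s) ^ 2 + snd (z s) ^ 2))
    (fun s => - 2 * (om g s / eps * gam s * (fst (z s) ^ 2 + snd (z s) ^ 2))) s0 s Hs).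
  - apply (rcont_ext (fun s => a s * a s + (fst (z s) * fst (z s) + snd (z s) * snd (z s)))); [intros; ring|].
    apply rcont_plus; [|apply rcont_plus]; apply rcont_mult; assumption.
  - intros u Hu. destruct (Fl u (proj1 Hu)) as [Da [D1 D2]].
    apply (is_derive_Rext (fun s => a s * a s + (fst (z s) * fst (z s) + snd (z s) * snd (z s)))); [intros; ring|].
    eapply is_derive_val.
    + exact (is_derive_Rplus _ _ _ _ _ (is_derive_Rmult _ _ _ _ _ Da Da)
        (is_derive_Rplus _ _ _ _ _ (is_derive_Rmult _ _ _ _ _ D1 D1) (is_derive_Rmult _ _ _ _ _ D2 D2))).
    + cbv beta. simpl. ring.
  - intros u Hu.
    assert (0 <= om g u / eps * gam u * (fst (z u) ^ 2 + snd (z u) ^ 2)).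
    { apply Rmult_le_pos; [apply Rmult_le_pos; [|apply Hgam]|].
      - left. apply Rdiv_lt_0_compat; [apply om_pos, Hg | exact He].
      - pose proof (pow2_ge_0 (fst (z u))). pose proof (pow2_ge_0 (snd (z u))). lra. }
    lra.
Qed.

Lemma trajectory_minus (g : R) (gam : R -> R) (eps s0 : R) (a a' : R -> R) (z z' : R -> C) :
  trajectory g gam eps s0 a z -> trajectory g gam eps s0 a' z' ->
  trajectory g gam eps s0 (fun s => a s - a' s) (fun s => Cminus (z s) (z' s)).
Proof.
  intros [Fl Ra R1 R2] [Fl' Ra' R1' R2']. split.
  - intros s Hs. destruct (Fl s Hs) as [Da Dz], (Fl' s Hs) as [Da' Dz']. split.
    + eapply is_derive_val; [exact (is_derive_Rminus _ _ _ _ _ Da Da') | simpl; ring].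
    + eapply is_cderive_val; [exact (is_cderive_minus _ _ _ _ _ Dz Dz')|].
      rewrite !RtoC_mult, RtoC_minus. ring.
  - exact (rcont_plus _ _ _ Ra (rcont_opp _ _ Ra')).
  - exact (rcont_plus _ _ _ R1 (rcont_opp _ _ R1')).
  - exact (rcont_plus _ _ _ R2 (rcont_opp _ _ R2')).
Qed.

Lemma trajectory_later (g : R) (gam : R -> R) (eps s0 s1 : R) (a : R -> R) (z : R -> C) :
  s0 < s1 -> trajectory g gam eps s0 a z -> trajectory g gam eps s1 a z.
Proof.
  intros Hs [Fl _ _ _]. destruct (Fl s1 Hs) as [Da [D1 D2]]. split.
  - intros s Hs'. apply Fl. lra.
  - exact (rcont_derive _ _ _ Da).
  - exact (rcont_derive _ _ _ D1).
  - exact (rcont_derive _ _ _ D2).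
Qed.

Lemma trajectory_bloch (g : R) (gam : R -> R) (eps s0 : R) (X Y Z : R -> R) : 0 < g -> 0 < eps ->
  (forall s, s0 < s -> bloch_eq g gam eps X Y Z s) -> rcont X s0 -> rcont Y s0 -> rcont Z s0 ->
  trajectory g gam eps s0 (bloch_a g X Z) (bloch_z g X Y Z).
Proof.
  intros Hg He Hb RX RY RZ.
  assert (Ri : rcont (fun s => / om g s) s0).
  { apply (rcont_ext (fun s => / om g s ^ 1)); [intros; now rewrite pow_1|].
    exact (rcont_derive _ _ _ (is_derive_inv_om_pow g Hg 1 s0)). }
  assert (Rid : rcont (fun s => s) s0) by exact (rcont_derive _ _ _ (is_derive_id s0)).
  split.
  - intros s Hs. apply bloch_eq_flow; auto.
  - exact (rcont_mult _ _ _ (rcont_plus _ _ _ (rcont_mult _ _ _ (rcont_const g s0) RX) (rcont_mult _ _ _ Rid RZ)) Ri).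
  - exact (rcont_mult _ _ _ (rcont_plus _ _ _ (rcont_mult _ _ _ Rid RX) (rcont_opp _ _ (rcont_mult _ _ _ (rcont_const g s0) RZ))) Ri).
  - exact RY.
Qed.

Lemma constant_rcont (f : R -> R) (a b : R) : a <= b -> rcont f a ->
  (forall s, a < s <= b -> is_derive f s 0) -> f b = f a.
Proof.
  intros Hab Hr Hd. apply Rle_antisym.
  - apply (nonincreasing_rcont f (fun _ => 0)); auto. intros; lra.
  - apply Ropp_le_cancel. apply (nonincreasing_rcont (fun s => - f s) (fun _ => - 0)); auto.
    + now apply rcont_opp.
    + intros s Hs. apply is_derive_Ropp. auto.
    + intros; lra.
Qed.

(* The factor [1] lets [propagator_bloch] treat the Hermitian and anti-Hermitian parts alike. *)
Definition prop_state (g : R) (U : R -> R -> M2 -> M2) (T t : R) : M2 :=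
  Mscal (RtoC 1) (U t (- T) (Eproj_minus g (- T))).

Definition traj_a (g : R) (U : R -> R -> M2 -> M2) (T : R) : R -> R :=
  bloch_a g (fun t => bx (prop_state g U T t)) (fun t => bz (prop_state g U T t)).

Definition traj_z (g : R) (U : R -> R -> M2 -> M2) (T : R) : R -> C :=
  bloch_z g (fun t => bx (prop_state g U T t)) (fun t => by_ (prop_state g U T t)) (fun t => bz (prop_state g U T t)).

Lemma propagator_trajectory (g eps : R) (gam : R -> R) (U : R -> R -> M2 -> M2) (T : R) :
  0 < g -> 0 < eps -> (forall s, 0 <= gam s) -> is_propagator g gam eps U ->
  trajectory g gam eps (- T) (traj_a g U T) (traj_z g U T) /\
  traj_a g U T (- T) = -1 /\ traj_z g U T (- T) = RtoC 0 /\
  forall s, - T <= s ->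
    Mtr (Mmul (Eproj_plus g s) (U s (- T) (Eproj_minus g (- T)))) = RtoC ((1 + traj_a g U T s) / 2).
Proof.
  intros Hg He Hgam Hp. set (r0 := Eproj_minus g (- T)).
  unfold traj_a, traj_z. set (f := prop_state g U T).
  set (fi := fun t => Mscal (Copp Ci) (U t (- T) r0)).
  assert (M1 : forall r, Mscal (RtoC 1) r = r).
  { intros [[r1 r2] [r3 r4]]. unfold Mscal, mk2, m11, m12, m21, m22. cbn [fst snd].
    apply injective_projections; apply injective_projections; cbn [fst snd]; ring. }
  assert (Hf : forall t, f t = U t (- T) r0) by (intros; apply M1).
  destruct (propagator_rcont g eps gam U Hp (- T) (RtoC 1) r0) as [X1 [Y1 [Z1 T1]]].
  destruct (propagator_rcont g eps gam U Hp (- T) (Copp Ci) r0) as [X2 [Y2 [Z2 T2]]].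
  change (fun t => Mscal (RtoC 1) (U t (- T) r0)) with f in X1, Y1, Z1, T1.
  fold fi in X2, Y2, Z2, T2.
  assert (Tr1 : trajectory g gam eps (- T) (bloch_a g (fun t => bx (f t)) (fun t => bz (f t)))
     (bloch_z g (fun t => bx (f t)) (fun t => by_ (f t)) (fun t => bz (f t)))).
  { apply trajectory_bloch; auto. intros s Hs. exact (proj1 (propagator_bloch g eps gam U Hg He Hp (- T) s (RtoC 1) r0 Hs)). }
  assert (Tr2 : trajectory g gam eps (- T) (bloch_a g (fun t => bx (fi t)) (fun t => bz (fi t)))
     (bloch_z g (fun t => bx (fi t)) (fun t => by_ (fi t)) (fun t => bz (fi t)))).
  { apply trajectory_bloch; auto. intros s Hs. exact (proj1 (propagator_bloch g eps gam U Hg He Hp (- T) s (Copp Ci) r0 Hs)). }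
  destruct (lower_state_bloch g (- T) Hg) as [e1 [e2 [e3 [e4 [e5 [e6 [e7 e8]]]]]]]. fold r0 in e1, e2, e3, e4, e5, e6, e7, e8.
  assert (If : f (- T) = r0) by (rewrite Hf; apply Hp).
  assert (Ifi : fi (- T) = Mscal (Copp Ci) r0) by (unfold fi; f_equal; apply Hp).
  pose proof (om_pos g Hg (- T)) as Ho. pose proof (om_sqr g (- T)) as Hq.
  split; [exact Tr1|]. split; [|split].
  - unfold bloch_a. rewrite If, e1, e3.
    transitivity (- (((- T) ^ 2 + g ^ 2) / om g (- T) ^ 2)); [field; lra|]. rewrite <- Hq. field. lra.
  - unfold bloch_z. rewrite If, e1, e2, e3. unfold RtoC. f_equal. field. lra.
  - intros s Hs. rewrite transition_entries by exact Hg. fold (fi s). rewrite <- Hf.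
    assert (Bt : bt (f s) = 1).
    { rewrite <- e4, <- If. apply (constant_rcont (fun t => bt (f t))); auto.
      intros u Hu. exact (proj2 (propagator_bloch g eps gam U Hg He Hp (- T) u (RtoC 1) r0 (proj1 Hu))). }
    assert (Bti : bt (fi s) = 0).
    { rewrite <- e8, <- Ifi. apply (constant_rcont (fun t => bt (fi t))); auto.
      intros u Hu. exact (proj2 (propagator_bloch g eps gam U Hg He Hp (- T) u (Copp Ci) r0 (proj1 Hu))). }
    assert (Ct := trajectory_contract g gam eps (- T) _ _ s Hg He Hgam Tr2 Hs).
    set (ai := bloch_a g (fun t => bx (fi t)) (fun t => bz (fi t))) in *.
    (* The anti-Hermitian part follows the same flow from zero initial data, and contraction keeps
       it zero; hence the trace is real. *)
    assert (Ei : ai s = 0).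
    { assert (ai (- T) = 0) by (unfold ai, bloch_a; rewrite Ifi, e5, e7; field; lra).
      assert (Zi : bloch_z g (fun t => bx (fi t)) (fun t => by_ (fi t)) (fun t => bz (fi t)) (- T) = RtoC 0).
      { unfold bloch_z. rewrite Ifi, e5, e6, e7. unfold RtoC. f_equal. field. lra. }
      rewrite Zi, Cmod_0, H in Ct.
      pose proof (pow2_ge_0 (Cmod (bloch_z g (fun t => bx (fi t)) (fun t => by_ (fi t)) (fun t => bz (fi t)) s))).
      assert (ai s ^ 2 = 0) by (pose proof (pow2_ge_0 (ai s)); lra).
      rewrite <- Rsqr_pow2 in H1. now apply Rsqr_0_uniq. }
    unfold ai, bloch_a in Ei. rewrite Hf. fold (fi s). rewrite Ei, Bti, <- Hf, Bt. unfold RtoC, bloch_a. f_equal. field.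
Qed.

(** * Existence of the limiting transition probability *)

Lemma atan_le_id (y : R) : 0 <= y -> atan y <= y.
Proof.
  intros Hy. destruct (MVT_point atan (fun x => / (1 + x ^ 2)) 0 y) as [c [_ E]].
  - intros t _. eapply is_derive_val; [apply is_derive_Reals, derivable_pt_lim_atan|]. unfold Rsqr. simpl.
    field. nra.
  - rewrite atan_0 in E. assert (/ (1 + c ^ 2) <= 1).
    { rewrite <- Rinv_1 at 2. apply Rinv_le_contravar; nra. }
    nra.
Qed.

Lemma atan_tail (g T : R) : 0 < g -> 0 < T -> PI / 2 - atan (T / g) <= g / T.
Proof.
  intros Hg HT. assert (0 < T / g) by now apply Rdiv_lt_0_compat.
  replace (PI / 2 - atan (T / g)) with (atan (/ (T / g))) by (rewrite atan_inv; auto).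
  eapply Rle_trans; [apply atan_le_id; left; now apply Rinv_0_lt_compat|]. right. field. lra.
Qed.

Section Bounded.

Variables (g eps : R) (gam : R -> R).
Hypothesis g_pos : 0 < g.
Hypothesis eps_pos : 0 < eps.
Hypothesis gam_nonneg : forall s, 0 <= gam s.

Lemma trajectory_bounded (s0 s : R) (a : R -> R) (z : R -> C) :
  trajectory g gam eps s0 a z -> a s0 = -1 -> z s0 = RtoC 0 -> s0 <= s ->
  a s ^ 2 + Cmod (z s) ^ 2 <= 1.
Proof.
  intros Tr Ea Ez Hs. pose proof (trajectory_contract g gam eps s0 a z s g_pos eps_pos gam_nonneg Tr Hs) as H.
  rewrite Ea, Ez, Cmod_0 in H. lra.
Qed.

Lemma trajectory_a_growth (s0 s : R) (a : R -> R) (z : R -> C) :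
  trajectory g gam eps s0 a z -> (forall u, s0 <= u -> Cmod (z u) <= 1) -> s0 <= s ->
  Rabs (a s - a s0) <= atan (s / g) - atan (s0 / g).
Proof.
  intros [Fl Ra _ _] HZ Hs. pose proof (flow_a_growth g gam eps s0 s 1 a z g_pos Fl Ra HZ Hs). lra.
Qed.

Variables (A : R -> R -> R) (Zf : R -> R -> C).
Hypothesis traj : forall T, 0 < T ->
  trajectory g gam eps (- T) (A T) (Zf T) /\ A T (- T) = -1 /\ Zf T (- T) = RtoC 0.

Lemma family_bounded (T s : R) : 0 < T -> - T <= s -> A T s ^ 2 + Cmod (Zf T s) ^ 2 <= 1.
Proof. intros HT Hs. destruct (traj T HT) as [Tr [Ea Ez]]. now apply (trajectory_bounded (- T)). Qed.

(** The run started at [-T'] has moved [a] by at most [g / T] when it reaches [-T]. Being inside the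
    unit ball, it is then within squared distance [2 g / T] of the lower state; the flow is linear
    and contracting, so the distance persists. The last [g / T] is the motion of [a] after time
    [T]. *)
Lemma family_close (T T' : R) : 0 < T -> T <= T' ->
  Rabs (A T T - A T' T') <= sqrt (2 * (g / T)) + g / T.
Proof.
  intros HT HT'.
  destruct (Req_dec T T') as [<-|N].
  { rewrite Rminus_diag, Rabs_R0. pose proof (sqrt_pos (2 * (g / T))).
    assert (0 < g / T) by now apply Rdiv_lt_0_compat. lra. }
  destruct (traj T HT) as [Tr [Ea Ez]]. destruct (traj T' ltac:(lra)) as [Tr' [Ea' Ez']].
  assert (HZ' : forall u, - T' <= u -> Cmod (Zf T' u) <= 1).
  { intros u Hu. apply (abs_Cmod_le_1 (A T' u)). apply family_bounded; lra. }
  assert (B1 : Rabs (A T' (- T) - A T' (- T')) <= g / T).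
  { eapply Rle_trans; [apply (trajectory_a_growth _ _ _ _ Tr' HZ'); lra|].
    pose proof (atan_tail g T g_pos HT). pose proof (atan_bound (- T' / g)).
    replace (- T / g) with (- (T / g)) by (field; lra). rewrite atan_opp. lra. }
  assert (B2 : Rabs (A T' T' - A T' T) <= g / T).
  { eapply Rle_trans; [apply (trajectory_a_growth T T' _ (Zf T'))|].
    - apply (trajectory_later _ _ _ (- T')); [lra | exact Tr'].
    - intros u Hu. apply HZ'. lra.
    - lra.
    - pose proof (atan_tail g T g_pos HT). pose proof (atan_bound (T' / g)). lra. }
  assert (Tr2 : trajectory g gam eps (- T) (fun s => A T s - A T' s) (fun s => Cminus (Zf T s) (Zf T' s))).
  { apply trajectory_minus; [exact Tr|]. apply (trajectory_later _ _ _ (- T')); [lra | exact Tr']. }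
  assert (Ct := trajectory_contract g gam eps (- T) _ _ T g_pos eps_pos gam_nonneg Tr2 ltac:(lra)).
  cbv beta in Ct. rewrite Ea, Ez in Ct.
  replace (Cminus (RtoC 0) (Zf T' (- T))) with (Copp (Zf T' (- T))) in Ct by ring. rewrite Cmod_opp in Ct.
  assert (Nb := family_bounded T' (- T) ltac:(lra) ltac:(lra)).
  rewrite Ea' in B1. apply Rabs_le_between in B1.
  assert (Sq : (A T T - A T' T) ^ 2 <= 2 * (g / T)).
  { pose proof (pow2_ge_0 (Cmod (Cminus (Zf T T) (Zf T' T)))). nra. }
  assert (B3 : Rabs (A T T - A T' T) <= sqrt (2 * (g / T))).
  { rewrite <- sqrt_Rsqr_abs, Rsqr_pow2. now apply sqrt_le_1_alt. }
  replace (A T T - A T' T') with ((A T T - A T' T) + - (A T' T' - A T' T)) by ring.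
  eapply Rle_trans; [apply Rabs_triang|]. rewrite Rabs_Ropp. lra.
Qed.

Lemma filterlim_cauchy_rate (f rate : R -> R) :
  (forall T T', 0 < T -> T <= T' -> Rabs (f T - f T') <= rate T) ->
  (forall d, 0 < d -> exists T, 0 < T /\ rate T < d) ->
  exists l : R, filterlim f (Rbar_locally p_infty) (locally l).
Proof.
  intros H Hr. apply (filterlim_locally_cauchy (U := R_CompleteSpace)).
  intros e. destruct (Hr (e / 2)) as [T [HT Hd]]; [destruct e; simpl; lra|].
  exists (fun u => T < u). split; [exists T; auto|].
  intros u v Hu Hv. change (Rabs (f v - f u) < e).
  pose proof (H T u HT ltac:(lra)) as H1. pose proof (H T v HT ltac:(lra)) as H2.
  replace (f v - f u) with ((f T - f u) + - (f T - f v)) by ring.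
  eapply Rle_lt_trans; [apply Rabs_triang|]. rewrite Rabs_Ropp. lra.
Qed.

Lemma family_limit : exists l : R, filterlim (fun T => A T T) (Rbar_locally p_infty) (locally l).
Proof.
  apply (filterlim_cauchy_rate (fun T => A T T) (fun T => sqrt (2 * (g / T)) + g / T)).
  - intros T T' HT HT'. now apply family_close.
  - intros d Hd. set (e := Rmin 1 (d / 2)).
    assert (He : 0 < e <= 1) by (unfold e, Rmin; destruct Rle_dec; lra).
    assert (Hed : e <= d / 2) by apply Rmin_r.
    (* With this [T] one has [g / T = e^2 / 4], so the two summands of the rate are at most [e] and
       less than [e]. *)
    exists (4 * g / e ^ 2). assert (0 < 4 * g / e ^ 2) by (apply Rdiv_lt_0_compat; nra).
    split; [assumption|].
    replace (g / (4 * g / e ^ 2)) with (e ^ 2 / 4) by (field; lra).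
    assert (sqrt (2 * (e ^ 2 / 4)) <= e).
    { rewrite <- (sqrt_pow2 e) at 2 by lra. apply sqrt_le_1_alt. nra. }
    assert (e ^ 2 / 4 < e) by nra. lra.
Qed.

End Bounded.

(** * The leading term *)

(** Closed form of the integrand: the trace equals [g^2 / (4 om^4)] and the energy is [om / 2]. *)
Definition rate (g : R) (gam : R -> R) (s : R) : R :=
  g ^ 2 * gam s * / om g s ^ 5 / (2 * (1 + gam s ^ 2)).

Lemma MDerive_Eproj_plus (g s : R) : 0 < g ->
  MDerive (Eproj_plus g) s = zx_matrix (g ^ 2 * / om g s ^ 3 / 2) (- g * s * / om g s ^ 3 / 2).
Proof.
  intros Hg. pose proof (om_pos g Hg s) as Ho. pose proof (om_sqr g s) as Hq.
  assert (Di : is_derive (fun s => / om g s) s (- s * / om g s ^ 3)).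
  { apply (is_derive_Rext (fun s => / om g s ^ 1)); [intros; now rewrite pow_1|].
    eapply is_derive_val; [apply is_derive_inv_om_pow, Hg|]. simpl. field. lra. }
  assert (D1 : forall c d : R, is_derive (fun s => c * (s * / om g s) + d) s (c * (g ^ 2 * / om g s ^ 3))).
  { intros c d. eapply is_derive_val.
    - apply is_derive_Rplus; [apply is_derive_Rmult; [apply is_derive_Rconst|] | apply is_derive_Rconst].
      apply is_derive_Rmult; [exact (is_derive_id s) | exact Di].
    - change (@one R_AbsRing) with 1. replace (g ^ 2) with (om g s ^ 2 - s ^ 2) by lra. field. lra. }
  assert (D2 : is_derive (fun s => g / 2 * / om g s) s (- g * s * / om g s ^ 3 / 2)).
  { eapply is_derive_val; [apply is_derive_Rmult; [apply is_derive_Rconst | exact Di] | cbv beta; field; lra]. }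
  assert (Dc : is_derive (fun _ : R => 0) s 0) by apply is_derive_Rconst.
  unfold MDerive, zx_matrix, CDerive, mk2. apply injective_projections; apply injective_projections; apply injective_projections; cbn [fst snd RtoC]; apply is_derive_unique.
  all: try (eapply is_derive_Rext; [|exact Dc]; intros t; simpl; ring).
  - eapply is_derive_val; [eapply is_derive_Rext; [|apply (D1 (/ 2) (/ 2))]|]; [intros t; pose proof (om_pos g Hg t) as Ht|].
    + unfold Eproj_plus. rewrite en_om. simpl. field. lra.
    + field. lra.
  - eapply is_derive_Rext; [|exact D2]. intros t; pose proof (om_pos g Hg t) as Ht.
    unfold Eproj_plus. rewrite en_om. simpl. field. lra.
  - eapply is_derive_Rext; [|exact D2]. intros t; pose proof (om_pos g Hg t) as Ht.
    unfold Eproj_plus. rewrite en_om. simpl. field. lra.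
  - eapply is_derive_val; [eapply is_derive_Rext; [|apply (D1 (- / 2) (/ 2))]|]; [intros t; pose proof (om_pos g Hg t) as Ht|].
    + unfold Eproj_plus. rewrite en_om. simpl. field. lra.
    + field. lra.
Qed.

Lemma integrand_rate (g : R) (gam : R -> R) (s : R) : 0 < g -> integrand g gam s = RtoC (rate g gam s).
Proof.
  intros Hg. pose proof (om_pos g Hg s) as Ho. pose proof (om_sqr g s) as Hq.
  unfold integrand. rewrite MDerive_Eproj_plus by exact Hg.
  (* The derivative of a rank-one projection is traceless, so its square is a multiple of the
     identity and the trace reduces to that of [P^-]. *)
  assert (Sq : forall p q, Mmul (zx_matrix p q) (zx_matrix p q) = Mscal (RtoC (p ^ 2 + q ^ 2)) Mid).
  { intros p q. unfold zx_matrix, Mmul, Mscal, Mid, mk2, m11, m12, m21, m22.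
    apply injective_projections; apply injective_projections; cbn [fst snd]; apply injective_projections; simpl; ring. }
  rewrite Sq.
  assert (Pm : Eproj_minus g s = mk2 (RtoC ((1 - s / om g s) / 2)) (RtoC (- g / om g s / 2)) (RtoC (- g / om g s / 2)) (RtoC ((1 + s / om g s) / 2))).
  { unfold Eproj_minus, Ham, Msub, Defs.Mopp, Madd, Mscal, Mid, mk2, m11, m12, m21, m22. rewrite en_om.
    apply injective_projections; apply injective_projections; cbn [fst snd]; apply injective_projections; simpl; field; lra. }
  assert (Tr : forall c x y w, Mtr (Mmul (mk2 (RtoC x) (RtoC y) (RtoC y) (RtoC w)) (Mmul (Mscal (RtoC c) Mid) (mk2 (RtoC x) (RtoC y) (RtoC y) (RtoC w))))
    = RtoC (c * (x ^ 2 + 2 * y ^ 2 + w ^ 2))).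
  { intros c x y w. unfold Mtr, Mmul, Mscal, Mid, mk2, m11, m12, m21, m22. cbn [fst snd].
    apply injective_projections; simpl; ring. }
  rewrite Pm, Tr, <- RtoC_mult. f_equal. rewrite en_om. unfold rate.
  pose proof (one_plus_sqr_pos (gam s)).
  transitivity (g ^ 2 * gam s * / om g s ^ 5 / (2 * (1 + gam s ^ 2))
    * ((s ^ 2 + g ^ 2) / om g s ^ 2) * ((1 + (s ^ 2 + g ^ 2) / om g s ^ 2) / 2)).
  - field. lra.
  - rewrite <- Hq. field. lra.
Qed.

Lemma rate_nonneg (g : R) (gam : R -> R) (s : R) : 0 < g -> 0 <= gam s -> 0 <= rate g gam s.
Proof.
  intros Hg H. pose proof (om_pos g Hg s) as Ho. pose proof (one_plus_sqr_pos (gam s)). unfold rate, Rdiv.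
  apply Rmult_le_pos; [|left; apply Rinv_0_lt_compat; lra].
  apply Rmult_le_pos; [nra|]. left. now apply Rinv_0_lt_compat, pow_lt.
Qed.

(** The majorant is the derivative of [atan (s / g) / g^2], which gives integrability and explicit
    tails with no dependence on [gam]. *)
Lemma rate_le (g : R) (gam : R -> R) (s : R) : 0 < g -> 0 <= gam s -> rate g gam s <= / g ^ 2 * (g / om g s ^ 2).
Proof.
  intros Hg H. pose proof (om_pos g Hg s) as Ho. pose proof (one_plus_sqr_pos (gam s)) as Hp.
  pose proof (om_ge_g g Hg s) as Hog.
  assert (E : gam s / (2 * (1 + gam s ^ 2)) <= 1).
  { apply Rmult_le_reg_r with (2 * (1 + gam s ^ 2)); [lra|].
    replace (gam s / (2 * (1 + gam s ^ 2)) * (2 * (1 + gam s ^ 2))) with (gam s) by (field; lra). nra. }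
  assert (E3 : / om g s ^ 3 <= / g ^ 3) by (apply Rinv_le_contravar; [now apply pow_lt | apply pow_incr; lra]).
  assert (P2 : 0 < / om g s ^ 2) by now apply Rinv_0_lt_compat, pow_lt.
  assert (P3 : 0 < / om g s ^ 3) by now apply Rinv_0_lt_compat, pow_lt.
  apply Rle_trans with (g ^ 2 * / om g s ^ 5 * 1).
  - unfold rate. replace (g ^ 2 * gam s * / om g s ^ 5 / (2 * (1 + gam s ^ 2)))
      with (g ^ 2 * / om g s ^ 5 * (gam s / (2 * (1 + gam s ^ 2)))) by (field; split; lra).
    apply Rmult_le_compat_l; [|exact E]. apply Rmult_le_pos; [nra|]. left. now apply Rinv_0_lt_compat, pow_lt.
  - replace (g ^ 2 * / om g s ^ 5 * 1) with (g ^ 2 * / om g s ^ 2 * / om g s ^ 3) by (field; lra).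
    replace (/ g ^ 2 * (g / om g s ^ 2)) with (g ^ 2 * / om g s ^ 2 * / g ^ 3) by (field; lra).
    apply Rmult_le_compat_l; [nra | exact E3].
Qed.

Lemma continuous_rate (g : R) (gam : R -> R) (s : R) : 0 < g -> continuous gam s -> continuous (rate g gam) s.
Proof.
  intros Hg Hc. unfold rate, Rdiv.
  assert (Hi : continuous (fun s => / om g s ^ 5) s).
  { apply (ex_derive_continuous (K := R_AbsRing) (V := R_NormedModule)). eexists. apply is_derive_inv_om_pow, Hg. }
  apply (continuous_mult (fun s => g ^ 2 * gam s * / om g s ^ 5) (fun s => / (2 * (1 + gam s ^ 2)))).
  - apply (continuous_mult (fun s => g ^ 2 * gam s) (fun s => / om g s ^ 5)); [|exact Hi].
    apply (continuous_mult (fun _ => g ^ 2) gam); [apply continuous_const | exact Hc].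
  - apply (continuous_comp gam (fun y => / (2 * (1 + y ^ 2)))); [exact Hc|].
    apply (ex_derive_continuous (K := R_AbsRing) (V := R_NormedModule)).
    pose proof (one_plus_sqr_pos (gam s)). auto_derive. nra.
Qed.

(** * Pairing with the undamped solution *)

(** [pair_Kf] multiplies the integrable error [eps^2 / om^2]; [pair_Kt] multiplies the error from
    the finite starting time, which vanishes in the limit and therefore does not enter the final
    constant. *)
Definition pair_Kf (g K0 K1 : R) : R := K0 / g ^ 2 + (K0 * K1 + (K1 / g ^ 2 + K0 * (K1 + / g ^ 2))).
Definition pair_Kt (g K0 K1 : R) : R := K0 * K1 + K1 / g ^ 2 + K0 * K1 / g ^ 3.

(** The product of the two slow manifolds, [eps kap0] for the dual solution and [- eps kap] for the
    damped one, gives exactly [- 2 eps rate]. The remaining products contain at least one of the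
    errors [eta], [etaD]. *)
Lemma pairing_bound (g : R) (gam : R -> R) (eps s K0 K1 zt : R) (z zD : C) :
  0 < g -> 0 < eps -> 0 <= gam s -> 0 <= K0 -> 0 <= K1 -> 0 <= zt ->
  Cmod (Cminus zD (Cmult (RtoC eps) (kap0 g s))) <= K0 * (eps ^ 2 * kw g (- s)) ->
  Cmod zD <= K0 * eps ->
  Cmod (Cminus z (Cmult (RtoC (- eps)) (kap g gam s))) <= K1 * (eps ^ 2 * kw g s + (1 + eps) * zt) ->
  Cmod z <= K1 * (eps + zt) ->
  Rabs (gam s * (om g s / eps) * fst (Cmult (Cconj zD) z) + 2 * eps * rate g gam s)
    <= gam s * (pair_Kf g K0 K1 * eps ^ 2 * / om g s ^ 2 + pair_Kt g K0 K1 * ((1 + eps) * zt) * om g s).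
Proof.
  intros Hg He Hgam HK0 HK1 Hzt BD BD' B B'.
  pose proof (om_pos g Hg s) as Ho. pose proof (om_ge_g g Hg s) as Hog. pose proof (one_plus_sqr_pos (gam s)) as Hp.
  set (eta := Cminus z (Cmult (RtoC (- eps)) (kap g gam s))) in *.
  set (etaD := Cminus zD (Cmult (RtoC eps) (kap0 g s))) in *.
  set (E := Cplus (Cmult (Cconj zD) eta) (Cmult (Cconj etaD) (Cmult (RtoC (- eps)) (kap g gam s)))).
  assert (Ker : fst (Cmult (Cconj (Cmult (RtoC eps) (kap0 g s))) (Cmult (RtoC (- eps)) (kap g gam s)))
    = - (eps ^ 2 * (g ^ 2 * / om g s ^ 6 / (1 + gam s ^ 2)))).
  { unfold kap0, kap, chi. simpl. field. lra. }
  assert (EE : gam s * (om g s / eps) * fst (Cmult (Cconj zD) z) + 2 * eps * rate g gam s = gam s * (om g s / eps * fst E)).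
  { assert (Ef : fst E = fst (Cmult (Cconj zD) z) - fst (Cmult (Cconj (Cmult (RtoC eps) (kap0 g s))) (Cmult (RtoC (- eps)) (kap g gam s)))).
    { unfold E, eta, etaD. destruct zD as [d1 d2], z as [z1 z2], (kap0 g s) as [k1 k2], (kap g gam s) as [l1 l2]. simpl. ring. }
    rewrite Ef, Ker. unfold rate. field. lra. }
  rewrite EE, Rabs_mult, (Rabs_right (gam s)) by lra. apply Rmult_le_compat_l; [exact Hgam|].
  assert (Hoe : 0 < om g s / eps) by (now apply Rdiv_lt_0_compat).
  rewrite Rabs_mult, (Rabs_right (om g s / eps)) by lra.
  assert (KB : Cmod (kap g gam s) <= g * / om g s ^ 3) by (apply slow_kap_bound, Hg).
  assert (KB0 : Cmod (kap0 g s) <= g * / om g s ^ 3) by (apply slow_kap_bound, Hg).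
  assert (TE : Rabs (fst E) <= Cmod zD * Cmod eta + Cmod etaD * (eps * (g * / om g s ^ 3))).
  { eapply Rle_trans; [apply abs_fst_le_Cmod|]. unfold E. eapply Rle_trans; [apply Cmod_triangle|].
    rewrite !Cmod_mult, !Cmod_conj, Cmod_R, Rabs_Ropp, (Rabs_right eps) by lra.
    apply Rplus_le_compat_l, Rmult_le_compat_l; [apply Cmod_ge_0|]. apply Rmult_le_compat_l; lra. }
  set (o := om g s) in *. set (w := (1 + eps) * zt) in *.
  assert (Hw : 0 <= w) by (unfold w; apply Rmult_le_pos; lra).
  assert (Hztw : zt <= w) by (unfold w; nra). assert (Hezw : eps * zt <= w) by (unfold w; nra).
  pose proof (Cmod_ge_0 zD) as n1. pose proof (Cmod_ge_0 eta) as n2. pose proof (Cmod_ge_0 etaD) as n3.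
  pose proof (kw_pos g Hg s) as k0. pose proof (kw_pos g Hg (- s)) as k0'.
  pose proof (kw_le_const g Hg s) as kc. pose proof (kw_le_const g Hg (- s)) as kc'.
  assert (I2 : 0 < / o ^ 2) by now apply Rinv_0_lt_compat, pow_lt.
  assert (I3 : 0 < / o ^ 3) by now apply Rinv_0_lt_compat, pow_lt.
  assert (G2 : 0 < / g ^ 2) by now apply Rinv_0_lt_compat, pow_lt.
  assert (G3 : 0 < / g ^ 3) by now apply Rinv_0_lt_compat, pow_lt.
  assert (He2 : 0 < eps ^ 2) by now apply pow_lt.
  assert (O2 : / o ^ 2 <= o * / g ^ 3).
  { replace (/ o ^ 2) with (o * / o ^ 3) by (field; lra). apply Rmult_le_compat_l; [lra|].
    apply Rinv_le_contravar; [now apply pow_lt | apply pow_incr; lra]. }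
  assert (Second : o / eps * (Cmod etaD * (eps * (g * / o ^ 3))) <= K0 / g ^ 2 * eps ^ 2 * / o ^ 2).
  { replace (o / eps * (Cmod etaD * (eps * (g * / o ^ 3)))) with (g * / o ^ 2 * Cmod etaD) by (field; lra).
    replace (K0 / g ^ 2 * eps ^ 2 * / o ^ 2) with (g * / o ^ 2 * (K0 * (eps ^ 2 * / g ^ 3))) by (field; lra).
    apply Rmult_le_compat_l; [nra|]. eapply Rle_trans; [exact BD|].
    apply Rmult_le_compat_l; [exact HK0|]. apply Rmult_le_compat_l; lra. }
  assert (Kpos : 0 <= K0 * K1) by now apply Rmult_le_pos.
  assert (First : o / eps * (Cmod zD * Cmod eta)
    <= (K0 * K1 + (K1 / g ^ 2 + K0 * (K1 + / g ^ 2))) * eps ^ 2 * / o ^ 2 + pair_Kt g K0 K1 * w * o).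
  { assert (Pe : 0 <= eps ^ 2 * / o ^ 2) by (apply Rmult_le_pos; lra).
    assert (Pw : 0 <= w * o) by (apply Rmult_le_pos; lra).
    assert (C1 : 0 <= K1 / g ^ 2) by (unfold Rdiv; apply Rmult_le_pos; lra).
    assert (C2 : 0 <= K0 * (K1 + / g ^ 2)) by (apply Rmult_le_pos; lra).
    assert (C3 : 0 <= K0 * K1 / g ^ 3) by (unfold Rdiv; apply Rmult_le_pos; lra).
    (* For [s <= 0] the error [eta] decays like [om^-3] and [zD] is merely of order [eps]. For
       [s > 0] the roles change: [eta] is only bounded, while both [kap0] and [etaD] decay like
       [om^-3]. *)
    destruct (Rle_dec s 0) as [Hs|Hs].
    - assert (ks : kw g s <= / o ^ 3) by (apply kw_le_om; assumption).
      apply Rle_trans with (o / eps * (K0 * eps * (K1 * (eps ^ 2 * / o ^ 3 + w)))).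
      + apply Rmult_le_compat_l; [lra|]. apply Rmult_le_compat; try assumption.
        eapply Rle_trans; [exact B|]. apply Rmult_le_compat_l; [exact HK1|].
        apply Rplus_le_compat_r, Rmult_le_compat_l; lra.
      + replace (o / eps * (K0 * eps * (K1 * (eps ^ 2 * / o ^ 3 + w))))
          with (K0 * K1 * (eps ^ 2 * / o ^ 2) + K0 * K1 * (w * o)) by (field; lra).
        unfold pair_Kt. rewrite !(Rmult_assoc _ (eps ^ 2)), !(Rmult_assoc _ w).
        apply Rplus_le_compat; apply Rmult_le_compat_r; lra.
    - assert (ks : kw g (- s) <= / o ^ 3) by (unfold o; rewrite <- (om_even g s); apply kw_le_om; lra).
      assert (ZD : Cmod zD <= eps * (g * / o ^ 3) + K0 * (eps ^ 2 * / o ^ 3)).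
      { replace zD with (Cplus (Cmult (RtoC eps) (kap0 g s)) etaD) by (unfold etaD; ring).
        eapply Rle_trans; [apply Cmod_triangle|]. rewrite Cmod_mult, Cmod_R, (Rabs_right eps) by lra.
        apply Rplus_le_compat; [apply Rmult_le_compat_l; lra|].
        eapply Rle_trans; [exact BD|]. apply Rmult_le_compat_l; [exact HK0|]. apply Rmult_le_compat_l; lra. }
      assert (N1 : Cmod eta <= K1 * (eps ^ 2 * / g ^ 3 + w)).
      { eapply Rle_trans; [exact B|]. apply Rmult_le_compat_l; [exact HK1|].
        apply Rplus_le_compat_r, Rmult_le_compat_l; lra. }
      assert (N2 : Cmod eta <= K1 * (eps + zt) + eps * / g ^ 2).
      { unfold eta, Cminus. eapply Rle_trans; [apply Cmod_triangle|].
        rewrite Cmod_opp, Cmod_mult, Cmod_R, Rabs_Ropp, (Rabs_right eps) by lra.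
        apply Rplus_le_compat; [exact B'|]. apply Rmult_le_compat_l; [lra|].
        eapply Rle_trans; [exact KB|]. replace (/ g ^ 2) with (g * / g ^ 3) by (field; lra).
        apply Rmult_le_compat_l; [lra|]. apply Rinv_le_contravar; [now apply pow_lt | apply pow_incr; lra]. }
      apply Rle_trans with (g * / o ^ 2 * Cmod eta + K0 * eps * / o ^ 2 * Cmod eta).
      + replace (g * / o ^ 2 * Cmod eta + K0 * eps * / o ^ 2 * Cmod eta)
          with (o / eps * ((eps * (g * / o ^ 3) + K0 * (eps ^ 2 * / o ^ 3)) * Cmod eta)) by (field; lra).
        apply Rmult_le_compat_l; [lra|]. now apply Rmult_le_compat_r.
      + assert (Q1 : g * / o ^ 2 * Cmod eta <= K1 / g ^ 2 * (eps ^ 2 * / o ^ 2) + K1 / g ^ 2 * (w * o)).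
        { apply Rle_trans with (g * / o ^ 2 * (K1 * (eps ^ 2 * / g ^ 3 + w))); [apply Rmult_le_compat_l; [nra | exact N1]|].
          replace (g * / o ^ 2 * (K1 * (eps ^ 2 * / g ^ 3 + w)))
            with (K1 / g ^ 2 * (eps ^ 2 * / o ^ 2) + g * K1 * w * / o ^ 2) by (field; lra).
          apply Rplus_le_compat_l.
          replace (K1 / g ^ 2 * (w * o)) with (g * K1 * w * (o * / g ^ 3)) by (field; lra).
          apply Rmult_le_compat_l; [|exact O2]. apply Rmult_le_pos; [apply Rmult_le_pos; lra | lra]. }
        assert (Q2 : K0 * eps * / o ^ 2 * Cmod eta <= K0 * (K1 + / g ^ 2) * (eps ^ 2 * / o ^ 2) + K0 * K1 / g ^ 3 * (w * o)).
        { apply Rle_trans with (K0 * eps * / o ^ 2 * (K1 * (eps + zt) + eps * / g ^ 2)).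
          - apply Rmult_le_compat_l; [|exact N2]. apply Rmult_le_pos; [apply Rmult_le_pos; lra | lra].
          - replace (K0 * eps * / o ^ 2 * (K1 * (eps + zt) + eps * / g ^ 2))
              with (K0 * (K1 + / g ^ 2) * (eps ^ 2 * / o ^ 2) + K0 * K1 * (eps * zt) * / o ^ 2) by (field; lra).
            apply Rplus_le_compat_l.
            replace (K0 * K1 / g ^ 3 * (w * o)) with (K0 * K1 * w * (o * / g ^ 3)) by (field; lra).
            apply Rmult_le_compat; [|lra| |exact O2].
            + apply Rmult_le_pos; [exact Kpos | apply Rmult_le_pos; lra].
            + apply Rmult_le_compat_l; assumption. }
        unfold pair_Kt. rewrite !(Rmult_assoc _ (eps ^ 2)), !(Rmult_assoc _ w).
        assert (0 <= K0 * K1 * (eps ^ 2 * / o ^ 2)) by (apply Rmult_le_pos; assumption).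
        assert (0 <= K0 * K1 * (w * o)) by (apply Rmult_le_pos; assumption).
        lra. }
  apply Rle_trans with (o / eps * (Cmod zD * Cmod eta + Cmod etaD * (eps * (g * / o ^ 3)))).
  - apply Rmult_le_compat_l; lra.
  - rewrite Rmult_plus_distr_l. unfold pair_Kf. lra.
Qed.

Lemma is_derive_pairing (g : R) (gam : R -> R) (eps : R) (a aD : R -> R) (z zD : R -> C) (s : R) :
  dephasing_flow g gam eps a z s -> dephasing_flow g (fun _ => 0) eps aD zD s ->
  is_derive (fun s => a s * aD s + fst (Cmult (Cconj (zD s)) (z s))) s
    (- (gam s * (om g s / eps) * fst (Cmult (Cconj (zD s)) (z s)))).
Proof.
  intros [Da Dz] [DaD DzD]. eapply is_derive_val.
  - exact (is_derive_Rplus _ _ _ _ _ (is_derive_Rmult _ _ _ _ _ Da DaD)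
      (proj1 (is_cderive_mult _ _ _ _ _ (is_cderive_Cconj _ _ _ DzD) Dz))).
  - cbv beta. destruct (z s) as [z1 z2], (zD s) as [d1 d2]. simpl. ring.
Qed.

Lemma om_le_om (g s T : R) : - T <= s <= T -> om g s <= om g T.
Proof. intros Hs. apply sqrt_le_1_alt. nra. Qed.

(** At [-T] the damped state is exactly the lower level, so the pairing equals [- aD (- T)] there.
    The pointwise bound is integrated with the primitive [atan (s / g)] for the weight [om^-2] and a
    linear function for the starting error. *)
Lemma pairing_estimate (g M eps T gbar : R) (gam gam1 gam2 a aD Q : R -> R) (z zD : R -> C) :
  0 < g -> 0 < eps -> 0 < T ->
  (forall s, 0 <= gam s) -> (forall s, Rabs (gam1 s) <= M) -> (forall s, Rabs (gam2 s) <= M) ->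
  (forall s, is_derive gam s (gam1 s)) -> (forall s, is_derive gam1 s (gam2 s)) ->
  (forall s, gam s <= gbar) -> (forall s, is_derive Q s (rate g gam s)) ->
  trajectory g gam eps (- T) a z -> a (- T) = -1 -> z (- T) = RtoC 0 ->
  (forall s, dephasing_flow g (fun _ => 0) eps aD zD s) ->
  (forall s, Cmod (Cminus (zD s) (Cmult (RtoC eps) (kap0 g s))) <= slow_const g 0 * (eps ^ 2 * kw g (- s))) ->
  (forall s, Cmod (zD s) <= slow_const g 0 * eps) ->
  Rabs (a T * aD T + fst (Cmult (Cconj (zD T)) (z T)) + aD (- T) - 2 * eps * (Q T - Q (- T)))
  <= gbar * (pair_Kf g (slow_const g 0) (slow_const g M) * eps ^ 2 * (PI / g)
             + pair_Kt g (slow_const g 0) (slow_const g M) * ((1 + eps) * (eps + eps ^ 2)) * (2 / T)).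
Proof.
  intros Hg He HT Hgam HM1 HM2 Dg Dg1 Hbar DQ Tr Ea Ez FlD BD BD'.
  set (K0 := slow_const g 0) in *. set (K1 := slow_const g M).
  assert (HK0 : 0 <= K0).
  { apply (slow_const_pos g 0 (fun _ => 0) Hg). intros; rewrite Rabs_R0; lra. }
  assert (HK1 : 0 <= K1) by (apply (slow_const_pos g M gam1 Hg HM1)).
  assert (Bnd : forall s, - T <= s -> Rabs (a s) <= 1 /\ Cmod (z s) <= 1).
  { intros s Hs. apply abs_Cmod_le_1.
    apply (trajectory_bounded g eps gam Hg He Hgam (- T)); assumption. }
  set (zt := (eps + eps ^ 2) * / om g T ^ 3).
  assert (Ho := om_pos g Hg T).
  assert (Hzt : 0 <= zt) by (unfold zt; apply Rmult_le_pos; [nra | left; now apply Rinv_0_lt_compat, pow_lt]).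
  assert (Slow : forall s, - T <= s ->
    Cmod (Cminus (z s) (Cmult (RtoC (- eps)) (kap g gam s))) <= K1 * (eps ^ 2 * kw g s + (1 + eps) * zt) /\
    Cmod (z s) <= K1 * (eps + zt)).
  { intros s Hs. destruct Tr as [Fl Ra R1 R2].
    assert (S := slow_manifold_bound g M gam gam1 gam2 Hg Hgam HM1 HM2 Dg Dg1 eps (- T) a z He Fl Ra R1 R2
      (fun u Hu => proj1 (Bnd u Hu)) (fun u Hu => proj2 (Bnd u Hu)) (-1) s Hs).
    replace (eps * -1) with (- eps) in S by ring.
    replace (Cmod (z (- T)) + Rabs (a (- T) - -1) + (eps + eps ^ 2) * / om g (- T) ^ 3) with zt in S; [exact S|].
    rewrite Ea, Ez, Cmod_0, om_even, Rminus_diag, Rabs_R0. unfold zt. ring. }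
  set (Kf := pair_Kf g K0 K1). set (Kt := pair_Kt g K0 K1). set (w := (1 + eps) * zt).
  assert (Hw : 0 <= w) by (unfold w; apply Rmult_le_pos; lra).
  assert (G2 : 0 < / g ^ 2) by now apply Rinv_0_lt_compat, pow_lt.
  assert (G3 : 0 < / g ^ 3) by now apply Rinv_0_lt_compat, pow_lt.
  assert (K01 : 0 <= K0 * K1) by now apply Rmult_le_pos.
  assert (HKf : 0 <= Kf).
  { unfold Kf, pair_Kf, Rdiv. assert (0 <= K0 * (K1 + / g ^ 2)) by (apply Rmult_le_pos; lra).
    assert (0 <= K0 * / g ^ 2) by (apply Rmult_le_pos; lra). assert (0 <= K1 * / g ^ 2) by (apply Rmult_le_pos; lra). lra. }
  assert (HKt : 0 <= Kt).
  { unfold Kt, pair_Kt, Rdiv. assert (0 <= K0 * K1 * / g ^ 3) by (apply Rmult_le_pos; lra).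
    assert (0 <= K1 * / g ^ 2) by (apply Rmult_le_pos; lra). lra. }
  assert (Hbar0 : 0 <= gbar) by (pose proof (Hgam 0); pose proof (Hbar 0); lra).
  set (F := fun s => a s * aD s + fst (Cmult (Cconj (zD s)) (z s)) - 2 * eps * Q s).
  assert (Gr : Cmod (RtoC (F T - F (- T))) <= Cmod (RtoC (F (- T) - F (- T)))
     + ((gbar * (Kf * eps ^ 2 / g * atan (T / g) + Kt * w * om g T * T)) - (gbar * (Kf * eps ^ 2 / g * atan (- T / g) + Kt * w * om g T * - T)))).
  { destruct Tr as [Fl Ra R1 R2].
    apply (norm_growth (fun s => RtoC (F s - F (- T)))
      (fun s => RtoC (- (gam s * (om g s / eps) * fst (Cmult (Cconj (zD s)) (z s)) + 2 * eps * rate g gam s)))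
      (fun s => gbar * (Kf * eps ^ 2 / g * atan (s / g) + Kt * w * om g T * s))
      (fun s => gbar * (Kf * eps ^ 2 * / om g s ^ 2 + Kt * w * om g T)) (- T) T).
    - lra.
    - destruct (FlD (- T)) as [dA [d1 d2]].
      apply (rcont_ext (fun s => (a s * aD s + (fst (zD s) * fst (z s) + snd (zD s) * snd (z s))) + - (2 * eps * Q s) + - F (- T))).
      { intros u. unfold F. simpl. ring. }
      apply (rcont_plus (fun s => (a s * aD s + (fst (zD s) * fst (z s) + snd (zD s) * snd (z s))) + - (2 * eps * Q s)) (fun _ => - F (- T)));
        [|apply rcont_const].
      apply rcont_plus.
      + exact (rcont_plus _ _ _ (rcont_mult _ _ _ Ra (rcont_derive _ _ _ dA))
          (rcont_plus _ _ _ (rcont_mult _ _ _ (rcont_derive _ _ _ d1) R1) (rcont_mult _ _ _ (rcont_derive _ _ _ d2) R2))).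
      + exact (rcont_opp _ _ (rcont_mult _ _ _ (rcont_const (2 * eps) (- T)) (rcont_derive _ _ _ (DQ (- T))))).
    - apply rcont_const.
    - intros s Hs. apply is_cderive_RtoC. eapply is_derive_val.
      + exact (is_derive_Rminus _ _ _ _ _ (is_derive_Rminus _ _ _ _ _
          (is_derive_pairing _ _ _ _ _ _ _ _ (Fl s (proj1 Hs)) (FlD s))
          (is_derive_Rmult _ _ _ _ _ (is_derive_Rconst (2 * eps) s) (DQ s))) (is_derive_Rconst (F (- T)) s)).
      + cbv beta. ring.
    - intros s. eapply is_derive_val.
      + exact (is_derive_Rmult _ _ _ _ _ (is_derive_Rconst gbar s)
          (is_derive_Rplus _ _ _ _ _ (is_derive_Rmult _ _ _ _ _ (is_derive_Rconst (Kf * eps ^ 2 / g) s) (is_derive_atan_scaled g Hg s))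
             (is_derive_Rlin (Kt * w * om g T) s))).
      + cbv beta. field. pose proof (om_pos g Hg s). lra.
    - intros s Hs. apply Rmult_le_pos; [exact Hbar0|].
      assert (0 < / om g s ^ 2) by (apply Rinv_0_lt_compat, pow_lt, om_pos, Hg).
      assert (0 <= Kf * eps ^ 2 * / om g s ^ 2).
      { apply Rmult_le_pos; [apply Rmult_le_pos; [exact HKf | apply pow2_ge_0] | lra]. }
      assert (0 <= Kt * w * om g T) by (apply Rmult_le_pos; [apply Rmult_le_pos; assumption | lra]). lra.
    - intros s Hs. eapply Rle_trans; [apply Re_conj_le|]. apply Rmult_le_compat_l; [apply Cmod_ge_0|].
      rewrite Cmod_R, Rabs_Ropp.
      destruct (Slow s ltac:(lra)) as [S1 S2].
      eapply Rle_trans; [apply (pairing_bound g gam eps s K0 K1 zt (z s) (zD s)); auto|].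
      fold Kf Kt w.
      assert (0 < / om g s ^ 2) by (apply Rinv_0_lt_compat, pow_lt, om_pos, Hg).
      assert (0 <= Kf * eps ^ 2 * / om g s ^ 2).
      { apply Rmult_le_pos; [apply Rmult_le_pos; [exact HKf | apply pow2_ge_0] | lra]. }
      pose proof (om_pos g Hg s).
      assert (0 <= Kt * w * om g s) by (apply Rmult_le_pos; [apply Rmult_le_pos; assumption | lra]).
      apply Rmult_le_compat; [apply Hgam | lra | apply Hbar |].
      apply Rplus_le_compat_l, Rmult_le_compat_l; [apply Rmult_le_pos; assumption|].
      apply om_le_om. lra. }
  rewrite Rminus_diag, Cmod_0, Cmod_R in Gr.
  replace (F T - F (- T)) with (a T * aD T + fst (Cmult (Cconj (zD T)) (z T)) + aD (- T) - 2 * eps * (Q T - Q (- T))) in Gr.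
  2:{ unfold F. rewrite Ea, Ez. simpl. ring. }
  eapply Rle_trans; [exact Gr|]. rewrite Rplus_0_l, <- Rmult_minus_distr_l.
  apply Rmult_le_compat_l; [exact Hbar0|].
  replace (- T / g) with (- (T / g)) by (field; lra). rewrite atan_opp.
  assert (P1 : Kf * eps ^ 2 / g * (2 * atan (T / g)) <= Kf * eps ^ 2 * (PI / g)).
  { replace (Kf * eps ^ 2 * (PI / g)) with (Kf * eps ^ 2 / g * PI) by (field; lra).
    apply Rmult_le_compat_l.
    - unfold Rdiv. apply Rmult_le_pos; [apply Rmult_le_pos; [exact HKf | apply pow2_ge_0] | left; now apply Rinv_0_lt_compat].
    - pose proof (atan_bound (T / g)). lra. }
  (* The starting error [om^-3] beats the factor [om] and the interval length [2 T], leaving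
     [2 / T]. *)
  assert (P2 : w * om g T * (2 * T) <= (1 + eps) * (eps + eps ^ 2) * (2 / T)).
  { replace (w * om g T * (2 * T)) with ((1 + eps) * (eps + eps ^ 2) * (2 * T * / om g T ^ 2)) by (unfold w, zt; field; lra).
    apply Rmult_le_compat_l; [apply Rmult_le_pos; nra|].
    replace (2 / T) with (2 * T * / T ^ 2) by (field; lra).
    apply Rmult_le_compat_l; [lra|]. apply Rinv_le_contravar; [now apply pow_lt|].
    rewrite om_sqr. nra. }
  assert (P3 : Kt * (w * om g T * (2 * T)) <= Kt * ((1 + eps) * (eps + eps ^ 2) * (2 / T))) by (apply Rmult_le_compat_l; assumption).
  lra.
Qed.

(** * Passage to infinite time and conclusion *)

Lemma le_sup_fun (f : R -> R) (M : R) : (forall s, Rabs (f s) <= M) -> forall s, f s <= sup_fun f.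
Proof.
  intros HM s. unfold sup_fun. destruct (Lub_Rbar_correct (fun x => exists s, x = f s)) as [Hub Hl].
  assert (H1 : Rbar_le (f s) (Lub_Rbar (fun x => exists s, x = f s))) by (apply Hub; now exists s).
  assert (H2 : Rbar_le (Lub_Rbar (fun x => exists s, x = f s)) M).
  { apply Hl. intros x [t ->]. simpl. pose proof (HM t). pose proof (Rle_abs (f t)). lra. }
  (* Boundedness and the attained value [f s] exclude both infinite cases, in which [real] would
     return a default. *)
  destruct (Lub_Rbar (fun x => exists s, x = f s)); simpl in *; tauto.
Qed.

Lemma rate_primitive_tail (g : R) (gam Q : R -> R) (s t : R) : 0 < g -> (forall s, 0 <= gam s) ->
  (forall s, is_derive Q s (rate g gam s)) -> s <= t ->
  0 <= Q t - Q s <= / g ^ 2 * (atan (t / g) - atan (s / g)).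
Proof.
  intros Hg Hgam DQ Hst. split.
  - assert (- Q t <= - Q s); [|lra].
    apply (nonincreasing_rcont (fun s => - Q s) (fun s => - rate g gam s)); [exact Hst | | |].
    + exact (rcont_opp _ _ (rcont_derive _ _ _ (DQ s))).
    + intros u _. apply is_derive_Ropp, DQ.
    + intros u _. pose proof (rate_nonneg g gam u Hg (Hgam u)). lra.
  - assert (Q t - / g ^ 2 * atan (t / g) <= Q s - / g ^ 2 * atan (s / g)); [|lra].
    assert (D : forall u, is_derive (fun s => Q s - / g ^ 2 * atan (s / g)) u (rate g gam u - / g ^ 2 * (g / om g u ^ 2))).
    { intros u. eapply is_derive_val.
      - exact (is_derive_Rminus _ _ _ _ _ (DQ u) (is_derive_Rmult _ _ _ _ _ (is_derive_Rconst (/ g ^ 2) u) (is_derive_atan_scaled g Hg u))).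
      - cbv beta. ring. }
    apply (nonincreasing_rcont (fun s => Q s - / g ^ 2 * atan (s / g)) (fun s => rate g gam s - / g ^ 2 * (g / om g s ^ 2))); [exact Hst | | |].
    + exact (rcont_derive _ _ _ (D s)).
    + intros u _. apply D.
    + intros u _. pose proof (rate_le g gam u Hg (Hgam u)). lra.
Qed.

(** The increments of [Q] beyond [T] are dominated by those of [atan (s / g) / g^2], so [Q] is
    Cauchy at both ends with rate proportional to [1 / T]. *)
Lemma rate_primitive_limits (g : R) (gam Q : R -> R) : 0 < g -> (forall s, 0 <= gam s) ->
  (forall s, is_derive Q s (rate g gam s)) ->
  exists l1 l2 : R, filterlim Q (Rbar_locally p_infty) (locally l1) /\
    filterlim (fun T => Q (- T)) (Rbar_locally p_infty) (locally l2).
Proof.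
  intros Hg Hgam DQ.
  assert (G2 : 0 < / g ^ 2) by now apply Rinv_0_lt_compat, pow_lt.
  assert (Ex : forall d, 0 < d -> exists T, 0 < T /\ / g ^ 2 * (g / T) < d).
  { intros d Hd. exists (2 / (g * d)). assert (0 < 2 / (g * d)) by (apply Rdiv_lt_0_compat; nra).
    split; [assumption|]. replace (/ g ^ 2 * (g / (2 / (g * d)))) with (d / 2) by (field; lra). lra. }
  destruct (filterlim_cauchy_rate Q (fun T => / g ^ 2 * (g / T))) as [l1 H1]; [|exact Ex|].
  { intros T T' HT HT'. destruct (rate_primitive_tail g gam Q T T' Hg Hgam DQ HT') as [B1 B2].
    rewrite Rabs_left1 by lra. pose proof (atan_tail g T Hg HT). pose proof (atan_bound (T' / g)).
    assert (/ g ^ 2 * (atan (T' / g) - atan (T / g)) <= / g ^ 2 * (g / T)) by (apply Rmult_le_compat_l; lra). lra. }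
  destruct (filterlim_cauchy_rate (fun T => Q (- T)) (fun T => / g ^ 2 * (g / T))) as [l2 H2]; [|exact Ex|].
  { intros T T' HT HT'. destruct (rate_primitive_tail g gam Q (- T') (- T) Hg Hgam DQ ltac:(lra)) as [B1 B2].
    rewrite Rabs_right by lra. pose proof (atan_tail g T Hg HT). pose proof (atan_bound (T' / g)).
    replace (- T / g) with (- (T / g)) in B2 by (field; lra). replace (- T' / g) with (- (T' / g)) in B2 by (field; lra).
    rewrite !atan_opp in B2.
    assert (/ g ^ 2 * (- atan (T / g) - - atan (T' / g)) <= / g ^ 2 * (g / T)) by (apply Rmult_le_compat_l; lra). lra. }
  exists l1, l2. split; assumption.
Qed.

Lemma ball_RtoC (x y : R) (e : posreal) : Rabs (y - x) < e -> ball (RtoC x) e (RtoC y).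
Proof.
  intros H. split; simpl; [exact H|]. change (Rabs (0 - 0) < e). rewrite Rminus_diag, Rabs_R0. apply cond_pos.
Qed.

Lemma is_RInt_gen_integrand (g : R) (gam Q : R -> R) (l1 l2 : R) : 0 < g ->
  (forall s, continuous gam s) -> (forall s, is_derive Q s (rate g gam s)) ->
  filterlim Q (Rbar_locally p_infty) (locally l1) ->
  filterlim (fun T => Q (- T)) (Rbar_locally p_infty) (locally l2) ->
  is_RInt_gen (integrand g gam) (Rbar_locally m_infty) (Rbar_locally p_infty) (RtoC (l1 - l2)).
Proof.
  intros Hg Hc DQ H1 H2.
  assert (HI : forall a b, is_RInt (integrand g gam) a b (RtoC (Q b - Q a))).
  { intros a b. apply (is_RInt_ext (fun s => RtoC (rate g gam s))).
    { intros s _. symmetry. now apply integrand_rate. }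
    apply (is_RInt_fct_extend_pair (fun s => RtoC (rate g gam s))); simpl.
    - apply (is_RInt_derive Q (rate g gam)); intros; [apply DQ | now apply continuous_rate].
    - assert (Z := is_RInt_const (V := R_NormedModule) a b 0).
      assert (E : scal (b - a) (0 : R_NormedModule) = 0) by apply Rmult_0_r.
      rewrite E in Z. exact Z. }
  intros P [e HP].
  assert (He2 : 0 < e / 2) by (destruct e; simpl; lra).
  destruct (H1 (fun y => Rabs (y - l1) < e / 2)) as [N1 HN1]; [exists (mkposreal _ He2); intros y Hy; exact Hy|].
  destruct (H2 (fun y => Rabs (y - l2) < e / 2)) as [N2 HN2]; [exists (mkposreal _ He2); intros y Hy; exact Hy|].
  exists (fun a => a < - N2) (fun b => N1 < b); [now exists (- N2) | now exists N1 |].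
  intros a b Ha Hb. exists (RtoC (Q b - Q a)). split; [apply HI|].
  apply HP, ball_RtoC. specialize (HN1 b Hb). specialize (HN2 (- a) ltac:(lra)). rewrite Ropp_involutive in HN2.
  replace (Q b - Q a - (l1 - l2)) with ((Q b - l1) + - (Q a - l2)) by ring.
  eapply Rle_lt_trans; [apply Rabs_triang|]. rewrite Rabs_Ropp. lra.
Qed.

Theorem theorem3p3 :
  forall g : R, 0 < g ->
  forall M : R,
  exists Cst : R,
  forall gam : R -> R,
    smooth gam ->
    (forall s, 0 <= gam s) ->
    (forall s, Rabs (gam s) <= M) ->
    (forall s, Rabs (Derive_n gam 1 s) <= M) ->
    (forall s, Rabs (Derive_n gam 2 s) <= M) ->
  forall eps : R, 0 < eps ->
  forall U : R -> R -> M2 -> M2, is_propagator g gam eps U ->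
  exists (p I : C),
    filterlim (fun T => Mtr (Mmul (Eproj_plus g T) (U T (- T) (Eproj_minus g (- T)))))
              (Rbar_locally p_infty) (locally p) /\
    is_RInt_gen (integrand g gam) (Rbar_locally m_infty) (Rbar_locally p_infty) I /\
    Cmod (Cminus p (Cplus (RtoC (exp (- PI * g ^ 2 / (2 * eps)))) (Cmult (RtoC eps) I)))
      <= Cst * sup_fun gam * eps ^ 2.
Proof.
  intros g Hg M. set (Kf := pair_Kf g (slow_const g 0) (slow_const g M)).
  (* [PI / g] is the integral of [om^-2] over the line; the division by 2 comes from
     [p = (1 + l) / 2]. *)
  exists (Kf * (PI / g) / 2).
  intros gam Hsm Hgam HM0 HM1 HM2 eps He U Hp.
  assert (Dg : forall s, is_derive gam s (Derive_n gam 1 s)) by (intros s; apply Derive_correct, (Hsm 1%nat s)).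
  assert (Dg1 : forall s, is_derive (Derive_n gam 1) s (Derive_n gam 2 s)) by (intros s; apply Derive_correct, (Hsm 2%nat s)).
  assert (Hcg : forall s, continuous gam s).
  { intros s. apply (ex_derive_continuous (K := R_AbsRing) (V := R_NormedModule)). exists (Derive_n gam 1 s). apply Dg. }
  pose proof (le_sup_fun gam M HM0) as Hsup.
  set (Q := fun s => RInt (rate g gam) 0 s).
  assert (DQ : forall s, is_derive Q s (rate g gam s)).
  { intros s. apply (is_derive_RInt (rate g gam) Q 0 s).
    - apply filter_forall. intros t. apply (RInt_correct (rate g gam)), continuous_ex_RInt.
      intros y. now apply continuous_rate.
    - now apply continuous_rate. }
  destruct (rate_primitive_limits g gam Q Hg Hgam DQ) as [l1 [l2 [L1 L2]]].
  assert (Tr : forall T, 0 < T -> trajectory g gam eps (- T) (traj_a g U T) (traj_z g U T) /\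
    traj_a g U T (- T) = -1 /\ traj_z g U T (- T) = RtoC 0).
  { intros T _. destruct (propagator_trajectory g eps gam U T Hg He Hgam Hp) as [t1 [t2 [t3 _]]]. auto. }
  destruct (family_limit g eps gam Hg He Hgam (traj_a g U) (traj_z g U) Tr) as [l Hl].
  exists (RtoC ((1 + l) / 2)), (RtoC (l1 - l2)). split; [|split].
  - intros P [e HP].
    assert (He2 : 0 < 2 * e) by (destruct e; simpl; lra).
    destruct (Hl (fun y => Rabs (y - l) < 2 * e)) as [N HN]; [exists (mkposreal _ He2); intros y Hy; exact Hy|].
    exists (Rmax 0 N). intros T HT.
    assert (HT0 : 0 < T) by (eapply Rle_lt_trans; [apply Rmax_l | exact HT]).
    assert (HTN : N < T) by (eapply Rle_lt_trans; [apply Rmax_r | exact HT]).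
    destruct (propagator_trajectory g eps gam U T Hg He Hgam Hp) as [_ [_ [_ E]]].
    rewrite E by lra. apply HP, ball_RtoC. specialize (HN T HTN).
    replace ((1 + traj_a g U T T) / 2 - (1 + l) / 2) with ((traj_a g U T T - l) * / 2) by field.
    rewrite Rabs_mult, (Rabs_right (/ 2)) by lra. lra.
  - now apply is_RInt_gen_integrand with Q.
  - set (P := exp (- PI * g ^ 2 / (2 * eps))).
    destruct (landau_zener_dual g eps Hg He) as [aD [zD [FlD [ND [BD [BD' [c [s1 [Hs1 As]]]]]]]]].
    fold P in As.
    rewrite <- RtoC_mult, <- RtoC_plus, <- RtoC_minus, Cmod_R.
    set (Kt := pair_Kt g (slow_const g 0) (slow_const g M)).
    set (gbar := sup_fun gam).
    (* The limit of the pairing estimate: [aD] and [zD] tend to 1 and 0 at [+oo], and [aD] tends to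
       [1 - 2 P] at [-oo]. *)
    assert (Main : Rabs (l + 1 - 2 * P - 2 * eps * (l1 - l2)) <= gbar * (Kf * eps ^ 2 * (PI / g))).
    { apply le_epsilon. intros d Hd.
      (* Replacing the limit [l] by its value at [T] costs [dl], replacing [l1] and [l2] costs
         [2 eps dl] each. *)
      set (dl := d / (1 + 4 * eps)).
      assert (Hdl : 0 < dl) by (unfold dl; apply Rdiv_lt_0_compat; lra).
      assert (Ed : dl + 4 * eps * dl = d) by (unfold dl; field; lra).
      destruct (Hl (fun y => Rabs (y - l) < dl)) as [N HN]; [exists (mkposreal _ Hdl); intros y Hy; exact Hy|].
      destruct (L1 (fun y => Rabs (y - l1) < dl)) as [N1 HN1]; [exists (mkposreal _ Hdl); intros y Hy; exact Hy|].
      destruct (L2 (fun y => Rabs (y - l2) < dl)) as [N2 HN2]; [exists (mkposreal _ Hdl); intros y Hy; exact Hy|].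
      (* The three [c / T] account for [aD] at [T], the transverse pairing at [T], and [aD] at [-T];
         the other part is the starting error of the pairing estimate. *)
      apply le_of_rate with (T0 := Rmax s1 (Rmax N (Rmax N1 N2) + 1))
        (c := gbar * (Kt * ((1 + eps) * (eps + eps ^ 2))) * 2 + 3 * c).
      intros T HT HT0.
      assert (T1 : s1 <= T) by (eapply Rle_trans; [apply Rmax_l | exact HT]).
      assert (T2 : Rmax N (Rmax N1 N2) < T).
      { apply Rlt_le_trans with (Rmax N (Rmax N1 N2) + 1); [lra|]. eapply Rle_trans; [apply Rmax_r | exact HT]. }
      assert (T3 : N < T) by (eapply Rle_lt_trans; [apply Rmax_l | exact T2]).
      assert (T4 : Rmax N1 N2 < T) by (eapply Rle_lt_trans; [apply Rmax_r | exact T2]).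
      assert (T5 : N1 < T) by (eapply Rle_lt_trans; [apply Rmax_l | exact T4]).
      assert (T6 : N2 < T) by (eapply Rle_lt_trans; [apply Rmax_r | exact T4]).
      specialize (HN T T3). specialize (HN1 T T5). specialize (HN2 T T6).
      destruct (As T T1) as [A1 [A2 A3]]. destruct (Tr T HT0) as [t1 [t2 t3]].
      pose proof (pairing_estimate g M eps T gbar gam _ _ (traj_a g U T) aD Q (traj_z g U T) zD Hg He HT0 Hgam HM1 HM2 Dg Dg1
        Hsup DQ t1 t2 t3 FlD BD BD') as PE. fold Kf Kt in PE.
      destruct (abs_Cmod_le_1 _ _ (trajectory_bounded g eps gam Hg He Hgam (- T) T _ _ t1 t2 t3 ltac:(lra))) as [b1 b2].
      set (at_ := traj_a g U T T) in *. set (ztT := traj_z g U T T) in *.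
      assert (B1 : Rabs (at_ * (1 - aD T)) <= c / T).
      { rewrite Rabs_mult, (Rabs_minus_sym 1). pose proof (Rabs_pos at_). pose proof (Rabs_pos (aD T - 1)). nra. }
      assert (B2 : Rabs (fst (Cmult (Cconj (zD T)) ztT)) <= c / T).
      { eapply Rle_trans; [apply abs_fst_le_Cmod|]. rewrite Cmod_mult, Cmod_conj.
        pose proof (Cmod_ge_0 (zD T)). pose proof (Cmod_ge_0 ztT). nra. }
      replace ((gbar * (Kt * ((1 + eps) * (eps + eps ^ 2))) * 2 + 3 * c) / T)
        with (gbar * (Kt * ((1 + eps) * (eps + eps ^ 2)) * (2 / T)) + 3 * (c / T)) by (field; lra).
      rewrite Rmult_plus_distr_l in PE.
      apply Rabs_le_between in PE. apply Rabs_le_between in B1. apply Rabs_le_between in B2. apply Rabs_le_between in A3.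
      apply Rabs_def2 in HN. apply Rabs_def2 in HN1. apply Rabs_def2 in HN2.
      set (x1 := gbar * (Kf * eps ^ 2 * (PI / g))) in *.
      set (x2 := gbar * (Kt * ((1 + eps) * (eps + eps ^ 2)) * (2 / T))) in *.
      set (re := fst (Cmult (Cconj (zD T)) ztT)) in *.
      assert (Q1 : - (eps * dl) <= eps * (Q T - l1) <= eps * dl) by (split; nra).
      assert (Q2 : - (eps * dl) <= eps * (Q (- T) - l2) <= eps * dl) by (split; nra).
      apply Rabs_le. split; lra. }
    replace ((1 + l) / 2 - (P + eps * (l1 - l2))) with ((l + 1 - 2 * P - 2 * eps * (l1 - l2)) * / 2) by field.
    rewrite Rabs_mult, (Rabs_right (/ 2)) by lra.
    fold gbar. lra.
Qed.
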